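(* Let $\lambda\in\mathbb{C}^3$ with $\lambda_1+\lambda_2+\lambda_3=0$, let $\ell\ge0$ and $m_1,m_2$ be integers with $|m_1|,|m_2|\le\ell$, and let $n\in\{-2,-1,0,1,2\}$. Then, as an identity of elements of the line bundle $\mathcal{L}_\lambda$, $$\pi(Z_n)D^\ell_{m_1,m_2}=\sum_{\substack{-2\le j\le 2\\ k\in\{-2,0,2\}}} c_k\,q_{k,j}(\ell,m_1)\,q_{n,j}(\ell,m_2)\,\Lambda^{(k)}_j(\lambda,\ell,m_1)\,D^{\ell+j}_{m_1+k,\,m_2+n},$$ where $c_{-2}=c_2=1$, $c_0=\sqrt{2/3}$, $\Lambda^{(-2)}_j(\lambda,\ell,m_1)=\lambda_1-\lambda_2+1-m_1$, $\Lambda^{(0)}_j(\lambda,\ell,m_1)=\lambda_1+\lambda_2-2\lambda_3+j\ell+\frac{j+j^2}{2}$, $\Lambda^{(2)}_j(\lambda,\ell,m_1)=\lambda_1-\lambda_2+1+m_1$.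
   Context: $G=SL(3,\mathbb{R})$, $K=SO(3,\mathbb{R})$. Euler angles: $k(\alpha,\beta,\gamma)=R(\alpha)S(\beta)R(\gamma)$ ($\alpha,\gamma\in\mathbb{R}/2\pi\mathbb{Z}$, $0\le\beta\le\pi$) with $R(\theta)=\begin{pmatrix}\cos\theta&-\sin\theta&0\\ \sin\theta&\cos\theta&0\\0&0&1\end{pmatrix}$, $S(\beta)=\begin{pmatrix}1&0&0\\0&\cos\beta&-\sin\beta\\0&\sin\beta&\cos\beta\end{pmatrix}$. Wigner functions ($\ell\ge0$, $|m_1|,|m_2|\le\ell$): $D^\ell_{m_1,m_2}(k(\alpha,\beta,\gamma))=(-1)^{\ell+m_2}e^{i(m_1\alpha+m_2\gamma)}\sqrt{\tfrac{(\ell+m_1)!(\ell-m_1)!}{(\ell+m_2)!(\ell-m_2)!}}\sum_{r=\max(0,m_1+m_2)}^{\min(\ell+m_1,\ell+m_2)}(-1)^r\binom{\ell+m_2}{r}\binom{\ell-m_2}{\ell+m_1-r}\cos(\tfrac\beta2)^{2r-m_1-m_2}\sin(\tfrac\beta2)^{2\ell+m_1+m_2-2r}$; by convention $D^\ell_{m_1,m_2}=0$ if $\ell<0$ or $|m_1|>\ell$ or $|m_2|>\ell$. Line bundle: $\mathcal{L}_\lambda$ is the space of (smooth) $f:G\to\mathbb{C}$ with $f(pg)=a^{1+\lambda_1}b^{\lambda_2}c^{-1+\lambda_3}f(g)$ for all upper triangular $p\in G$ with positive diagonal entries $a,b,c$; $G$ acts by right translation $\pi$, and each $D^\ell_{m_1,m_2}$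 is identified with its unique extension in $\mathcal{L}_\lambda$, i.e. $D^\ell_{m_1,m_2}(n\,\mathrm{diag}(a,b,c)\,k)=a^{1+\lambda_1}b^{\lambda_2}c^{-1+\lambda_3}D^\ell_{m_1,m_2}(k)$. Lie algebra action: $(\pi(X)f)(g)=\frac{d}{dt}\big|_{t=0}f(ge^{tX})$ for real $X$, extended complex-linearly. Elements: $Z_{-2}=\begin{pmatrix}1&i&0\\ i&-1&0\\0&0&0\end{pmatrix}$, $Z_{-1}=\begin{pmatrix}0&0&i\\0&0&-1\\ i&-1&0\end{pmatrix}$, $Z_0=\sqrt{\tfrac23}\begin{pmatrix}1&0&0\\0&1&0\\0&0&-2\end{pmatrix}$, $Z_1=\begin{pmatrix}0&0&i\\0&0&1\\ i&1&0\end{pmatrix}$, $Z_2=\begin{pmatrix}1&-i&0\\ -i&-1&0\\0&0&0\end{pmatrix}$. Clebsch–Gordan coefficients $q_{k,j}(\ell,m)=\langle 2\,k\,\ell\,m\,|\,(\ell+j)\,(k+m)\rangle$ are $0$ unless $|k|,|j|\le2$, $|m|\le\ell$, $|k+m|\le\ell+j$, $|\ell-2|\le\ell+j$, in which case $q_{k,-2}(\ell,m)=\frac{(-1)^k\sqrt{6(\ell-m)!(\ell+m)!}}{\sqrt{\ell(\ell-1)(2\ell-1)(2\ell+1)(2-k)!(2+k)!(\ell-k-m-2)!(\ell+k+m-2)!}}$, $q_{k,-1}(\ell,m)=\frac{(-1)^k(k+\ell k+2m)\sqrt{3(\ell-m)!(\ell+m)!}}{\sqrt{\ell(\ell-1)(\ell+1)(2\ell+1)(2-k)!(2+k)!(\ell-k-m-1)!(\ell+k+m-1)!}}$,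 $q_{k,0}(\ell,m)=\frac{(-1)^k(2\ell^2(k^2-1)+\ell(5k^2+6km-2)+3(k^2+3km+2m^2))\sqrt{(\ell-m)!(\ell+m)!}}{\sqrt{\ell(\ell+1)(2\ell-1)(2\ell+3)(2-k)!(2+k)!(\ell-k-m)!(\ell+k+m)!}}$, $q_{k,1}(\ell,m)=\frac{(\ell k-2m)\sqrt{3(\ell-k-m+1)!(\ell+k+m+1)!}}{\sqrt{\ell(\ell+1)(\ell+2)(2\ell+1)(2-k)!(2+k)!(\ell-m)!(\ell+m)!}}$, $q_{k,2}(\ell,m)=\frac{\sqrt{6(\ell-k-m+2)!(\ell+k+m+2)!}}{\sqrt{(\ell+1)(\ell+2)(2\ell+1)(2\ell+3)(2-k)!(2+k)!(\ell-m)!(\ell+m)!}}$. *)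

(* Defs.v *)
From HB Require Import structures.
From mathcomp Require Import all_boot all_order all_algebra.
From mathcomp Require Import complex.
From mathcomp Require Import all_classical all_reals all_analysis.

Set Implicit Arguments.
Unset Strict Implicit.
Unset Printing Implicit Defensive.

Import Order.TTheory GRing.Theory Num.Theory.
Import numFieldNormedType.Exports.

Local Open Scope classical_set_scope.
Local Open Scope complex_scope.
Local Open Scope ring_scope.

Definition mx3 (T : Type) (a00 a01 a02 a10 a11 a12 a20 a21 a22 : T) : 'M[T]_3 :=
  \matrix_(i < 3, j < 3)
    nth a00 (nth [::] [:: [:: a00; a01; a02];
                          [:: a10; a11; a12];
                          [:: a20; a21; a22]] i) j.

(* z!, as an element of R; meant for z >= 0. *)
Definition factz (R : realType) (z : int) : R := ((absz z)`!)%:R.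

Section Groups.
Variable R : realType.

Definition SL3 : set 'M[R]_3 := [set g : 'M[R]_3 | \det g = 1].

Definition SO3 : set 'M[R]_3 := [set k : 'M[R]_3 | k *m k^T = 1%:M /\ \det k = 1].

(* The group NA: upper triangular, positive diagonal, determinant 1. *)
Definition borel3 : set 'M[R]_3 :=
  [set p : 'M[R]_3 | [/\ forall i j : 'I_3, (j < i)%N -> p i j = 0,
               forall i : 'I_3, 0 < p i i
             & \det p = 1]].

Definition eulerR (t : R) : 'M[R]_3 :=
  mx3 (cos t) (- sin t) 0
      (sin t) (cos t)   0
      0       0         1.

Definition eulerS (b : R) : 'M[R]_3 :=
  mx3 1 0       0
      0 (cos b) (- sin b)
      0 (sin b) (cos b).

Definition euler (al be ga : R) : 'M[R]_3 := eulerR al *m eulerS be *m eulerR ga.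

Definition expmx (X : 'M[R]_3) : 'M[R]_3 :=
  lim (series (fun n : nat => (n`!%:R)^-1 *: X ^+ n) @ \oo).

End Groups.

Section Wigner.
Variable R : realType.

Definition expi (t : R) : R[i] := cos t +i* sin t.

(* In the range |m1|, |m2| <= l, all arguments of factz and absz and both
   exponents below are nonnegative. *)
Definition wigner_euler (l m1 m2 : int) (al be ga : R) : R[i] :=
  ((-1) ^ (l + m2) *
   Num.sqrt (factz R (l + m1) * factz R (l - m1) /
             (factz R (l + m2) * factz R (l - m2))) *
   \sum_(absz (Num.max 0 (m1 + m2))%R <= r < (absz (Num.min (l + m1) (l + m2))%R).+1)
      (-1) ^+ r * 'C(absz (l + m2)%R, r)%:R *
      'C(absz (l - m2)%R, absz (l + m1 - r%:Z)%R)%:R *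
      cos (be / 2) ^ (2 * r%:Z - m1 - m2) *
      sin (be / 2) ^ (2 * l + m1 + m2 - 2 * r%:Z))%:C *
  expi (m1%:~R * al + m2%:~R * ga).

(* The value at k in SO(3), read off from any Euler angles of k (it does not
   depend on their choice). *)
Definition wigner (l m1 m2 : int) (k : 'M[R]_3) : R[i] :=
  if [&& 0 <= l, `|m1| <= l & `|m2| <= l] then
    xget 0 [set z | exists al be ga : R,
      [/\ 0 <= be <= pi, k = euler al be ga & z = wigner_euler l m1 m2 al be ga]]
  else 0.

End Wigner.

Section LineBundle.
Variable R : realType.

(* x ^ s = exp (s * ln x), for x > 0. *)
Definition cpow (x : R) (s : R[i]) : R[i] :=
  (expR (complex.Re s * ln x))%:C * expi (complex.Im s * ln x).

Definition lb_char (lam1 lam2 lam3 : R[i]) (p : 'M[R]_3) : R[i] :=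
  cpow (p 0 0) (1 + lam1) * cpow (p 1 1) lam2 * cpow (p 2 2) (-1 + lam3).

(* Functions on SL(3,R) are functions on all matrices, of which only the values
   on SL3 are relevant. *)

Definition pi_derivable (X : 'M[R]_3) (f : 'M[R]_3 -> R[i]) (g : 'M[R]_3) : Prop :=
  derivable (fun t : R => complex.Re (f (g *m expmx (t *: X)))) 0 1 /\
  derivable (fun t : R => complex.Im (f (g *m expmx (t *: X)))) 0 1.

Definition pi_real (X : 'M[R]_3) (f : 'M[R]_3 -> R[i]) (g : 'M[R]_3) : R[i] :=
  derive1 (fun t : R => complex.Re (f (g *m expmx (t *: X)))) 0 +i*
  derive1 (fun t : R => complex.Im (f (g *m expmx (t *: X)))) 0.

Definition pi_act (Z : 'M[R[i]]_3) (f : 'M[R]_3 -> R[i]) (g : 'M[R]_3) : R[i] :=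
  pi_real (map_mx (@complex.Re R) Z) f g +
  'i%C * pi_real (map_mx (@complex.Im R) Z) f g.

(* C^n on the Lie group SL(3,R), in terms of iterated derivatives along
   left-invariant vector fields, i.e. traceless matrices. *)
Fixpoint Cn_SL3 (n : nat) (f : 'M[R]_3 -> R[i]) : Prop :=
  {within @SL3 R, continuous (fun g => complex.Re (f g))} /\
  {within @SL3 R, continuous (fun g => complex.Im (f g))} /\
  if n is n'.+1 then
    forall X : 'M[R]_3, \tr X = 0 ->
      (forall g, SL3 g -> pi_derivable X f g) /\ Cn_SL3 n' (pi_real X f)
  else True.

Definition smooth_SL3 (f : 'M[R]_3 -> R[i]) : Prop := forall n, Cn_SL3 n f.

Definition line_bundle (lam1 lam2 lam3 : R[i]) : set ('M[R]_3 -> R[i]) :=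
  [set f | smooth_SL3 f /\
    forall p g, borel3 p -> SL3 g ->
      f (p *m g) = lb_char lam1 lam2 lam3 p * f g].

(* The extension of phi : SO(3) -> C to SL(3,R) along the Iwasawa
   decomposition g = p k. *)
Definition lb_ext (lam1 lam2 lam3 : R[i]) (phi : 'M[R]_3 -> R[i])
    (g : 'M[R]_3) : R[i] :=
  xget 0 [set z | exists p k : 'M[R]_3,
    [/\ borel3 p, SO3 k, g = p *m k & z = lb_char lam1 lam2 lam3 p * phi k]].

Definition wignerL (lam1 lam2 lam3 : R[i]) (l m1 m2 : int) : 'M[R]_3 -> R[i] :=
  lb_ext lam1 lam2 lam3 (wigner l m1 m2).

Definition Zmx (n : int) : 'M[R[i]]_3 :=
  if n == -2 then
    mx3 1    'i%C 0
        'i%C (-1) 0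
        0    0    0
  else if n == -1 then
    mx3 0    0    'i%C
        0    0    (-1)
        'i%C (-1) 0
  else if n == 0 then
    (Num.sqrt (2 / 3))%:C *:
    mx3 1 0 0
        0 1 0
        0 0 (-2)
  else if n == 1 then
    mx3 0    0 'i%C
        0    0 1
        'i%C 1 0
  else if n == 2 then
    mx3 1        (- 'i%C) 0
        (- 'i%C) (-1)     0
        0        0        0
  else 0.

End LineBundle.

Section ClebschGordan.
Variable R : realType.

(* In the range where cg is not 0 by definition, the arguments of the factorials
   are nonnegative and the denominators nonzero. *)
Local Notation fct := (factz R).

Definition cg_m2 (k l m : int) : R :=
  (-1) ^ k * Num.sqrt (6 * fct (l - m) * fct (l + m)) /
  Num.sqrt ((l * (l - 1) * (2 * l - 1) * (2 * l + 1))%:~R *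
            fct (2 - k) * fct (2 + k) * fct (l - k - m - 2) * fct (l + k + m - 2)).

Definition cg_m1 (k l m : int) : R :=
  (-1) ^ k * (k + l * k + 2 * m)%:~R * Num.sqrt (3 * fct (l - m) * fct (l + m)) /
  Num.sqrt ((l * (l - 1) * (l + 1) * (2 * l + 1))%:~R *
            fct (2 - k) * fct (2 + k) * fct (l - k - m - 1) * fct (l + k + m - 1)).

Definition cg_0 (k l m : int) : R :=
  (-1) ^ k *
  (2 * l ^+ 2 * (k ^+ 2 - 1) + l * (5 * k ^+ 2 + 6 * k * m - 2) +
   3 * (k ^+ 2 + 3 * k * m + 2 * m ^+ 2))%:~R *
  Num.sqrt (fct (l - m) * fct (l + m)) /
  Num.sqrt ((l * (l + 1) * (2 * l - 1) * (2 * l + 3))%:~R *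
            fct (2 - k) * fct (2 + k) * fct (l - k - m) * fct (l + k + m)).

Definition cg_1 (k l m : int) : R :=
  (l * k - 2 * m)%:~R * Num.sqrt (3 * fct (l - k - m + 1) * fct (l + k + m + 1)) /
  Num.sqrt ((l * (l + 1) * (l + 2) * (2 * l + 1))%:~R *
            fct (2 - k) * fct (2 + k) * fct (l - m) * fct (l + m)).

Definition cg_2 (k l m : int) : R :=
  Num.sqrt (6 * fct (l - k - m + 2) * fct (l + k + m + 2)) /
  Num.sqrt (((l + 1) * (l + 2) * (2 * l + 1) * (2 * l + 3))%:~R *
            fct (2 - k) * fct (2 + k) * fct (l - m) * fct (l + m)).

(* q_{k,j}(l,m) = < 2 k l m | (l+j) (k+m) > *)
Definition cg (k j l m : int) : R :=
  if [&& `|k| <= 2, `|j| <= 2, `|m| <= l, `|k + m| <= l + j & `|l - 2| <= l + j]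
  then
    if j == -2 then cg_m2 k l m
    else if j == -1 then cg_m1 k l m
    else if j == 0 then cg_0 k l m
    else if j == 1 then cg_1 k l m
    else cg_2 k l m
  else 0.

End ClebschGordan.

Section Coefficients.
Variable R : realType.

Definition coef_c (k : int) : R := if k == 0 then Num.sqrt (2 / 3) else 1.

Definition Lambda (k j : int) (lam1 lam2 lam3 : R[i]) (l m1 : int) : R[i] :=
  if k == -2 then lam1 - lam2 + 1 - m1%:~R
  else if k == 0 then
    lam1 + lam2 - 2 * lam3 + (j * l)%:~R + (j + j ^+ 2)%:~R / 2
  else lam1 - lam2 + 1 + m1%:~R.

End Coefficients.

(* Main.v *)
(* Write a rotation through its spinor [a, b, c, d], [ad - bc = 1] (the double cover
   by SU(2)).  Up to the factor [sqrt ((l+m1)! (l-m1)! (l+m2)! (l-m2)!)], the Wigner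
   function is the sum [wigU] of products of divided powers
   [a^r b^(p-r) c^(i-r) d^(N-i-p+r)], with [N = 2l], [i = l + m1], [p = l + m2].
   Multiplying [wigU] by a monomial only changes the weights of this sum, so the
   Clebsch-Gordan expansion of a product with a spin 2 function, made homogeneous by
   powers of [ad - bc], amounts to an identity between rational weights; the cases
   [l = 0, 1], where denominators vanish, are finitely many numerical identities.

   On the analytic side, the Iwasawa factors of [g] are algebraic in [g], and [wigU] is
   a polynomial in the entries of the rotation.  For [Y = k Z k^-1], differentiating
   along [Z] at a rotation [k] multiplies by a linear form in the diagonal of [Y] and
   rotates [k] by the skew matrix with the entries of [Y] below the diagonal; all entries
   of [Y] are spin 2 functions of [k].  Equivariance under the upper triangular group
   extends the identity from rotations to [SL(3)]. *)
Require Import Defs.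
From Corelib Require BinNums.
From HB Require Import structures.
From mathcomp Require Import all_boot all_order all_algebra.
From mathcomp Require Import complex.
From mathcomp Require Import all_classical all_reals all_analysis.
From mathcomp Require Import ring zify ssrZ.

Set Implicit Arguments.
Unset Strict Implicit.
Unset Printing Implicit Defensive.

Import Order.TTheory GRing.Theory Num.Theory.
Import numFieldNormedType.Exports.

Local Open Scope classical_set_scope.
Local Open Scope complex_scope.
Local Open Scope ring_scope.

(** * Divided powers, and the weights by which monomials act on them *)

Section Weights.
Variable T : comNzRingType.
Implicit Types x A B C D : T.

(** With [L = d + c s + b t + a s t], the sum [wigU N i p] is the coefficient of [s^i t^p] in
    [L^N / N!]; [spin_quad] lists the coefficients of [L^2 / 2] and [quartic] those of [L^4]. A
    rotation fixes its spinor only up to sign, so differentiation cannot go through [a, b, c, d].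
    The coefficients of [L^2 / 2] do not see the sign and are linear in the entries of the rotation,
    and [L^(2n)] is a power of [L^2]. Terms of the derivative that keep [m1] in the Wigner function
    need only the product expansions for [k = -2, 0, 2]. The infinitesimal rotation also shifts [m1]
    by one, in opposite directions in the quartic and in the Wigner function. These terms form the
    mixed part of the Casimir operator on a tensor product, which acts on the component of spin
    [l + j] by a scalar. This is the origin of [j l + (j + j^2) / 2], which is half of
    [(l + j)(l + j + 1) - l (l + 1)]. *)

Fixpoint ffall x (n : nat) : T := if n is n'.+1 then x * ffall (x - 1) n' else 1.

(* A homogeneous polynomial in [a, b, c, d] is encoded by its list of terms
   [(coefficient, (e1, e2, e3, e4))], meaning [a^e1 b^e2 c^e3 d^e4]. *)
Definition mono : Type := (T * (nat * nat * nat * nat))%type.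

(** [A, B, C, D] are the exponents of a term after multiplication: each variable contributes a
    falling factorial, by [x^e x^(n-e) / (n-e)! = n (n-1) ... (n-e+1) x^n / n!]. *)
Definition mono_weight A B C D (t : mono) : T :=
  let: (q, (e1, e2, e3, e4)) := t in
  q * (ffall A e1 * ffall B e2 * ffall C e3 * ffall D e4).

Definition poly_weight A B C D (s : seq (mono)) : T :=
  foldr (fun t z => mono_weight A B C D t + z) 0 s.

(** Expanded powers of [a d - b c]. The exponent used is [2 - j], at most 4, which raises the degree
    [2l + 2j] to the common degree [2l + 4]. *)
Definition detpow (t : nat) : seq mono :=
  match t with
  | 0 => [:: (1, (0, 0, 0, 0)%N)]
  | 1 => [:: (1, (1, 0, 0, 1)%N); (-1, (0, 1, 1, 0)%N)]
  | 2 => [:: (1, (2, 0, 0, 2)%N); (- 2%:R, (1, 1, 1, 1)%N); (1, (0, 2, 2, 0)%N)]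
  | 3 => [:: (1, (3, 0, 0, 3)%N); (- 3%:R, (2, 1, 1, 2)%N); (3%:R, (1, 2, 2, 1)%N); (-1, (0, 3, 3, 0)%N)]
  | _ => [:: (1, (4, 0, 0, 4)%N); (- 4%:R, (3, 1, 1, 3)%N); (6%:R, (2, 2, 2, 2)%N); (- 4%:R, (1, 3, 3, 1)%N);
             (1, (0, 4, 4, 0)%N)]
  end.

End Weights.

Arguments detpow : clear implicits.

Section DividedPowers.
Variable F : numFieldType.
Implicit Types (x y : F) (e N i p : int).

(** The value 0 at negative exponents makes the multiplication rule hold for all integers (at
    [e = -1] the factor [e + 1] vanishes) and makes the bounds of summation immaterial. *)
Definition divpow x e : F := if e is Posz k then x ^+ k / k`!%:R else 0.

Lemma mul_divpow x e : x * divpow x e = (e + 1)%:~R * divpow x (e + 1).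
Proof.
case: e => [k|[|k]]; rewrite ?mulr0.
- have -> : Posz k + 1 = k.+1 by lia.
  rewrite /divpow factS natrM exprS invfM -[k.+1%:~R]/(k.+1%:R).
  have hy : (k.+1%:R : F) != 0 by rewrite pnatr_eq0.
  move: (k.+1%:R : F) hy => y hy.
  by rewrite -mulrA (mulrCA _ y^-1) (mulrCA _ y^-1) mulVKf // !mulrA.
- by have -> : Negz 0 + 1 = 0 by []; rewrite mul0r.
- by rewrite /= ?mulr0.
Qed.

Lemma exp_mul_divpow x n e :
  x ^+ n * divpow x e = ffall (e + n%:Z)%:~R n * divpow x (e + n%:Z).
Proof.
elim: n e => [|n IH] e; first by rewrite expr0 /= addr0.
rewrite exprSr -mulrA mul_divpow mulrCA IH mulrA.
have -> : e + 1 + n%:Z = e + n.+1%:Z by lia.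
congr (_ * _).
have H : forall z : F, (z - n%:R) * ffall z n = z * ffall (z - 1) n.
  elim: n {IH} => [|n IHn] z /=; first by ring.
  rewrite -[X in _ = _ * X]IHn mulrCA; congr (_ * (_ * _)).
  by rewrite -natr1; ring.
by rewrite /= -H; congr (_ * _); rewrite -[X in _ - X]/(n%:~R) -rmorphB /=; congr (_%:~R); lia.
Qed.

Lemma ffall_nat0 (r n : nat) : (r < n)%N -> ffall (r%:R : F) n = 0.
Proof.
elim: n r => [|n IH] [|r] //= h; first by rewrite mul0r.
by rewrite -natr1 addrK IH // mulr0.
Qed.

Variables a b c d : F.

Definition wterm (w : F -> F -> F -> F -> F) N i p (r : int) : F :=
  w r%:~R (p - r)%:~R (i - r)%:~R (N - i - p + r)%:~R *
  (divpow a r * divpow b (p - r) * divpow c (i - r) * divpow d (N - i - p + r)).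

Definition wsum w N i p : F := \sum_(0 <= r < (absz p).+1) wterm w N i p r%:Z.

Definition wigU N i p : F := wsum (fun _ _ _ _ => 1) N i p.

Lemma divpow_lt0 x e : e < 0 -> divpow x e = 0.
Proof. by case: e. Qed.

Lemma wsum_widen w N i p (M : nat) : (absz p < M)%N ->
  wsum w N i p = \sum_(0 <= r < M) wterm w N i p r%:Z.
Proof.
move=> h; rewrite /wsum [RHS](big_cat_nat (n := (absz p).+1)) //= [X in _ = _ + X]big_nat.
rewrite [X in _ = _ + X]big1 ?addr0 // => r /andP[h1 _].
by rewrite /wterm (@divpow_lt0 b) ?(mulr0, mul0r) //; lia.
Qed.

Lemma wigU_out N i p : ~~ [&& 0 <= i, 0 <= p, i <= N & p <= N] -> wigU N i p = 0.
Proof.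
move=> h; rewrite /wigU /wsum big1 // => r _; rewrite /wterm.
have [h1|h1] := ltP (p - r%:Z) 0; first by rewrite (divpow_lt0 b h1) !(mulr0, mul0r).
have [h2|h2] := ltP (i - r%:Z) 0; first by rewrite (divpow_lt0 c h2) !(mulr0, mul0r).
have [h3|h3] := ltP (N - i - p + r%:Z) 0; first by rewrite (divpow_lt0 d h3) !(mulr0, mul0r).
by exfalso; move/negP: h; apply; apply/and4P; split; lia.
Qed.

Definition mono_eval (t : mono F) : F :=
  let: (q, (e1, e2, e3, e4)) := t in q * (a ^+ e1 * b ^+ e2 * c ^+ e3 * d ^+ e4).

Definition mono_shift (N i p N' i' p' : int) (t : mono F) : bool :=
  let: (_, (e1, e2, e3, e4)) := t in
  [&& N' == N + (e1 + e2 + e3 + e4)%N%:Z, i' == i + (e1 + e3)%N%:Z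
    & p' == p + (e1 + e2)%N%:Z].

(** The substitution [r -> r + e1] matches the terms; the first [e1] terms on the right have no
    source, and their factor [ffall r e1] is zero. *)
Lemma mono_mul_wigU t N i p N' i' p' : mono_shift N i p N' i' p' t ->
  mono_eval t * wigU N i p = wsum (fun A B C D => mono_weight A B C D t) N' i' p'.
Proof.
case: t => q [[[e1 e2] e3] e4] /and3P[/eqP-> /eqP-> /eqP->].
set P := (p + _).
rewrite /wigU (@wsum_widen _ _ _ _ (absz p + absz P).+1); last by lia.
rewrite (@wsum_widen _ _ _ P (e1 + (absz p + absz P).+1)); last by lia.
rewrite [RHS](big_cat_nat (n := e1)) //= ?leq_addr //.
rewrite [X in _ = X + _]big_nat [X in _ = X + _]big1 ?add0r; last first.
  move=> r /andP[_ hr]; rewrite /wterm /mono_weight.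
  by rewrite -pmulrn ffall_nat0 // !(mulr0, mul0r).
rewrite (big_addn 0 _ e1) addKn mulr_sumr; apply: eq_bigr => r _.
rewrite /wterm /mono_eval /mono_weight mul1r.
have -> : (r + e1)%N%:Z = r%:Z + e1%:Z by lia.
have -> : P - (r%:Z + e1%:Z) = p - r%:Z + e2%:Z by rewrite /P; lia.
have -> : i + (e1 + e3)%N%:Z - (r%:Z + e1%:Z) = i - r%:Z + e3%:Z by lia.
have -> : N + (e1 + e2 + e3 + e4)%N%:Z - (i + (e1 + e3)%N%:Z) - P + (r%:Z + e1%:Z)
          = N - i - p + r%:Z + e4%:Z by rewrite /P; lia.
move: (exp_mul_divpow a e1 r) (exp_mul_divpow b e2 (p - r%:Z))
  (exp_mul_divpow c e3 (i - r%:Z)) (exp_mul_divpow d e4 (N - i - p + r%:Z)).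
move=> Ha Hb Hc Hd.
transitivity (q * ((a ^+ e1 * divpow a r) * (b ^+ e2 * divpow b (p - r%:Z)) *
   (c ^+ e3 * divpow c (i - r%:Z)) * (d ^+ e4 * divpow d (N - i - p + r%:Z)))); first by ring.
by rewrite Ha Hb Hc Hd; ring.
Qed.

Definition poly_eval (s : seq (mono F)) : F := foldr (fun t z => mono_eval t + z) 0 s.

Lemma wsum_add w1 w2 N i p : wsum w1 N i p + wsum w2 N i p =
  wsum (fun A B C D => w1 A B C D + w2 A B C D) N i p.
Proof. by rewrite /wsum -big_split; apply: eq_bigr => r _; rewrite /wterm mulrDl. Qed.

Lemma wsum_scale q w N i p : q * wsum w N i p = wsum (fun A B C D => q * w A B C D) N i p.
Proof. by rewrite /wsum mulr_sumr; apply: eq_bigr => r _; rewrite /wterm mulrA. Qed.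

(** Terms with a negative exponent vanish by themselves, so a weight matters only at natural
    exponents, and their three linear relations leave one degree of freedom. *)
Lemma wsum_eq0 w N i p :
  (forall A B C D : nat, A%:Z + B%:Z = p -> A%:Z + C%:Z = i ->
     A%:Z + B%:Z + C%:Z + D%:Z = N -> w A%:R B%:R C%:R D%:R = 0) -> wsum w N i p = 0.
Proof.
move=> h; rewrite /wsum big1 // => r _; rewrite /wterm.
case eB: (p - r%:Z) => [B|B]; last by rewrite !(mulr0, mul0r).
case eC: (i - r%:Z) => [C|C]; last by rewrite !(mulr0, mul0r).
case eD: (N - i - p + r%:Z) => [D|D]; last by rewrite !(mulr0, mul0r).
by rewrite -!pmulrn (h r B C D) ?mul0r //; lia.
Qed.

Lemma poly_mul_wigU s N i p N' i' p' : all (mono_shift N i p N' i' p') s ->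
  poly_eval s * wigU N i p = wsum (fun A B C D => poly_weight A B C D s) N' i' p'.
Proof.
elim: s => [_|t s IH] /=.
  by rewrite mul0r wsum_eq0.
by case/andP=> h1 h2; rewrite mulrDl (mono_mul_wigU h1) (IH h2) wsum_add.
Qed.

Definition summand : Type := (F * seq (mono F) * (int * int * int))%type.

Definition summand_eval (t : summand) : F :=
  let: (q, s, (N, i, p)) := t in q * (poly_eval s * wigU N i p).

(** Equal total degrees merge all summands into a single [wsum]. The product expansions, the Casimir
    identity and the recursion of [wigV] are all reduced to weights in this way. *)
Lemma lincomb_eq0 (N i p : int) (s : seq summand) :
  all (fun t => let: (_, r, (N0, i0, p0)) := t in all (mono_shift N0 i0 p0 N i p) r) s ->
  (forall A B C D : nat, A%:Z + B%:Z = p -> A%:Z + C%:Z = i ->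
     A%:Z + B%:Z + C%:Z + D%:Z = N ->
     foldr (fun t z => t.1.1 * poly_weight A%:R B%:R C%:R D%:R t.1.2 + z) 0 s = 0) ->
  foldr (fun t z => summand_eval t + z) 0 s = 0.
Proof.
move=> hs hw; rewrite -[RHS](@wsum_eq0 (fun A B C D =>
  foldr (fun t z => t.1.1 * poly_weight A B C D t.1.2 + z) 0 s) _ _ _ hw) {hw}.
elim: s hs => [_|t s IH] /=; first by rewrite wsum_eq0.
case/andP=> h1 h2; rewrite (IH h2) -wsum_add; congr (_ + _).
case: t h1 => -[q r] [[N0 i0] p0] h1 /=.
by rewrite (poly_mul_wigU h1) wsum_scale.
Qed.

Lemma detpow_eval t : a * d - b * c = 1 -> poly_eval (detpow F t) = 1.
Proof.
move=> h; have -> : poly_eval (detpow F t) = (a * d - b * c) ^+ (minn t 4).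
  by case: t => [|[|[|[|t]]]]; rewrite /poly_eval /= ?minnSS ?minn0; ring.
by rewrite h expr1n.
Qed.

Lemma detpow_shift (t : nat) N i p N' i' p' : (t <= 4)%N ->
  N' = N + t.*2%:Z -> i' = i + t%:Z -> p' = p + t%:Z ->
  all (mono_shift N i p N' i' p') (detpow F t).
Proof.
move=> ht -> -> ->; case: t ht => [|[|[|[|[|t]]]]] // _; rewrite /= /mono_shift;
  by do !(apply/andP; split => //); apply/eqP; lia.
Qed.

End DividedPowers.

Arguments poly_eval : simpl never.
Arguments poly_weight : simpl never.
Arguments detpow : simpl never.

(** * Spin 2 quartics and rational parts of Clebsch-Gordan coefficients *)

Section GenericCoefficients.
Variable T : comNzRingType.

(* [24 * wigU 4 i p]. *)
Definition quartic (i p : nat) : seq (mono T) :=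
  match i, p with
  | 0, 0 => [:: (1, (0, 0, 0, 4)%N)]
  | 0, 1 => [:: (4%:R, (0, 1, 0, 3)%N)]
  | 0, 2 => [:: (6%:R, (0, 2, 0, 2)%N)]
  | 0, 3 => [:: (4%:R, (0, 3, 0, 1)%N)]
  | 0, 4 => [:: (1, (0, 4, 0, 0)%N)]
  | 1, 0 => [:: (4%:R, (0, 0, 1, 3)%N)]
  | 1, 1 => [:: (12%:R, (0, 1, 1, 2)%N); (4%:R, (1, 0, 0, 3)%N)]
  | 1, 2 => [:: (12%:R, (0, 2, 1, 1)%N); (12%:R, (1, 1, 0, 2)%N)]
  | 1, 3 => [:: (4%:R, (0, 3, 1, 0)%N); (12%:R, (1, 2, 0, 1)%N)]
  | 1, 4 => [:: (4%:R, (1, 3, 0, 0)%N)]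
  | 2, 0 => [:: (6%:R, (0, 0, 2, 2)%N)]
  | 2, 1 => [:: (12%:R, (0, 1, 2, 1)%N); (12%:R, (1, 0, 1, 2)%N)]
  | 2, 2 => [:: (6%:R, (0, 2, 2, 0)%N); (24%:R, (1, 1, 1, 1)%N); (6%:R, (2, 0, 0, 2)%N)]
  | 2, 3 => [:: (12%:R, (1, 2, 1, 0)%N); (12%:R, (2, 1, 0, 1)%N)]
  | 2, 4 => [:: (6%:R, (2, 2, 0, 0)%N)]
  | 3, 0 => [:: (4%:R, (0, 0, 3, 1)%N)]
  | 3, 1 => [:: (4%:R, (0, 1, 3, 0)%N); (12%:R, (1, 0, 2, 1)%N)]
  | 3, 2 => [:: (12%:R, (1, 1, 2, 0)%N); (12%:R, (2, 0, 1, 1)%N)]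
  | 3, 3 => [:: (12%:R, (2, 1, 1, 0)%N); (4%:R, (3, 0, 0, 1)%N)]
  | 3, 4 => [:: (4%:R, (3, 1, 0, 0)%N)]
  | 4, 0 => [:: (1, (0, 0, 4, 0)%N)]
  | 4, 1 => [:: (4%:R, (1, 0, 3, 0)%N)]
  | 4, 2 => [:: (6%:R, (2, 0, 2, 0)%N)]
  | 4, 3 => [:: (4%:R, (3, 0, 1, 0)%N)]
  | 4, 4 => [:: (1, (4, 0, 0, 0)%N)]
  | _, _ => [::]
  end.

Arguments quartic : simpl never.

(** The product [(x + 1) ... (x + n)], that is [(x + n)! / x!]. *)
Fixpoint rise (x : T) (n : nat) : T := if n is n'.+1 then (x + n%:R) * rise x n' else 1.

Definition sgnz (k : int) : T := if odd (absz k) then -1 else 1.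

(* [rcg j k l m] and [rcg_den j l] are the rational parts of the Clebsch-Gordan
   coefficient [cg k j l m], once its factorials are absorbed into the
   normalization of the Wigner functions. *)
Definition rcg (j k : int) (x y : T) : T :=
  if j == -2 then sgnz k
  else if j == -1 then sgnz k * (k%:~R + x * k%:~R + 2 * y)
  else if j == 0 then
    sgnz k * (2 * x ^+ 2 * (k%:~R ^+ 2 - 1) + x * (5 * k%:~R ^+ 2 + 6 * k%:~R * y - 2) +
     3 * (k%:~R ^+ 2 + 3 * k%:~R * y + 2 * y ^+ 2))
  else if j == 1 then
    if k == -2 then - 2 * rise (x - y) 3
    else if k == 2 then 2 * rise (x + y) 3
    else (x * k%:~R - 2 * y) * rise (x + y) (absz (1 + k)) * rise (x - y) (absz (1 - k))
  else rise (x + y) (absz (2 + k)) * rise (x - y) (absz (2 - k)).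

End GenericCoefficients.

Arguments quartic : clear implicits.

Ltac compute_nat :=
  repeat match goal with
  | |- context [absz ?t] =>
      let v := eval vm_compute in (absz t) in change (absz t) with v
  end;
  repeat match goal with
  | |- context [binomial ?u ?t] =>
      let v := eval vm_compute in (binomial u t) in change (binomial u t) with v
  end.

(** * Product expansions and the Casimir identity in terms of weights *)

Section ClebschGordanIdentities.
Variable F : numFieldType.

(** The part of a squared coefficient that depends on [j] and [l] only. As the inverse of 0 is 0, it
    vanishes for [l = 0, j < 2] and for [l = 1, j < 0], exactly where the triangle condition
    [|l - 2| <= l + j] fails. *)
Definition rcg_den (j : int) (x : F) : F :=
  if j == -2 then 6 / (x * (x - 1) * (2 * x - 1) * (2 * x + 1))
  else if j == -1 then 3 / (x * (x - 1) * (x + 1) * (2 * x + 1))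
  else if j == 0 then 1 / (x * (x + 1) * (2 * x - 1) * (2 * x + 3))
  else if j == 1 then 3 / (x * (x + 1) * (x + 2) * (2 * x + 1))
  else 6 / ((x + 1) * (x + 2) * (2 * x + 1) * (2 * x + 3)).

(** The binomials stand for [24 / ((2-k)! (2+k)!)] and the same with [n]; one factor 24 remains
    because [quartic] is 24 times a [wigU]. *)
Definition cgprod (k n j : int) (x y z : F) : F :=
  'C(4, absz (2 + k))%:R * 'C(4, absz (2 + n))%:R / 24 *
  rcg_den j x * rcg j k x y * rcg j n x z.

Lemma quartic_shift (i0 p0 : nat) (N i p : int) (N' i' p' : int) :
  N' = N + 4 -> i' = i + i0%:Z -> p' = p + p0%:Z ->
  all (mono_shift N i p N' i' p') (quartic F i0 p0).
Proof.
move=> -> -> ->; case: i0 p0 => [|[|[|[|[|i0]]]]] [|[|[|[|[|p0]]]]] //;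
  by rewrite /quartic /= /mono_shift; do !(apply/andP; split => //); apply/eqP; lia.
Qed.

Variables a b c d : F.
Hypothesis abcd : a * d - b * c = 1.
Variables l m1 m2 : int.
Local Notation x := (l%:~R : F).
Local Notation y := (m1%:~R : F).
Local Notation z := (m2%:~R : F).
Local Notation U := (wigU a b c d).

Lemma large_neq0 : 2 <= l ->
  [/\ x != 0, x - 1 != 0, x + 1 != 0 & x + 2 != 0] /\
  [/\ 2 * x - 1 != 0, 2 * x + 1 != 0 & 2 * x + 3 != 0].
Proof.
move=> hl; do !split.
- by rewrite intr_eq0; lia.
- by rewrite -(intrB F l 1) intr_eq0; lia.
- by rewrite -(intrD F l 1) intr_eq0; lia.
- by rewrite -(intrD F l 2) intr_eq0; lia.
- by rewrite -(intrM F 2 l) -(intrB F _ 1) intr_eq0; lia.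
- by rewrite -(intrM F 2 l) -(intrD F _ 1) intr_eq0; lia.
- by rewrite -(intrM F 2 l) -(intrD F _ 3) intr_eq0; lia.
Qed.

(** Powers of [a d - b c = 1] are dropped here, so the right side is not homogeneous; they are
    restored before weights are compared. *)
Definition quartic_identity (k n : int) : Prop :=
  poly_eval a b c d (quartic F (absz (2 + k)) (absz (2 + n))) * U (2 * l) (l + m1) (l + m2) =
  \sum_(j <- [:: -2; -1; 0; 1; 2]) cgprod k n j x y z *
     U (2 * l + 2 * j) (l + j + m1 + k) (l + j + m2 + n).

Definition quartic_weight_identity (k n : int) (x y z A B C D : F) : Prop :=
  poly_weight A B C D (quartic F (absz (2 + k)) (absz (2 + n))) =
  cgprod k n (-2) x y z * poly_weight A B C D (detpow F 4) +
  cgprod k n (-1) x y z * poly_weight A B C D (detpow F 3) +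
  cgprod k n 0 x y z * poly_weight A B C D (detpow F 2) +
  cgprod k n 1 x y z * poly_weight A B C D (detpow F 1) +
  cgprod k n 2 x y z * poly_weight A B C D (detpow F 0).

Local Opaque detpow quartic.

Lemma quartic_identity_of_weights (k n : int) : -2 <= k -> -2 <= n ->
  (forall A B C D : nat, A%:Z + B%:Z = l + m2 + 2 + n -> A%:Z + C%:Z = l + m1 + 2 + k ->
     A%:Z + B%:Z + C%:Z + D%:Z = 2 * l + 4 ->
     quartic_weight_identity k n x y z A%:R B%:R C%:R D%:R) ->
  quartic_identity k n.
Proof.
move=> hk hn hw; rewrite /quartic_identity.
have := @lincomb_eq0 F a b c d (2 * l + 4) (l + m1 + 2 + k) (l + m2 + 2 + n)
  ((1, quartic F (absz (2 + k)) (absz (2 + n)), (2 * l, l + m1, l + m2)) ::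
   map (fun j => (- cgprod k n j x y z, detpow F (absz (2 - j)),
     (2 * l + 2 * j, l + j + m1 + k, l + j + m2 + n))) [:: -2; -1; 0; 1; 2]).
rewrite /= !(detpow_eval _ abcd) !big_cons big_nil => H.
apply/eqP; rewrite -subr_eq0; apply/eqP; rewrite -[RHS]H {H}; first by ring.
- rewrite quartic_shift; try lia.
  by rewrite !detpow_shift //; try lia.
- move=> A B C D e1 e2 e3; move: (hw A B C D e1 e2 e3).
  rewrite /quartic_weight_identity => ->.
  by rewrite -[detpow F (2 + _.+1)]/(detpow F 4); ring.
Qed.

Local Transparent detpow quartic.

(** Once [B, C, D] are eliminated, each of the 15 pairs [(k, n)] gives an identity of rational
    functions in [x, y, z, A]. *)
Lemma quartic_weights (k n : int) (x y z A B C D : F) :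
  [/\ x != 0, x - 1 != 0, x + 1 != 0 & x + 2 != 0] /\
  [/\ 2 * x - 1 != 0, 2 * x + 1 != 0 & 2 * x + 3 != 0] ->
  k \in [:: -2; 0; 2] -> n \in [:: -2; -1; 0; 1; 2] ->
  B = x + z + 2 + n%:~R - A ->
  C = x + y + 2 + k%:~R - A ->
  D = 2 * x + 4 - (A + B + C) ->
  quartic_weight_identity k n x y z A B C D.
Proof.
move=> [[h0 h1 h2 h3] [h4 h5 h6]] hk hn -> -> ->.
rewrite /quartic_weight_identity /cgprod /rcg /rcg_den /quartic /detpow /sgnz /poly_weight /mono_weight.
move: hk hn; rewrite !inE => /or3P[]/eqP-> /or4P[/eqP->|/eqP->|/eqP->|/orP[]/eqP->].
all: compute_nat; rewrite /=.
all: by field; rewrite ?h0 ?h1 ?h2 ?h3 ?h4 ?h5 ?h6.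
Qed.

(** The left side is half the spin 2 Casimir value 6, plus the mixed Casimir term on the middle
    component of the quartic. There [3/2] is half the ladder coefficient 3 from the middle to either
    neighbour; the middle weight is 0, so no diagonal mixed term occurs. *)
Definition deriv_identity (n : int) : Prop :=
  3 / 2 * (2 * (poly_eval a b c d (quartic F 2 (absz (2 + n))) * U (2 * l) (l + m1) (l + m2)) +
    (l + m1 + 1)%:~R *
      (poly_eval a b c d (quartic F 1 (absz (2 + n))) * U (2 * l) (l + m1 + 1) (l + m2)) +
    (2 * l - (l + m1) + 1)%:~R *
      (poly_eval a b c d (quartic F 3 (absz (2 + n))) * U (2 * l) (l + m1 - 1) (l + m2))) =
  \sum_(j <- [:: -2; -1; 0; 1; 2])
     ((j * l)%:~R + (j + j ^+ 2)%:~R / 2) * cgprod 0 n j x y z *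
     U (2 * l + 2 * j) (l + j + m1 + 0) (l + j + m2 + n).

(** The factors are the values of [j l + (j + j^2) / 2] at [j = -2, -1, 1, 2]; the value at [j = 0]
    is 0. *)
Definition deriv_weight_identity (n : int) (x y z A B C D : F) : Prop :=
  3 / 2 * (2 * poly_weight A B C D (quartic F 2 (absz (2 + n))) +
    (x + y + 1) * poly_weight A B C D (quartic F 1 (absz (2 + n))) +
    (x - y + 1) * poly_weight A B C D (quartic F 3 (absz (2 + n)))) =
  (- 2 * x + 1) * cgprod 0 n (-2) x y z * poly_weight A B C D (detpow F 4) +
  (- x) * cgprod 0 n (-1) x y z * poly_weight A B C D (detpow F 3) +
  (x + 1) * cgprod 0 n 1 x y z * poly_weight A B C D (detpow F 1) +
  (2 * x + 3) * cgprod 0 n 2 x y z * poly_weight A B C D (detpow F 0).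

Local Opaque detpow quartic.

Lemma deriv_identity_of_weights (n : int) : -2 <= n ->
  (forall A B C D : nat, A%:Z + B%:Z = l + m2 + 2 + n -> A%:Z + C%:Z = l + m1 + 2 + 0 ->
     A%:Z + B%:Z + C%:Z + D%:Z = 2 * l + 4 ->
     deriv_weight_identity n x y z A%:R B%:R C%:R D%:R) ->
  deriv_identity n.
Proof.
move=> hn hw; rewrite /deriv_identity.
have := @lincomb_eq0 F a b c d (2 * l + 4) (l + m1 + 2) (l + m2 + 2 + n)
  [:: (3, quartic F 2 (absz (2 + n)), (2 * l, l + m1, l + m2)),
      (3 / 2 * (l + m1 + 1)%:~R, quartic F 1 (absz (2 + n)), (2 * l, l + m1 + 1, l + m2)),
      (3 / 2 * (2 * l - (l + m1) + 1)%:~R, quartic F 3 (absz (2 + n)),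
         (2 * l, l + m1 - 1, l + m2)) &
   map (fun j => (- (((j * l)%:~R + (j + j ^+ 2)%:~R / 2) * cgprod 0 n j x y z),
     detpow F (absz (2 - j)),
     (2 * l + 2 * j, l + j + m1 + 0, l + j + m2 + n))) [:: -2; -1; 0; 1; 2]].
rewrite /= !(detpow_eval _ abcd) !big_cons big_nil => H.
apply/eqP; rewrite -subr_eq0; apply/eqP; rewrite -[RHS]H {H}; first by field.
- rewrite !quartic_shift; try lia.
  by rewrite !detpow_shift //; try lia.
- move=> A B C D e1 e2 e3; move: (hw A B C D e1); rewrite addr0 => /(_ e2 e3).
  rewrite /deriv_weight_identity -[detpow F (2 + _.+1)]/(detpow F 4).
  rewrite -[detpow F (2 - 1)]/(detpow F 1) -[detpow F (2 - _.+1)]/(detpow F 0).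
  rewrite -[detpow F (2 + 1)]/(detpow F 3).
  move: (poly_weight _ _ _ _ (detpow F _)) (poly_weight _ _ _ _ (detpow F _))
   (poly_weight _ _ _ _ (detpow F _)) (poly_weight _ _ _ _ (detpow F _))
   (poly_weight _ _ _ _ (detpow F _)) => w0 w1 w2 w3 w4 /eqP.
  by rewrite -subr_eq0 => /eqP E; rewrite -[RHS]E; field.
Qed.

Local Transparent detpow quartic.

Lemma deriv_weights (n : int) (x y z A B C D : F) :
  [/\ x != 0, x - 1 != 0, x + 1 != 0 & x + 2 != 0] /\
  [/\ 2 * x - 1 != 0, 2 * x + 1 != 0 & 2 * x + 3 != 0] ->
  n \in [:: -2; -1; 0; 1; 2] ->
  B = x + z + 2 + n%:~R - A ->
  C = x + y + 2 + 0%:~R - A ->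
  D = 2 * x + 4 - (A + B + C) ->
  deriv_weight_identity n x y z A B C D.
Proof.
move=> [[h0 h1 h2 h3] [h4 h5 h6]] hn -> -> ->.
rewrite /deriv_weight_identity /cgprod /rcg /rcg_den /quartic /detpow /sgnz.
rewrite /poly_weight /mono_weight.
move: hn; rewrite !inE => /or4P[/eqP->|/eqP->|/eqP->|/orP[]/eqP->].
all: compute_nat; rewrite /=.
all: by field; rewrite ?h0 ?h1 ?h2 ?h3 ?h4 ?h5 ?h6.
Qed.

Lemma nat_solve (k n : int) (A B C D : nat) :
  A%:Z + B%:Z = l + m2 + 2 + n -> A%:Z + C%:Z = l + m1 + 2 + k ->
  A%:Z + B%:Z + C%:Z + D%:Z = 2 * l + 4 ->
  [/\ B%:R = x + z + 2 + n%:~R - A%:R, C%:R = x + y + 2 + k%:~R - A%:R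
   & D%:R = 2 * x + 4 - (A%:R + B%:R + C%:R) :> F].
Proof.
move=> /(congr1 (fun t : int => t%:~R : F)) eB
   /(congr1 (fun t : int => t%:~R : F)) eC /(congr1 (fun t : int => t%:~R : F)) eD.
move: eB eC eD; rewrite !intrD !intrM -!pmulrn => eB eC eD.
by split; [rewrite -eB|rewrite -eC|rewrite -eD]; ring.
Qed.

Lemma cgprod_small k n j x' y' z' :
  (j \in [:: -2; -1; 0; 1]) && (x' == 0) || (j \in [:: -2; -1]) && (x' == 1) ->
  cgprod k n j x' y' z' = 0.
Proof.
move=> h; suff e : rcg_den j x' = 0 by rewrite /cgprod e !(mulr0, mul0r).
case/orP: h; rewrite !inE => /andP[h /eqP->].
  by case/or4P: h => /eqP->; rewrite /rcg_den /= !mul0r invr0 mulr0.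
by case/orP: h => /eqP->; rewrite /rcg_den /= subrr !(mulr0, mul0r) invr0 mulr0.
Qed.

End ClebschGordanIdentities.

(** * The cases [l = 0, 1] by integer computation, and transport along ring morphisms *)

Section SmallDefects.
Variable T : comNzRingType.

(* The weight identities for [l < 2], where only [j = 0, 1, 2] occur, multiplied
   by a common denominator [24 * M]. *)
Definition quartic_defect (x M q0 q1 q2 : T) (k n : int) (y z A B C D : T) : T :=
  24 * M * poly_weight A B C D (quartic T (absz (2 + k)) (absz (2 + n))) -
  'C(4, absz (2 + k))%:R * 'C(4, absz (2 + n))%:R *
    (q0 * rcg 0 k x y * rcg 0 n x z * poly_weight A B C D (detpow T 2) +
     q1 * rcg 1 k x y * rcg 1 n x z * poly_weight A B C D (detpow T 1) +
     q2 * rcg 2 k x y * rcg 2 n x z * poly_weight A B C D (detpow T 0)).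

Definition deriv_defect (x M q1 q2 : T) (n : int) (y z A B C D : T) : T :=
  24 * M * (3 * (2 * poly_weight A B C D (quartic T 2 (absz (2 + n))) +
     (x + y + 1) * poly_weight A B C D (quartic T 1 (absz (2 + n))) +
     (x - y + 1) * poly_weight A B C D (quartic T 3 (absz (2 + n))))) -
  2 * ('C(4, 2)%:R * 'C(4, absz (2 + n))%:R *
    ((x + 1) * q1 * rcg 1 0 x y * rcg 1 n x z * poly_weight A B C D (detpow T 1) +
     (2 * x + 3) * q2 * rcg 2 0 x y * rcg 2 n x z * poly_weight A B C D (detpow T 0))).

End SmallDefects.

Section Morphism.
Variables (T1 T2 : comNzRingType) (f : {rmorphism T1 -> T2}).

Lemma rmorph_ffall x n : f (ffall x n) = ffall (f x) n.
Proof. by elim: n x => [|n IH] x /=; rewrite ?rmorph1 // rmorphM IH rmorphB rmorph1. Qed.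

Lemma rmorph_poly_weight A B C D s : f (poly_weight A B C D s) =
  poly_weight (f A) (f B) (f C) (f D) [seq (f t.1, t.2) | t <- s].
Proof.
elim: s => [|[q [[[e1 e2] e3] e4]] s IH]; first exact: rmorph0.
by rewrite /poly_weight /= rmorphD IH /= !rmorphM !rmorph_ffall.
Qed.

Lemma map_quartic i p : [seq (f t.1, t.2) | t <- quartic T1 i p] = quartic T2 i p.
Proof.
by case: i p => [|[|[|[|[|i]]]]] [|[|[|[|[|p]]]]] //=; rewrite /quartic /= ?rmorph1 ?rmorph_nat.
Qed.

Lemma map_detpow t : [seq (f t.1, t.2) | t <- detpow T1 t] = detpow T2 t.
Proof.
by case: t => [|[|[|[|t]]]] /=; rewrite /detpow /= ?rmorphN ?rmorph1 ?rmorph_nat ?rmorphN1.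
Qed.

Lemma rmorph_rise x n : f (rise x n) = rise (f x) n.
Proof. by elim: n => [|n IH] /=; rewrite ?rmorph1 // rmorphM IH rmorphD rmorph_nat. Qed.

Lemma rmorph_sgnz k : f (sgnz T1 k) = sgnz T2 k.
Proof. by rewrite /sgnz; case: ifP; rewrite ?rmorphN1 ?rmorph1. Qed.

Lemma rmorph_rcg j k x y : f (rcg j k x y) = rcg j k (f x) (f y).
Proof.
rewrite /rcg; do !case: ifP => _;
  by rewrite ?(rmorph_nat, rmorph_int, rmorph1, rmorph_rise, rmorph_sgnz, rmorphXn, rmorphM,
     rmorphB, rmorphD, rmorphN).
Qed.

Lemma rmorph_quartic_defect x M q0 q1 q2 k n y z A B C D :
  f (quartic_defect x M q0 q1 q2 k n y z A B C D) =
  quartic_defect (f x) (f M) (f q0) (f q1) (f q2) k n (f y) (f z) (f A) (f B) (f C) (f D).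
Proof.
by rewrite /quartic_defect !(rmorph_rcg, rmorph_poly_weight, map_quartic, map_detpow,
  rmorph_nat, rmorphM, rmorphB, rmorphD).
Qed.

Lemma rmorph_deriv_defect x M q1 q2 n y z A B C D :
  f (deriv_defect x M q1 q2 n y z A B C D) =
  deriv_defect (f x) (f M) (f q1) (f q2) n (f y) (f z) (f A) (f B) (f C) (f D).
Proof.
by rewrite /deriv_defect !(rmorph_rcg, rmorph_poly_weight, map_quartic, map_detpow,
  rmorph_nat, rmorph1, rmorphM, rmorphB, rmorphD).
Qed.

End Morphism.

(** Exponents live in the binary integers so that [vm_compute] evaluates the defects; a ring
    morphism carries the result to the field. Testing [A < 7] is enough, as
    [A <= l + m2 + 2 + n <= 6] for [l <= 1]. *)
Definition all_small (l : int) (ms : seq int) (ks : seq int)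
    (P : int -> int -> int -> int -> BinNums.Z -> BinNums.Z -> BinNums.Z -> BinNums.Z -> bool) : bool :=
  all (fun m1 => all (fun m2 => all (fun k => all (fun n => all (fun A : nat =>
    let B := l + m2 + 2 + n - A%:Z in
    let C := l + m1 + 2 + k - A%:Z in
    let D := 2 * l + 4 - (A%:Z + B + C) in
    [&& 0 <= B, 0 <= C & 0 <= D] ==> P m1 m2 k n A%:R B%:~R C%:~R D%:~R)
   (iota 0 7)) [:: -2; -1; 0; 1; 2]) ks) ms) ms.

(** At [l = 1] the values of [rcg_den] for [j = 0, 1, 2] are [1/10, 1/6, 1/15], that is [3, 5, 2]
    over 30. At [l = 0] only [j = 2] remains, with value 1. *)
Lemma quartic_defect_1 : all_small 1 [:: -1; 0; 1] [:: -2; 0; 2]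
  (fun m1 m2 k n A B C D =>
     quartic_defect 1 30 3 5 2 k n m1%:~R m2%:~R A B C D == 0).
Proof. by vm_compute. Qed.

Lemma quartic_defect_0 : all_small 0 [:: 0] [:: -2; 0; 2]
  (fun m1 m2 k n A B C D =>
     quartic_defect 0 1 0 0 1 k n m1%:~R m2%:~R A B C D == 0).
Proof. by vm_compute. Qed.

Lemma deriv_defect_1 : all_small 1 [:: -1; 0; 1] [:: 0]
  (fun m1 m2 k n A B C D =>
     deriv_defect 1 30 5 2 n m1%:~R m2%:~R A B C D == 0).
Proof. by vm_compute. Qed.

Lemma deriv_defect_0 : all_small 0 [:: 0] [:: 0]
  (fun m1 m2 k n A B C D =>
     deriv_defect 0 1 0 1 n m1%:~R m2%:~R A B C D == 0).
Proof. by vm_compute. Qed.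

(** * Product expansions and the Casimir identity for all [l] *)

Section ClebschGordanIdentities.
Variable F : numFieldType.
Variables a b c d : F.
Hypothesis abcd : a * d - b * c = 1.
Variables l m1 m2 : int.
Local Notation x := (l%:~R : F).
Local Notation y := (m1%:~R : F).
Local Notation z := (m2%:~R : F).

Lemma all_smallP (ms ks : seq int) P k n (A B C D : nat) :
  all_small l ms ks P -> m1 \in ms -> m2 \in ms -> k \in ks -> n \in [:: -2; -1; 0; 1; 2] ->
  l < 2 -> `|m1| <= l -> `|m2| <= l -> `|k| <= 2 ->
  A%:Z + B%:Z = l + m2 + 2 + n -> A%:Z + C%:Z = l + m1 + 2 + k ->
  A%:Z + B%:Z + C%:Z + D%:Z = 2 * l + 4 ->
  P m1 m2 k n A%:R B%:R C%:R D%:R.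
Proof.
move=> h h1 h2 hk hn hl hm1 hm2 hk2 e1 e2 e3.
have n2 : `|n| <= 2 by move: hn; rewrite !inE => /or4P[/eqP->|/eqP->|/eqP->|/orP[]/eqP->].
have hA : A \in iota 0 7 by rewrite mem_iota; lia.
move/allP: h => /(_ _ h1)/allP/(_ _ h2)/allP/(_ _ hk)/allP/(_ _ hn)/allP/(_ _ hA) /=.
have -> : l + m2 + 2 + n - A%:Z = B by lia.
have -> : l + m1 + 2 + k - A%:Z = C by lia.
have -> : 2 * l + 4 - (A%:Z + B%:Z + C%:Z) = D by lia.
by rewrite /= -!pmulrn.
Qed.

Local Notation phi := (intr \o int_of_Z : BinNums.Z -> F).

Lemma quartic_identity_holds (k n : int) :
  k \in [:: -2; 0; 2] -> n \in [:: -2; -1; 0; 1; 2] ->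
  `|m1| <= l -> `|m2| <= l -> quartic_identity a b c d l m1 m2 k n.
Proof.
move=> hk hn hm1 hm2; apply: (quartic_identity_of_weights abcd).
- by move: hk; rewrite !inE => /or3P[]/eqP->.
- by move: hn; rewrite !inE => /or4P[/eqP->|/eqP->|/eqP->|/orP[]/eqP->].
move=> A B C D e1 e2 e3; have [eB eC eD] := nat_solve F e1 e2 e3.
have [hl|hl] := leP 2 l; first by apply: quartic_weights (large_neq0 F hl) hk hn eB eC eD.
have k2 : `|k| <= 2 by move: hk; rewrite !inE => /or3P[]/eqP->.
have [l0|l1] : l = 0 \/ l = 1 by lia.
- have h1 : m1 \in [:: 0] by rewrite !inE; lia.
  have h2 : m2 \in [:: 0] by rewrite !inE; lia.
  have h0 := quartic_defect_0; rewrite -{1}l0 in h0.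
  have {h0} := all_smallP h0 h1 h2 hk hn hl hm1 hm2 k2 e1 e2 e3.
  move=> /= /eqP/(congr1 phi); rewrite rmorph_quartic_defect.
  rewrite ?(rmorph_int, rmorph0, rmorph1, rmorph_nat) /quartic_defect /quartic_weight_identity => E.
  rewrite l0 !(@cgprod_small F k n (-2), @cgprod_small F k n (-1), @cgprod_small F k n 0,
    @cgprod_small F k n 1) ?eqxx // /cgprod /rcg_den /=.
  apply/eqP; rewrite -subr_eq0; apply/eqP; rewrite -[RHS](mulr0 24^-1) -[X in _ = _ * X]E.
  by field.
- have h1 : m1 \in [:: -1; 0; 1] by rewrite !inE; lia.
  have h2 : m2 \in [:: -1; 0; 1] by rewrite !inE; lia.
  have h0 := quartic_defect_1; rewrite -{1}l1 in h0.
  have {h0} := all_smallP h0 h1 h2 hk hn hl hm1 hm2 k2 e1 e2 e3.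
  move=> /= /eqP/(congr1 phi); rewrite rmorph_quartic_defect.
  rewrite ?(rmorph_int, rmorph0, rmorph1, rmorph_nat) /quartic_defect /quartic_weight_identity => E.
  rewrite l1 !(@cgprod_small F k n (-2), @cgprod_small F k n (-1)) ?eqxx ?orbT //.
  rewrite /cgprod /rcg_den /=.
  apply/eqP; rewrite -subr_eq0; apply/eqP; rewrite -[RHS](mulr0 720^-1) -[X in _ = _ * X]E.
  by field.
Qed.

Lemma deriv_identity_holds (n : int) : n \in [:: -2; -1; 0; 1; 2] ->
  `|m1| <= l -> `|m2| <= l -> deriv_identity a b c d l m1 m2 n.
Proof.
move=> hn hm1 hm2; apply: (deriv_identity_of_weights abcd).
- by move: hn; rewrite !inE => /or4P[/eqP->|/eqP->|/eqP->|/orP[]/eqP->].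
move=> A B C D e1 e2 e3; have [eB eC eD] := nat_solve F e1 e2 e3.
have [hl|hl] := leP 2 l; first by apply: deriv_weights (large_neq0 F hl) hn eB eC eD.
have hk : 0 \in [:: 0 : int] by rewrite !inE.
have k2 : `|0 : int| <= 2 by [].
have [l0|l1] : l = 0 \/ l = 1 by lia.
- have h1 : m1 \in [:: 0] by rewrite !inE; lia.
  have h2 : m2 \in [:: 0] by rewrite !inE; lia.
  have h0 := deriv_defect_0; rewrite -{1}l0 in h0.
  have {h0} := all_smallP h0 h1 h2 hk hn hl hm1 hm2 k2 e1 e2 e3.
  move=> /= /eqP/(congr1 phi); rewrite rmorph_deriv_defect.
  rewrite ?(rmorph_int, rmorph0, rmorph1, rmorph_nat) /deriv_defect /deriv_weight_identity => E.
  rewrite l0 !(@cgprod_small F 0 n (-2), @cgprod_small F 0 n (-1), @cgprod_small F 0 n 0,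
    @cgprod_small F 0 n 1) ?eqxx // /cgprod /rcg_den /=.
  apply/eqP; rewrite -subr_eq0; apply/eqP; rewrite -[RHS](mulr0 48^-1) -[X in _ = _ * X]E.
  by field.
- have h1 : m1 \in [:: -1; 0; 1] by rewrite !inE; lia.
  have h2 : m2 \in [:: -1; 0; 1] by rewrite !inE; lia.
  have h0 := deriv_defect_1; rewrite -{1}l1 in h0.
  have {h0} := all_smallP h0 h1 h2 hk hn hl hm1 hm2 k2 e1 e2 e3.
  move=> /= /eqP/(congr1 phi); rewrite rmorph_deriv_defect.
  rewrite ?(rmorph_int, rmorph0, rmorph1, rmorph_nat) /deriv_defect /deriv_weight_identity => E.
  rewrite l1 !(@cgprod_small F 0 n (-2), @cgprod_small F 0 n (-1)) ?eqxx ?orbT //.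
  rewrite /cgprod /rcg_den /=.
  (* [1440 = 2 * 24 * 30]: the common denominator, doubled to clear [3/2]. *)
  apply/eqP; rewrite -subr_eq0; apply/eqP; rewrite -[RHS](mulr0 1440^-1) -[X in _ = _ * X]E.
  by field.
Qed.

End ClebschGordanIdentities.

(** * The matrix exponential and its derivative *)

Section MatrixExponential.
Variable R : realType.
Implicit Types (X : 'M[R]_3) (t : R).

Lemma cvg_mx (u : nat -> 'M[R]_3) (M : 'M[R]_3) :
  (forall i j, (fun n => u n i j) @ \oo --> M i j) -> u @ \oo --> M.
Proof.
move=> h A [P MP sPA]; apply: (@filterS _ \oo _ [set n | forall i j, P i j (u n i j)]).
  by move=> n hn; apply: sPA.
have H i j : \oo (fun n => P i j (u n i j)) by exact: (h i j _ (MP i j)).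
apply: (@filter_forall _ _ (fun i => [set n | forall j, P i j (u n i j)]) \oo) => i.
by apply: (@filter_forall _ _ (fun j => [set n | P i j (u n i j)]) \oo) => j; exact: H.
Qed.

Lemma expr_mx_bounded X :
  exists2 B : R, 0 <= B & forall n i j, `|(X ^+ n) i j| <= B ^+ n.
Proof.
pose S := \sum_i \sum_j `|X i j|.
have S0 : 0 <= S by apply: sumr_ge0 => i _; apply: sumr_ge0.
exists S => //; elim=> [|n IH] i j.
  by rewrite !expr0 mxE; case: eqP; rewrite ?normr1 ?normr0 ?ler01.
rewrite exprS mxE (le_trans (ler_norm_sum _ _ _))// exprS.
apply: (@le_trans _ _ (\sum_k `|X i k| * S ^+ n)).
  by apply: ler_sum => k _; rewrite normrM ler_wpM2l.
rewrite -mulr_suml ler_wpM2r ?exprn_ge0// /S [leRHS](bigD1 i)//= lerDl.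
by apply: sumr_ge0 => k _; apply: sumr_ge0.
Qed.

(** The shift [d] keeps this family closed under termwise differentiation, which raises [d] by
    one. *)
Definition expmx_coef X i j (d n : nat) : R := (X ^+ (n + d)) i j / n`!%:R.

Lemma is_cvg_expmx_coef X i j d t : cvgn (pseries (expmx_coef X i j d) t).
Proof.
have [B B0 hB] := expr_mx_bounded X.
apply: normed_cvg.
have h0 n : 0 <= (B ^+ d *: exp_coeff (B * `|t|)) n :> R.
  apply: mulr_ge0; first exact: exprn_ge0.
  by apply: exp_coeff_ge0; apply: mulr_ge0.
apply: (series_le_cvg _ h0); first by move=> n /=.
  move=> n; rewrite -[leRHS]/(B ^+ d * ((B * `|t|) ^+ n / n`!%:R)) /expmx_coef /=.
  rewrite exprMn !normrM normfV normrX (ger0_norm (ler0n _ _)).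
  rewrite (_ : B ^+ d * _ = B ^+ (n + d) / n`!%:R * `|t| ^+ n); last by rewrite exprD; ring.
  by apply: ler_wpM2r; rewrite ?exprn_ge0//; apply: ler_wpM2r; rewrite ?invr_ge0.
by apply: is_cvg_seriesZ; exact: is_cvg_series_exp_coeff.
Qed.

Lemma expmx_series_entry X t i j n :
  series (fun n : nat => (n`!%:R)^-1 *: (t *: X) ^+ n) n i j =
  pseries (expmx_coef X i j 0) t n.
Proof.
rewrite /pseries /series /= summxE; apply: eq_bigr => k _.
by rewrite exprZn !mxE /expmx_coef addn0; ring.
Qed.

Lemma expmx_entry X t i j :
  expmx (t *: X) i j = limn (pseries (expmx_coef X i j 0) t).
Proof.
pose M : 'M[R]_3 := \matrix_(i, j) limn (pseries (expmx_coef X i j 0) t).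
have cM : series (fun n : nat => (n`!%:R)^-1 *: (t *: X) ^+ n) @ \oo --> M.
  apply: cvg_mx => a b; rewrite /M mxE.
  rewrite (_ : (fun n => _) = pseries (expmx_coef X a b 0) t); last first.
    by apply/funext => n; rewrite expmx_series_entry.
  exact: is_cvg_expmx_coef.
by rewrite /expmx (cvg_lim _ cM) ?mxE//; exact: norm_hausdorff.
Qed.

Lemma is_derive_expmx X t i j :
  is_derive t 1 (fun t => expmx (t *: X) i j) ((expmx (t *: X) *m X) i j).
Proof.
have diffsE d : pseries_diffs (expmx_coef X i j d) = expmx_coef X i j d.+1.
  apply/funext => n; rewrite /pseries_diffs /expmx_coef factS natrM invfM addSnnS.
  by rewrite mulrCA mulVKf ?pnatr_eq0.
have -> : (expmx (t *: X) *m X) i j = limn (pseries (expmx_coef X i j 1) t).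
  rewrite mxE; apply/esym/cvg_lim => //.
  have -> : pseries (expmx_coef X i j 1) t =
      (fun n => \sum_(k < 3) pseries (expmx_coef X i k 0) t n * X k j).
    apply/funext => n; rewrite /pseries /series /=.
    under [RHS]eq_bigr do rewrite mulr_suml.
    rewrite exchange_big /=; apply: eq_bigr => m _.
    rewrite /expmx_coef addn0 addn1 exprSr mxE !mulr_suml; apply: eq_bigr => k _.
    by ring.
  rewrite (_ : (fun n => _) = \sum_(k < 3) (fun n => pseries (expmx_coef X i k 0) t n * X k j));
    last by apply/funext => n; rewrite fct_sumE.
  elim/big_ind2: _ => [|u a v b|k _]; [exact: cvg_cst|exact: cvgD|].
  by rewrite expmx_entry; apply: cvgMr_tmp; exact: is_cvg_expmx_coef.
rewrite (_ : (fun t => _) = (fun t => limn (pseries (expmx_coef X i j 0) t))); last first.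
  by apply/funext => s; rewrite expmx_entry.
(* A point strictly beyond [t] where the series and its first two termwise derivatives converge. *)
rewrite -diffsE; apply: (@pseries_snd_diffs _ _ (`|t| + 1)).
- exact: is_cvg_expmx_coef.
- by rewrite diffsE; exact: is_cvg_expmx_coef.
- by rewrite !diffsE; exact: is_cvg_expmx_coef.
- by rewrite [ltRHS]ger0_norm ?ltrDl// addr_ge0.
Qed.

Lemma expmx0 : expmx (0 : 'M[R]_3) = 1%:M.
Proof.
apply: cvg_lim; first exact: norm_hausdorff.
apply: (@cvg_near_cst).
exists 1%N => // n /= hn; rewrite /series /= -(prednK hn) big_nat_recl//= fact0 invr1 scale1r.
rewrite expr0 big1 ?addr0// => k _.
by rewrite expr0n /= scaler0.
Qed.

End MatrixExponential.

(** * Derivatives of complex-valued functions of a real variable *)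

Section ComplexDerivative.
Variable R : realType.
Implicit Types (f g : R -> R) (h : R -> R[i]) (t : R).
Local Notation Re := complex.Re.
Local Notation Im := complex.Im.

Lemma is_derive_add f g t (a b : R) : is_derive t 1 f a -> is_derive t 1 g b ->
  is_derive t 1 (fun s => f s + g s) (a + b).
Proof. exact: is_deriveD. Qed.

Lemma is_derive_opp f t (a : R) : is_derive t 1 f a ->
  is_derive t 1 (fun s => - f s) (- a).
Proof. exact: is_deriveN. Qed.

Lemma is_derive_mul f g t (a b : R) : is_derive t 1 f a -> is_derive t 1 g b ->
  is_derive t 1 (fun s => f s * g s) (a * g t + f t * b).
Proof.
move=> hf hg; have h := is_deriveM hf hg; apply: is_derive_eq h _.
by rewrite /GRing.scale /= addrC [g t * a]mulrC.
Qed.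

Definition cder h t (d : R[i]) : Prop :=
  is_derive t 1 (fun s => Re (h s)) (Re d) /\ is_derive t 1 (fun s => Im (h s)) (Im d).

Lemma cReM (x y : R[i]) : Re (x * y) = Re x * Re y - Im x * Im y.
Proof. by case: x => a b; case: y. Qed.

Lemma cImM (x y : R[i]) : Im (x * y) = Re x * Im y + Im x * Re y.
Proof. by case: x => a b; case: y => c e /=; rewrite addrC. Qed.

Lemma cReD (x y : R[i]) : Re (x + y) = Re x + Re y.
Proof. by case: x => a b; case: y. Qed.

Lemma cImD (x y : R[i]) : Im (x + y) = Im x + Im y.
Proof. by case: x => a b; case: y. Qed.

Lemma complexP (x y : R[i]) : Re x = Re y -> Im x = Im y -> x = y.
Proof. by case: x => a b; case: y => c e /= -> ->. Qed.

Lemma cder_cst t (c : R[i]) : cder (fun=> c) t 0.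
Proof. by split; exact: is_derive_cst. Qed.

Lemma cder_real f t (a : R) : is_derive t 1 f a -> cder (fun s => (f s)%:C) t a%:C.
Proof. by move=> hf; split => //=; exact: is_derive_cst. Qed.

Lemma cderD h1 h2 t d1 d2 : cder h1 t d1 -> cder h2 t d2 ->
  cder (fun s => h1 s + h2 s) t (d1 + d2).
Proof.
move=> [r1 i1] [r2 i2]; split; rewrite ?cReD ?cImD.
  under eq_fun do rewrite cReD.
  exact: is_derive_add.
under eq_fun do rewrite cImD.
exact: is_derive_add.
Qed.

Lemma cderM h1 h2 t d1 d2 : cder h1 t d1 -> cder h2 t d2 ->
  cder (fun s => h1 s * h2 s) t (d1 * h2 t + h1 t * d2).
Proof.
move=> [r1 i1] [r2 i2]; split; rewrite ?cReD ?cImD ?cReM ?cImM.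
  under eq_fun do rewrite cReM.
  have h := is_derive_add (is_derive_mul r1 r2) (is_derive_opp (is_derive_mul i1 i2)).
  apply: is_derive_eq h _.
  by move: (Re d1) (Im d1) => *; ring.
under eq_fun do rewrite cImM.
have h := is_derive_add (is_derive_mul r1 i2) (is_derive_mul i1 r2).
apply: is_derive_eq h _.
by move: (Re d1) (Im d1) => *; ring.
Qed.

Lemma cderZ h t d c : cder h t d -> cder (fun s => c * h s) t (c * d).
Proof.
by move=> hd; have := cderM (cder_cst t c) hd; rewrite mul0r add0r.
Qed.

Lemma cder_eq h t d d' : cder h t d -> d = d' -> cder h t d'.
Proof. by move=> ? <-. Qed.

Lemma cder_ext h1 h2 t d : h1 =1 h2 -> cder h1 t d -> cder h2 t d.
Proof. by move=> /funext ->. Qed.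

Lemma expiD (x y : R) : expi (x + y) = expi x * expi y.
Proof. by apply: complexP; rewrite /expi ?cReM ?cImM /= ?cosD ?sinD; ring. Qed.

Lemma cpowM (x y : R) (s : R[i]) : 0 < x -> 0 < y -> cpow (x * y) s = cpow x s * cpow y s.
Proof.
move=> x0 y0; rewrite /cpow lnM ?posrE// !mulrDr expRD expiD rmorphM /=; ring.
Qed.

Lemma cpowD (x : R) (s t : R[i]) : cpow x (s + t) = cpow x s * cpow x t.
Proof. by rewrite /cpow cReD cImD !mulrDl expRD expiD rmorphM /=; ring. Qed.

Lemma cpow1 (s : R[i]) : cpow 1 s = 1.
Proof. by rewrite /cpow ln1 !mulr0 expR0 /expi cos0 sin0 mul1r. Qed.

Lemma cpow_real (x r : R) : 0 < x -> cpow x r%:C = (x `^ r)%:C.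
Proof.
by move=> x0; rewrite /cpow /= mul0r /expi cos0 sin0 mulr1 /powR gt_eqF.
Qed.

(** The logarithmic derivative is written with [cpow (f t) (-1)] instead of a quotient, so that it
    stays inside the class [elementary_fun]. *)
Lemma cder_cpow f t (a : R) s : 0 < f t -> is_derive t 1 f a ->
  cder (fun x => cpow (f x) s) t (s * (a%:C * cpow (f t) (-1)) * cpow (f t) s).
Proof.
move=> f0 hf.
have hl : is_derive t 1 (@ln R \o f) ((f t)^-1 * a).
  by apply: is_derive1_comp; exact: is_derive1_ln.
set b := (f t)^-1 * a in hl.
have -> : a%:C * cpow (f t) (-1) = b%:C.
  have -> : cpow (f t) (-1) = cpow (f t) (-1)%:C by rewrite rmorphN1.
  rewrite cpow_real// powR_inv1 ?ltW//.
  by rewrite -rmorphM /= mulrC.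
have hk (k : R) : is_derive t 1 (fun x => k * ln (f x)) (k * b).
  have h := is_derive_mul (is_derive_cst k t 1) hl.
  apply: is_derive_eq h _.
  by rewrite mul0r add0r.
have he : is_derive t 1 (@expR R \o (fun x => Re s * ln (f x)))
    (expR (Re s * ln (f t)) * (Re s * b)).
  by apply: is_derive1_comp; exact: is_derive_expR.
have hc : is_derive t 1 (@cos R \o (fun x => Im s * ln (f x)))
    (- sin (Im s * ln (f t)) * (Im s * b)).
  by apply: is_derive1_comp; exact: is_derive_cos.
have hs : is_derive t 1 (@sin R \o (fun x => Im s * ln (f x)))
    (cos (Im s * ln (f t)) * (Im s * b)).
  by apply: is_derive1_comp; exact: is_derive_sin.
have hE : cder (fun x => expi (Im s * ln (f x))) t
  ((- sin (Im s * ln (f t)) * (Im s * b)) +i* (cos (Im s * ln (f t)) * (Im s * b))).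
  by split.
apply: cder_eq; first exact: (cderM (cder_real he) hE).
rewrite /cpow /=; apply: complexP; rewrite ?cReD ?cImD ?cReM ?cImM ?cReM ?cImM /=; ring.
Qed.

End ComplexDerivative.

(** * Explicit indices and determinants of small matrices *)

Definition o0 : 'I_3 := @Ordinal 3 0 isT.
Definition o1 : 'I_3 := @Ordinal 3 1 isT.
Definition o2 : 'I_3 := @Ordinal 3 2 isT.
Lemma big3 (V : nmodType) (h : 'I_3 -> V) : \sum_i h i = h o0 + h o1 + h o2.
Proof.
rewrite !big_ord_recl big_ord0 addr0 addrA; congr (h _ + h _ + h _); exact: val_inj.
Qed.
Lemma ord3P (P : 'I_3 -> Prop) : P o0 -> P o1 -> P o2 -> forall i, P i.
Proof.
move=> p0 p1 p2 [[|[|[|//]]] h].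
- by rewrite (_ : Ordinal h = o0) //; apply: val_inj.
- by rewrite (_ : Ordinal h = o1) //; apply: val_inj.
- by rewrite (_ : Ordinal h = o2) //; apply: val_inj.
Qed.

Lemma det_mx22 (T : comNzRingType) (M : 'M[T]_2) :
  \det M = M 0 0 * M 1 1 - M 0 1 * M 1 0.
Proof.
have L0 : lift (0 : 'I_2) (0 : 'I_1) = 1 by apply: val_inj.
have L1 : lift (1 : 'I_2) (0 : 'I_1) = 0 by apply: val_inj.
rewrite (expand_det_row _ 0) big_ord_recl big_ord1 /cofactor !det_mx11 !mxE L0 L1 /=.
rewrite addn0 expr0 expr1; ring.
Qed.

Lemma det3 (T : comNzRingType) (M : 'M[T]_3) : \det M =
  M o0 o0 * (M o1 o1 * M o2 o2 - M o1 o2 * M o2 o1) -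
  M o0 o1 * (M o1 o0 * M o2 o2 - M o1 o2 * M o2 o0) +
  M o0 o2 * (M o1 o0 * M o2 o1 - M o1 o1 * M o2 o0).
Proof.
have L00 : lift o0 (0 : 'I_2) = o1 by apply: val_inj.
have L01 : lift o0 (1 : 'I_2) = o2 by apply: val_inj.
have L10 : lift o1 (0 : 'I_2) = o0 by apply: val_inj.
have L11 : lift o1 (1 : 'I_2) = o2 by apply: val_inj.
have L20 : lift o2 (0 : 'I_2) = o0 by apply: val_inj.
have L21 : lift o2 (1 : 'I_2) = o1 by apply: val_inj.
rewrite (expand_det_row _ o0) big3 /cofactor !det_mx22 !mxE L00 L01 L10 L11 L20 L21 /=.
rewrite !add0n expr0 expr1 expr2; ring.
Qed.


(** * A class of smooth functions on [SL(3)] *)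

Section SmoothFunctions.
Variable R : realType.
Implicit Types (X g : 'M[R]_3) (f : 'M[R]_3 -> R[i]).
Local Notation Re := complex.Re.
Local Notation Im := complex.Im.

(** Differentiating the expanded determinant gives [tr X] times the determinant, hence 0, so the
    value 1 at [t = 0] persists. *)
Lemma det_expmx X (t : R) : \tr X = 0 -> \det (expmx (t *: X)) = 1.
Proof.
rewrite /mxtrace big3 => trX.
have X22 : X o2 o2 = - X o0 o0 - X o1 o1 by rewrite -[LHS]subr0 -trX; ring.
pose e (i j : 'I_3) (s : R) : R := expmx (s *: X) i j.
have de i j (s : R) : is_derive s 1 (e i j) (e i o0 s * X o0 j + e i o1 s * X o1 j + e i o2 s * X o2 j).
  by have := is_derive_expmx X s i j; rewrite mxE big3.
pose D (s : R) : R := e o0 o0 s * (e o1 o1 s * e o2 o2 s + - (e o1 o2 s * e o2 o1 s)) +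
  - (e o0 o1 s * (e o1 o0 s * e o2 o2 s + - (e o1 o2 s * e o2 o0 s))) +
  e o0 o2 s * (e o1 o0 s * e o2 o1 s + - (e o1 o1 s * e o2 o0 s)).
have minor i j k l (s : R) := is_derive_add (is_derive_mul (de i j s) (de k l s))
   (is_derive_opp (is_derive_mul (de i l s) (de k j s))).
have dD (s : R) : is_derive s 1 D 0.
  have h := is_derive_add (is_derive_add
    (is_derive_mul (de o0 o0 s) (minor o1 o1 o2 o2 s))
    (is_derive_opp (is_derive_mul (de o0 o1 s) (minor o1 o0 o2 o2 s))))
    (is_derive_mul (de o0 o2 s) (minor o1 o0 o2 o1 s)).
  by apply: is_derive_eq h _; rewrite X22; ring.
have -> : \det (expmx (t *: X)) = D t by rewrite det3.
rewrite (is_derive_0_is_cst t 0 dD) /D /e scale0r expmx0 !mxE /=; ring.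
Qed.

Lemma SL3_mul_expmx g X t : \tr X = 0 -> SL3 g -> SL3 (g *m expmx (t *: X)).
Proof. by move=> trX; rewrite /SL3 /= det_mulmx => ->; rewrite det_expmx // mulr1. Qed.

(* Closed under the left-invariant derivations, hence contained in the smooth functions. *)
Inductive elementary_fun : ('M[R]_3 -> R[i]) -> Prop :=
  | elementary_cst c : elementary_fun (fun=> c)
  | elementary_entry i j : elementary_fun (fun g => (g i j)%:C)
  | elementaryD f1 f2 : elementary_fun f1 -> elementary_fun f2 ->
      elementary_fun (fun g => f1 g + f2 g)
  | elementaryM f1 f2 : elementary_fun f1 -> elementary_fun f2 ->
      elementary_fun (fun g => f1 g * f2 g)
  | elementary_cpow (q : 'M[R]_3 -> R) s : elementary_fun (fun g => (q g)%:C) ->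
      (forall g, SL3 g -> 0 < q g) -> elementary_fun (fun g => cpow (q g) s)
  | elementary_ext f1 f2 : (forall g, SL3 g -> f1 g = f2 g) ->
      elementary_fun f1 -> elementary_fun f2.

(** A single [f'] of the class serves at every point of [SL(3)], which is what allows the derivation
    to be iterated. *)
Lemma elementary_derivative f X : elementary_fun f -> \tr X = 0 ->
  exists2 f', elementary_fun f' &
    forall g, SL3 g -> cder (fun t => f (g *m expmx (t *: X))) 0 (f' g).
Proof.
move=> hf trX; elim: hf => {f}.
- move=> c; exists (fun=> 0); first exact: elementary_cst.
  by move=> g _; exact: cder_cst.
- move=> i j; exists (fun g => (g i o0)%:C * (X o0 j)%:C + (g i o1)%:C * (X o1 j)%:C +
                            (g i o2)%:C * (X o2 j)%:C).
    by do !apply: elementaryD; apply: elementaryM; [exact: elementary_entry|exact: elementary_cst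
      |exact: elementary_entry|exact: elementary_cst|exact: elementary_entry|exact: elementary_cst].
  move=> g _; rewrite -!rmorphM -!rmorphD /=; apply: cder_real.
  rewrite (_ : (fun t => _) = (fun t => g i o0 * expmx (t *: X) o0 j +
    g i o1 * expmx (t *: X) o1 j + g i o2 * expmx (t *: X) o2 j)); last first.
    by apply/funext => t; rewrite mxE big3.
  have d k := is_derive_mul (is_derive_cst (g i k) (0 : R) (1 : R)) (is_derive_expmx X 0 k j).
  have h := is_derive_add (is_derive_add (d o0) (d o1)) (d o2).
  by apply: is_derive_eq h _; rewrite scale0r expmx0 mul1mx /=; ring.
- move=> f1 f2 h1 [d1 e1 H1] h2 [d2 e2 H2]; exists (fun g => d1 g + d2 g).
    exact: elementaryD.
  by move=> g Sg; apply: cderD; [exact: H1|exact: H2].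
- move=> f1 f2 h1 [d1 e1 H1] h2 [d2 e2 H2]; exists (fun g => d1 g * f2 g + f1 g * d2 g).
    by apply: elementaryD; exact: elementaryM.
  move=> g Sg; apply: cder_eq; first exact: (cderM (H1 g Sg) (H2 g Sg)).
  by rewrite /= scale0r expmx0 mulmx1.
- move=> q s hq [d e H] q0.
  exists (fun g => s * (d g * cpow (q g) (-1)) * cpow (q g) s).
    apply: elementaryM; last exact: elementary_cpow.
    apply: elementaryM; first exact: elementary_cst.
    by apply: elementaryM => //; exact: elementary_cpow.
  move=> g Sg; have [hr hi] := H g Sg.
  (* [q] is real, so the imaginary part of its derivative is the derivative of a constant; the
     elementary [d] may then stand for the real derivative of [q]. *)
  have dE : d g = (Re (d g))%:C.
    apply: complexP => //=.
    by rewrite -(@derive_val _ _ _ _ _ _ _ hi) derive_cst.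
  have g0 : 0 < q (g *m expmx (0 *: X)) by rewrite scale0r expmx0 mulmx1; exact: q0.
  apply: cder_eq; first exact: (cder_cpow s g0 hr).
  by rewrite /= scale0r expmx0 mulmx1 -dE.
- move=> f1 f2 E hf [d e H]; exists d => // g Sg.
  apply: cder_ext (H g Sg) => t; apply: E; exact: SL3_mul_expmx.
Qed.

Lemma elementary_continuous f : elementary_fun f ->
  forall g, SL3 g -> (fun x => Re (f x)) @ within (@SL3 R) (nbhs g) --> Re (f g) /\
    (fun x => Im (f x)) @ within (@SL3 R) (nbhs g) --> Im (f g).
Proof.
elim=> {f}.
- by move=> c g _; split; exact: cvg_cst.
- move=> i j g _; split; last exact: cvg_cst.
  by apply: cvg_within_filter; exact: coord_continuous.
- move=> f1 f2 _ H1 _ H2 g Sg; have [r1 i1] := H1 g Sg; have [r2 i2] := H2 g Sg.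
  split; rewrite ?cReD ?cImD.
    by under eq_fun do rewrite cReD; exact: cvgD.
  by under eq_fun do rewrite cImD; exact: cvgD.
- move=> f1 f2 _ H1 _ H2 g Sg; have [r1 i1] := H1 g Sg; have [r2 i2] := H2 g Sg.
  split; rewrite ?cReM ?cImM.
    by under eq_fun do rewrite cReM; apply: cvgB; exact: cvgM.
  by under eq_fun do rewrite cImM; apply: cvgD; exact: cvgM.
- move=> q s _ H q0 g Sg; have [r1 _] := H g Sg.
  have hl : (fun x => ln (q x)) @ within (@SL3 R) (nbhs g) --> ln (q g).
    by apply: (continuous_cvg _ _ r1); exact/continuous_ln/q0.
  have hk (k : R) : (fun x => k * ln (q x)) @ within (@SL3 R) (nbhs g) --> k * ln (q g).
    exact: cvgMl_tmp.
  have he := continuous_cvg _ (@continuous_expR R _) (hk (Re s)).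
  have hc := continuous_cvg _ (@continuous_cos R _) (hk (Im s)).
  have hs := continuous_cvg _ (@continuous_sin R _) (hk (Im s)).
  have Ere x : Re (cpow x s) = expR (Re s * ln x) * cos (Im s * ln x).
    by rewrite /cpow cReM /= mul0r subr0.
  have Eim x : Im (cpow x s) = expR (Re s * ln x) * sin (Im s * ln x).
    by rewrite /cpow cImM /= mul0r addr0.
  split; [rewrite Ere|rewrite Eim].
    under eq_fun do rewrite Ere.
    exact: (cvgM (he _) (hc _)).
  under eq_fun do rewrite Eim.
  exact: (cvgM (he _) (hs _)).
- move=> f1 f2 E _ H g Sg; have [r1 i1] := H g Sg; rewrite -E//; split.
    by apply: cvg_trans r1; apply: fmap_within_eq => x Sx; rewrite E// -in_setE.
  by apply: cvg_trans i1; apply: fmap_within_eq => x Sx; rewrite E// -in_setE.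
Qed.

Lemma pi_realE X f g d : cder (fun t => f (g *m expmx (t *: X))) 0 d -> pi_real X f g = d.
Proof.
move=> [hr hi]; apply: complexP; rewrite /pi_real /= derive1E.
  exact: (@derive_val _ _ _ _ _ _ _ hr).
exact: (@derive_val _ _ _ _ _ _ _ hi).
Qed.

Lemma elementary_smooth f : elementary_fun f -> smooth_SL3 f.
Proof.
move=> hf n; elim: n f hf => [|n IH] f hf /=;
  (split; [|split]; try by apply/subspace_continuousP => g /(elementary_continuous hf)[]) => //.
move=> X trX; have [d ed H] := elementary_derivative hf trX; split.
  by move=> g /H[hr hi]; split; apply: ex_derive.
(* The derivative agrees with an elementary function only on [SL(3)]; this suffices for
   [elementary_ext]. *)
apply: IH; apply: elementary_ext ed => g Sg.
by apply/esym/pi_realE/H.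
Qed.

End SmoothFunctions.

(** * Cofactors and rows of a rotation *)

Section Rotations.
Variable T : comUnitRingType.
Implicit Types k : 'M[T]_3.

Lemma cofactor3 k :
  [/\ cofactor k o0 o0 = k o1 o1 * k o2 o2 - k o1 o2 * k o2 o1,
      cofactor k o0 o1 = k o1 o2 * k o2 o0 - k o1 o0 * k o2 o2 &
      cofactor k o0 o2 = k o1 o0 * k o2 o1 - k o1 o1 * k o2 o0] /\
  [/\ cofactor k o1 o0 = k o2 o1 * k o0 o2 - k o2 o2 * k o0 o1,
      cofactor k o1 o1 = k o2 o2 * k o0 o0 - k o2 o0 * k o0 o2 &
      cofactor k o1 o2 = k o2 o0 * k o0 o1 - k o2 o1 * k o0 o0] /\
  [/\ cofactor k o2 o0 = k o0 o1 * k o1 o2 - k o0 o2 * k o1 o1,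
      cofactor k o2 o1 = k o0 o2 * k o1 o0 - k o0 o0 * k o1 o2 &
      cofactor k o2 o2 = k o0 o0 * k o1 o1 - k o0 o1 * k o1 o0].
Proof.
have L00 : lift o0 (0 : 'I_2) = o1 by apply: val_inj.
have L01 : lift o0 (1 : 'I_2) = o2 by apply: val_inj.
have L10 : lift o1 (0 : 'I_2) = o0 by apply: val_inj.
have L11 : lift o1 (1 : 'I_2) = o2 by apply: val_inj.
have L20 : lift o2 (0 : 'I_2) = o0 by apply: val_inj.
have L21 : lift o2 (1 : 'I_2) = o1 by apply: val_inj.
do !split; rewrite /cofactor det_mx22 !mxE ?L00 ?L01 ?L10 ?L11 ?L20 ?L21 /=; ring.
Qed.

(** The adjugate of a rotation is its inverse, hence its transpose. *)
Lemma orthogonal_cofactor k i j : k *m k^T = 1%:M -> \det k = 1 -> cofactor k i j = k i j.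
Proof.
move=> h d; have h' : k^T *m k = 1%:M by apply: mulmx1C.
have : k^T *m (k *m \adj k) = k^T by rewrite mul_mx_adj d mulmx1.
by rewrite mulmxA h' mul1mx => /matrixP/(_ j i); rewrite !mxE.
Qed.

(** The rows are a positively oriented orthonormal frame: each is the cross product of the next two
    in cyclic order. *)
Lemma rotation_rows k : k *m k^T = 1%:M -> \det k = 1 ->
  [/\ k o0 o0 = k o1 o1 * k o2 o2 - k o1 o2 * k o2 o1,
      k o0 o1 = k o1 o2 * k o2 o0 - k o1 o0 * k o2 o2 &
      k o0 o2 = k o1 o0 * k o2 o1 - k o1 o1 * k o2 o0] /\
  [/\ k o1 o0 = k o2 o1 * k o0 o2 - k o2 o2 * k o0 o1,
      k o1 o1 = k o2 o2 * k o0 o0 - k o2 o0 * k o0 o2 &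
      k o1 o2 = k o2 o0 * k o0 o1 - k o2 o1 * k o0 o0] /\
  [/\ k o2 o0 = k o0 o1 * k o1 o2 - k o0 o2 * k o1 o1,
      k o2 o1 = k o0 o2 * k o1 o0 - k o0 o0 * k o1 o2 &
      k o2 o2 = k o0 o0 * k o1 o1 - k o0 o1 * k o1 o0].
Proof. by move=> h d; have := cofactor3 k; rewrite !(orthogonal_cofactor _ _ h d). Qed.

Lemma row_dot k i j : k *m k^T = 1%:M ->
  k i o0 * k j o0 + k i o1 * k j o1 + k i o2 * k j o2 = (i == j)%:R.
Proof. by move/matrixP/(_ i j); rewrite !mxE big3 !mxE. Qed.

End Rotations.

(** * Iwasawa decomposition and extension to the line bundle *)

Section Iwasawa.
Variable R : realType.
Implicit Types (g p k : 'M[R]_3).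

Definition sqn2 g : R := g o2 o0 ^+ 2 + g o2 o1 ^+ 2 + g o2 o2 ^+ 2.

Definition cross12 g : 'I_3 -> R := fun j =>
  if j == o0 then g o1 o1 * g o2 o2 - g o1 o2 * g o2 o1
  else if j == o1 then g o1 o2 * g o2 o0 - g o1 o0 * g o2 o2
  else g o1 o0 * g o2 o1 - g o1 o1 * g o2 o0.

Definition sqn12 g : R := cross12 g o0 ^+ 2 + cross12 g o1 ^+ 2 + cross12 g o2 ^+ 2.

Definition krow2 g j : R := (Num.sqrt (sqn2 g))^-1 * g o2 j.
Definition krow0 g j : R := (Num.sqrt (sqn12 g))^-1 * cross12 g j.

(* The orthogonal factor: Gram-Schmidt on the rows of [g], starting from the last one. *)
Definition kpart g : 'M[R]_3 :=
  mx3 (krow0 g o0) (krow0 g o1) (krow0 g o2)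
      (krow2 g o1 * krow0 g o2 - krow2 g o2 * krow0 g o1)
      (krow2 g o2 * krow0 g o0 - krow2 g o0 * krow0 g o2)
      (krow2 g o0 * krow0 g o1 - krow2 g o1 * krow0 g o0)
      (krow2 g o0) (krow2 g o1) (krow2 g o2).

(** The determinant is linear in row 2, and it is the scalar product of row 0 with [cross12 g];
    neither vector can vanish. *)
Lemma sqn_gt0 g : SL3 g -> 0 < sqn2 g /\ 0 < sqn12 g.
Proof.
rewrite /SL3 /= det3 => d.
have pos (x y z : R) : 0 <= x ^+ 2 + y ^+ 2 + z ^+ 2 by rewrite !addr_ge0 ?sqr_ge0.
have nz (x y z : R) : x ^+ 2 + y ^+ 2 + z ^+ 2 = 0 -> [/\ x = 0, y = 0 & z = 0].
  move/eqP; rewrite paddr_eq0 ?addr_ge0 ?sqr_ge0// paddr_eq0 ?sqr_ge0// !sqrf_eq0.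
  by case/andP=> /andP[/eqP-> /eqP->] /eqP->.
split; rewrite lt_neqAle pos andbT; apply/eqP => /esym/nz[].
- move=> h0 h1 h2; move: d; rewrite h0 h1 h2 => d.
  suff : (1 : R) = 0 by move/eqP; rewrite oner_eq0.
  by rewrite -d; ring.
- rewrite /cross12 /= => h0 h1 h2.
  suff : (1 : R) = 0 by move/eqP; rewrite oner_eq0.
  transitivity (g o0 o0 * (g o1 o1 * g o2 o2 - g o1 o2 * g o2 o1) +
    g o0 o1 * (g o1 o2 * g o2 o0 - g o1 o0 * g o2 o2) +
    g o0 o2 * (g o1 o0 * g o2 o1 - g o1 o1 * g o2 o0)); first by rewrite -d; ring.
  by rewrite h0 h1 h2 !mulr0 !addr0.
Qed.

Lemma matrix3P (T : Type) (A B : 'M[T]_3) :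
  [/\ A o0 o0 = B o0 o0, A o0 o1 = B o0 o1 & A o0 o2 = B o0 o2] ->
  [/\ A o1 o0 = B o1 o0, A o1 o1 = B o1 o1 & A o1 o2 = B o1 o2] ->
  [/\ A o2 o0 = B o2 o0, A o2 o1 = B o2 o1 & A o2 o2 = B o2 o2] -> A = B.
Proof.
by move=> [h1 h2 h3] [h4 h5 h6] [h7 h8 h9]; apply/matrixP; apply: ord3P; apply: ord3P.
Qed.

Lemma krows_orthonormal g : SL3 g ->
  [/\ krow2 g o0 ^+ 2 + krow2 g o1 ^+ 2 + krow2 g o2 ^+ 2 = 1,
      krow0 g o0 ^+ 2 + krow0 g o1 ^+ 2 + krow0 g o2 ^+ 2 = 1 &
      krow0 g o0 * krow2 g o0 + krow0 g o1 * krow2 g o1 + krow0 g o2 * krow2 g o2 = 0].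
Proof.
move=> /sqn_gt0[u0 v0].
have hu : (Num.sqrt (sqn2 g))^-1 ^+ 2 * sqn2 g = 1.
  by rewrite exprVn sqr_sqrtr ?ltW// mulVf ?gt_eqF.
have hv : (Num.sqrt (sqn12 g))^-1 ^+ 2 * sqn12 g = 1.
  by rewrite exprVn sqr_sqrtr ?ltW// mulVf ?gt_eqF.
split.
- by rewrite -[RHS]hu /krow2 /sqn2; ring.
- by rewrite -[RHS]hv /krow0 /sqn12; ring.
- by rewrite /krow0 /krow2 /cross12 /=; ring.
Qed.

(** The middle row is the cross product of the last row with the first, and Lagrange's identity
    gives its norm. *)
Lemma mx3_SO3 (a b c x y z : R) :
  x ^+ 2 + y ^+ 2 + z ^+ 2 = 1 -> a ^+ 2 + b ^+ 2 + c ^+ 2 = 1 -> a * x + b * y + c * z = 0 ->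
  SO3 (mx3 a b c (y * c - z * b) (z * a - x * c) (x * b - y * a) x y z).
Proof.
move=> hx ha h0.
have h1 : (y * c - z * b) ^+ 2 + (z * a - x * c) ^+ 2 + (x * b - y * a) ^+ 2 = 1.
  transitivity ((x ^+ 2 + y ^+ 2 + z ^+ 2) * (a ^+ 2 + b ^+ 2 + c ^+ 2) -
    (a * x + b * y + c * z) ^+ 2); first by ring.
  by rewrite hx ha h0; ring.
split.
  apply: matrix3P; split; rewrite /mx3 !mxE big3 !mxE /=.
  - by rewrite -[RHS]ha; ring.
  - by ring.
  - by rewrite -[RHS]h0; ring.
  - by ring.
  - by rewrite -[RHS]h1; ring.
  - by ring.
  - by rewrite -[RHS]h0; ring.
  - by ring.
  - by rewrite -[RHS]hx; ring.
rewrite det3 /mx3 !mxE /=.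
by rewrite -[RHS]h1; ring.
Qed.

Lemma kpart_SO3 g : SL3 g -> SO3 (kpart g).
Proof. by move=> /krows_orthonormal[h1 h2 h3]; apply: mx3_SO3. Qed.

Lemma borel_entries p : borel3 p ->
  [/\ p o1 o0 = 0, p o2 o0 = 0 & p o2 o1 = 0] /\
  [/\ 0 < p o0 o0, 0 < p o1 o1, 0 < p o2 o2 & p o0 o0 * p o1 o1 * p o2 o2 = 1].
Proof.
move=> [h1 h2 h3]; have e10 : p o1 o0 = 0 by apply: h1.
have e20 : p o2 o0 = 0 by apply: h1.
have e21 : p o2 o1 = 0 by apply: h1.
by split => //; split => //; rewrite -h3 det3 e10 e20 e21; ring.
Qed.

(** Row 2 of [p k] is [p22] times row 2 of [k], and the cross product of rows 1 and 2 is [p11 p22]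
    times row 0 of [k]. As the diagonal is positive, normalizing recovers both rows. *)
Lemma iwasawa_unique p k : borel3 p -> SO3 k ->
  [/\ kpart (p *m k) = k, sqn2 (p *m k) = p o2 o2 ^+ 2 &
      sqn12 (p *m k) = (p o1 o1 * p o2 o2) ^+ 2].
Proof.
move=> /borel_entries[[e10 e20 e21] [p0 p1 p2 dp]] [kk dk].
have [[r1 r2 r3] [[s1 s2 s3] _]] := rotation_rows kk dk.
have n0 := row_dot o0 o0 kk; have n2 := row_dot o2 o2 kk; rewrite /= in n0 n2.
have g2 j : (p *m k) o2 j = p o2 o2 * k o2 j by rewrite mxE big3 e20 e21; ring.
have g1 j : (p *m k) o1 j = p o1 o1 * k o1 j + p o1 o2 * k o2 j.
  by rewrite mxE big3 e10; ring.
have c j : cross12 (p *m k) j = p o1 o1 * p o2 o2 * k o0 j.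
  move: j; apply: ord3P; rewrite /cross12 /= !g1 !g2 ?r1 ?r2 ?r3; ring.
have u : sqn2 (p *m k) = p o2 o2 ^+ 2.
  by rewrite /sqn2 !g2 -[RHS]mulr1 -[X in _ = _ * X]n2; ring.
have v : sqn12 (p *m k) = (p o1 o1 * p o2 o2) ^+ 2.
  by rewrite /sqn12 !c -[RHS]mulr1 -[X in _ = _ * X]n0; ring.
have k2 j : krow2 (p *m k) j = k o2 j.
  by rewrite /krow2 u g2 sqrtr_sqr gtr0_norm// mulKf ?gt_eqF.
have k0 j : krow0 (p *m k) j = k o0 j.
  by rewrite /krow0 v c sqrtr_sqr gtr0_norm ?mulr_gt0// mulKf ?gt_eqF ?mulr_gt0.
split => //; rewrite /kpart; apply: matrix3P; split; rewrite /mx3 mxE /= ?k2 ?k0 //.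
Qed.

(** The entries are scalar products of rows of [g] and of [kpart g]. With [x], [y] the inverse norms
    of row 2 and of [cross12 g], the diagonal is [y], [x y sqn12 g], [x sqn2 g], the first because
    [det g = 1]. *)
Lemma iwasawa_exists g : SL3 g -> borel3 (g *m (kpart g)^T).
Proof.
move=> Sg; have [u0 v0] := sqn_gt0 Sg; have [kk dk] := kpart_SO3 Sg.
set x := (Num.sqrt (sqn2 g))^-1; set y := (Num.sqrt (sqn12 g))^-1.
have x0 : 0 < x by rewrite invr_gt0 sqrtr_gt0.
have y0 : 0 < y by rewrite invr_gt0 sqrtr_gt0.
split.
- move=> i j; move: i j; apply: ord3P; apply: ord3P => // _;
    rewrite mxE big3 /kpart /mx3 !mxE /= /krow0 /krow2 -/x -/y /cross12 /=; ring.
- apply: ord3P; rewrite mxE big3 /kpart /mx3 !mxE /= /krow0 /krow2 -/x -/y.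
  + suff -> : g o0 o0 * (y * cross12 g o0) + g o0 o1 * (y * cross12 g o1) +
      g o0 o2 * (y * cross12 g o2) = y by [].
    by rewrite -[RHS]mulr1 -[X in _ = _ * X]Sg det3 /cross12 /=; ring.
  + rewrite [ltRHS](_ : _ = x * y * sqn12 g); first by rewrite !mulr_gt0.
    by rewrite /sqn12 /cross12 /=; ring.
  + rewrite [ltRHS](_ : _ = x * sqn2 g); first by rewrite mulr_gt0.
    by rewrite /sqn2; ring.
- by rewrite det_mulmx det_tr dk mulr1.
Qed.

Lemma iwasawa_decomp g : SL3 g -> g = g *m (kpart g)^T *m kpart g.
Proof.
by move=> Sg; have [kk dk] := kpart_SO3 Sg; rewrite -mulmxA (mulmx1C kk) mulmx1.
Qed.

Lemma lb_charE lam1 lam2 lam3 p : lb_char lam1 lam2 lam3 p =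
  cpow (p o0 o0) (1 + lam1) * cpow (p o1 o1) lam2 * cpow (p o2 o2) (-1 + lam3).
Proof.
have E (i j : 'I_3) : val i = val j -> p i i = p j j by move=> /val_inj ->.
by rewrite /lb_char (E 0 o0 erefl) (E 1 o1 erefl) (E 2 o2 erefl).
Qed.

(** Uniqueness of the Iwasawa factors makes the value chosen by [xget] independent of the choice. *)
Lemma lb_extE lam1 lam2 lam3 phi p k : borel3 p -> SO3 k ->
  lb_ext lam1 lam2 lam3 phi (p *m k) = lb_char lam1 lam2 lam3 p * phi k.
Proof.
move=> bp Sk; rewrite /lb_ext; set A := (X in xget _ X).
have : A (xget 0 A) by apply: xgetPex; exists (lb_char lam1 lam2 lam3 p * phi k), p, k.
move=> [p' [k' [bp' Sk' e ->]]].
have [h1 _ _] := iwasawa_unique bp Sk; have [h2 _ _] := iwasawa_unique bp' Sk'.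
have ek : k' = k by rewrite -h1 e h2.
rewrite ek in e Sk' *; congr (lb_char _ _ _ _ * _).
by rewrite -[p']mulmx1 -(proj1 Sk) mulmxA -e -mulmxA (proj1 Sk) mulmx1.
Qed.

Lemma cpow_sqrt (x : R) s : 0 < x -> cpow (Num.sqrt x) s = cpow x (s / 2).
Proof.
move=> x0; have -> : s = s / 2 + s / 2 by field.
rewrite [in LHS]cpowD -cpowM ?sqrtr_gt0// -expr2 sqr_sqrtr ?ltW//.
by congr (cpow x); field.
Qed.

Lemma cpowV (x : R) s : 0 < x -> cpow x^-1 s = cpow x (- s).
Proof.
move=> x0; rewrite -[LHS]mulr1 -(_ : cpow x (s - s) = 1); last first.
  by rewrite subrr /cpow /= !mul0r expR0 /expi cos0 sin0 mul1r.
by rewrite cpowD mulrA -cpowM ?invr_gt0// mulVf ?gt_eqF// cpow1 mul1r.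
Qed.

(** With [u = sqn2 g] and [v = sqn12 g], the diagonal of the triangular factor is
    [v^(-1/2), (v/u)^(1/2), u^(1/2)]; collecting exponents gives the two powers. *)
Lemma lb_ext_explicit lam1 lam2 lam3 phi g : SL3 g ->
  lb_ext lam1 lam2 lam3 phi g =
  cpow (sqn2 g) ((lam3 - 1 - lam2) / 2) * cpow (sqn12 g) ((lam2 - 1 - lam1) / 2) *
  phi (kpart g).
Proof.
move=> Sg; have bp := iwasawa_exists Sg; have Sk := kpart_SO3 Sg.
have [u0 v0] := sqn_gt0 Sg.
rewrite {1}(iwasawa_decomp Sg) lb_extE//; congr (_ * _).
have [_ hu hv] := iwasawa_unique bp Sk; rewrite -(iwasawa_decomp Sg) in hu hv.
move: (g *m _) bp hu hv => p /borel_entries[_ [p0 p1 p2 dp]] hu hv.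
have E2 : p o2 o2 = Num.sqrt (sqn2 g) by rewrite hu sqrtr_sqr gtr0_norm.
have E12 : p o1 o1 * p o2 o2 = Num.sqrt (sqn12 g).
  by rewrite hv sqrtr_sqr gtr0_norm// mulr_gt0.
have E1 : p o1 o1 = Num.sqrt (sqn12 g) * (Num.sqrt (sqn2 g))^-1.
  by rewrite -E12 -E2 mulfK ?gt_eqF.
have E0 : p o0 o0 = (Num.sqrt (sqn12 g))^-1.
  by rewrite -E12 -[LHS](mulfK (_ : p o1 o1 * p o2 o2 != 0)) ?mulrA ?dp ?mul1r// gt_eqF// mulr_gt0.
rewrite lb_charE E0 E1 E2 cpowM ?invr_gt0 ?sqrtr_gt0// !cpowV ?sqrtr_gt0// !cpow_sqrt//.
have -> : (lam3 - 1 - lam2) / 2 = - lam2 / 2 + (-1 + lam3) / 2 by field.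
have -> : (lam2 - 1 - lam1) / 2 = - (1 + lam1) / 2 + lam2 / 2 by field.
by rewrite !cpowD; ring.
Qed.

Lemma borel3M p q : borel3 p -> borel3 q -> borel3 (p *m q) /\
  (forall i, (p *m q) i i = p i i * q i i).
Proof.
move=> bp bq; have [[e1 e2 e3] [p0 p1 p2 _]] := borel_entries bp.
have [[f1 f2 f3] [q0 q1 q2 _]] := borel_entries bq.
have dg i : (p *m q) i i = p i i * q i i.
  move: i; apply: ord3P; rewrite mxE big3 ?e1 ?e2 ?e3 ?f1 ?f2 ?f3; ring.
split => //; split.
- move=> i j; move: i j; apply: ord3P; apply: ord3P => // _;
    rewrite mxE big3 ?e1 ?e2 ?e3 ?f1 ?f2 ?f3; ring.
- by apply: ord3P; rewrite dg mulr_gt0.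
- by rewrite det_mulmx; case: bp => _ _ ->; case: bq => _ _ ->; rewrite mulr1.
Qed.

Lemma lb_charM lam1 lam2 lam3 p q : borel3 p -> borel3 q ->
  lb_char lam1 lam2 lam3 (p *m q) = lb_char lam1 lam2 lam3 p * lb_char lam1 lam2 lam3 q.
Proof.
move=> bp bq; have [_ dg] := borel3M bp bq.
have [_ [p0 p1 p2 _]] := borel_entries bp; have [_ [q0 q1 q2 _]] := borel_entries bq.
by rewrite !lb_charE !dg !cpowM//; ring.
Qed.

Lemma lb_ext_equivariant lam1 lam2 lam3 phi p g : borel3 p -> SL3 g ->
  lb_ext lam1 lam2 lam3 phi (p *m g) =
  lb_char lam1 lam2 lam3 p * lb_ext lam1 lam2 lam3 phi g.
Proof.
move=> bp Sg; have bq := iwasawa_exists Sg; have Sk := kpart_SO3 Sg.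
rewrite (iwasawa_decomp Sg) mulmxA !lb_extE//; last by have [] := borel3M bp bq.
by rewrite lb_charM// mulrA.
Qed.

Lemma SO3_SL3 k : SO3 k -> SL3 k.
Proof. by case. Qed.

Lemma borel1 : borel3 (1%:M : 'M[R]_3).
Proof.
split; last exact: det1.
- by move=> i j; move: i j; apply: ord3P; apply: ord3P => // _; rewrite mxE.
- by move=> i; rewrite mxE eqxx.
Qed.

Lemma lb_ext_SO3 lam1 lam2 lam3 phi k : SO3 k -> lb_ext lam1 lam2 lam3 phi k = phi k.
Proof.
move=> Sk; rewrite -{1}[k]mul1mx lb_extE//; last exact: borel1.
by rewrite lb_charE !mxE !cpow1 !mul1r.
Qed.

End Iwasawa.

(** * Wigner sums as polynomials in spin 1 functions, and their derivatives *)

Section RotationPolynomials.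
Variable F : numFieldType.
Implicit Types (q : nat -> nat -> F) (i p : int).

(* [wigU (2n)] as a polynomial in the entries [q] of [wigU 2]. *)
Fixpoint wigV (n : nat) q i p : F :=
  if n is n'.+1 then
    ((n'.+1 * n'.*2.+1)%N%:R)^-1 *
    (q 0%N 0%N * wigV n' q i p + q 1%N 0%N * wigV n' q (i - 1) p +
     q 2%N 0%N * wigV n' q (i - 2) p +
     (q 0%N 1%N * wigV n' q i (p - 1) + q 1%N 1%N * wigV n' q (i - 1) (p - 1) +
      q 2%N 1%N * wigV n' q (i - 2) (p - 1)) +
     (q 0%N 2%N * wigV n' q i (p - 2) + q 1%N 2%N * wigV n' q (i - 1) (p - 2) +
      q 2%N 2%N * wigV n' q (i - 2) (p - 2)))
  else ((i == 0) && (p == 0))%:R.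

Variables a b c d : F.

Definition spin_quad (j s : nat) : F :=
  match j, s with
  | 0, 0 => d ^+ 2 / 2 | 0, 1 => b * d | 0, _ => b ^+ 2 / 2
  | 1, 0 => c * d | 1, 1 => a * d + b * c | 1, _ => a * b
  | _, 0 => c ^+ 2 / 2 | _, 1 => a * c | _, _ => a ^+ 2 / 2
  end.

Lemma wigU0 i p : wigU a b c d 0 i p = ((i == 0) && (p == 0))%:R.
Proof.
have [/andP[/eqP-> /eqP->]|h] := boolP (_ && _).
  rewrite /wigU /wsum big_nat1 /wterm /divpow /= !expr0 fact0 divr1; ring.
by apply: wigU_out; move: h; rewrite negb_and => /orP[]/eqP; lia.
Qed.

(** In generating functions, [(L^2 / 2) (L^(2n) / (2n)!)] is [C(2n+2, 2)] times
    [L^(2n+2) / (2n+2)!], and this binomial coefficient is [(n+1)(2n+1)]. *)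
Lemma wigV_spin n i p : wigV n spin_quad i p = wigU a b c d (2 * n%:Z) i p.
Proof.
elim: n i p => [|n IH] i p; first by rewrite mulr0 wigU0.
have nz : ((n.+1 * n.*2.+1)%N%:R : F) != 0 by rewrite pnatr_eq0.
apply: (mulfI nz); rewrite /= mulVKf // !IH.
have := @lincomb_eq0 F a b c d (2 * n.+1%:Z) i p
  [:: (1, [:: (2^-1, (0, 0, 0, 2)%N)], (2 * n%:Z, i, p));
      (1, [:: (1, (0, 0, 1, 1)%N)], (2 * n%:Z, i - 1, p));
      (1, [:: (2^-1, (0, 0, 2, 0)%N)], (2 * n%:Z, i - 2, p));
      (1, [:: (1, (0, 1, 0, 1)%N)], (2 * n%:Z, i, p - 1));
      (1, [:: (1, (1, 0, 0, 1)%N); (1, (0, 1, 1, 0)%N)], (2 * n%:Z, i - 1, p - 1));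
      (1, [:: (1, (1, 0, 1, 0)%N)], (2 * n%:Z, i - 2, p - 1));
      (1, [:: (2^-1, (0, 2, 0, 0)%N)], (2 * n%:Z, i, p - 2));
      (1, [:: (1, (1, 1, 0, 0)%N)], (2 * n%:Z, i - 1, p - 2));
      (1, [:: (2^-1, (2, 0, 0, 0)%N)], (2 * n%:Z, i - 2, p - 2));
      (- (n.+1 * n.*2.+1)%N%:R, [:: (1, (0, 0, 0, 0)%N)], (2 * n.+1%:Z, i, p))].
rewrite /= /poly_eval /= /mono_eval => H.
apply/eqP; rewrite -subr_eq0; apply/eqP; rewrite -[RHS]H {H}.
- by field.
- by rewrite /mono_shift; do !(apply/andP; split => //); apply/eqP; lia.
- move=> A B C D _ _ e.
  have {}e : (A%:R + B%:R + C%:R + D%:R : F) = 2 * (n%:R + 1).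
    by rewrite natr1 -!natrD -natrM; congr (_%:R); lia.
  (* The weights of the nine products add up to [E (E - 1) / 2], where [E = 2 (n + 1)] is the total
     degree. *)
  have -> : ((n.+1 * n.*2.+1)%N%:R : F) = (A%:R + B%:R + C%:R + D%:R) *
     (A%:R + B%:R + C%:R + D%:R - 1) / 2.
    by rewrite e natrM -mul2n -[(2 * n).+1%:R]natr1 natrM -natr1; field.
  by rewrite /poly_weight /mono_weight /=; field.
Qed.

End RotationPolynomials.

Section RotationPolynomialsDerivative.
Variable R : realType.
Implicit Types (q : R -> nat -> nat -> R[i]) (i p : int).

Lemma wigV_ext (F : numFieldType) n (q1 q2 : nat -> nat -> F) i p :
  (forall j s, (j < 3)%N -> (s < 3)%N -> q1 j s = q2 j s) -> wigV n q1 i p = wigV n q2 i p.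
Proof. by move=> h; elim: n i p => [|n IH] i p //=; rewrite !h // !IH. Qed.

(* [wigV n q] transforms under the derivation of the [q]'s like a spin [n] vector in
   its first index. *)
Lemma wigV_cder n q (t0 tp tm : R[i]) t i p :
  (forall s, (s < 3)%N -> [/\
     cder (fun x => q x 0%N s) t (- 2 * t0 * q t 0%N s + tp * q t 1%N s),
     cder (fun x => q x 1%N s) t (2 * tp * q t 2%N s + 2 * tm * q t 0%N s) &
     cder (fun x => q x 2%N s) t (2 * t0 * q t 2%N s + tm * q t 1%N s)]) ->
  cder (fun x => wigV n (q x) i p) t
    (t0 * (2 * i - 2 * n%:Z)%:~R * wigV n (q t) i p +
     tp * (i + 1)%:~R * wigV n (q t) (i + 1) p +
     tm * (2 * n%:Z - i + 1)%:~R * wigV n (q t) (i - 1) p).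
Proof.
move=> hq; elim: n i p => [|n IH] i p.
  apply: cder_eq; first exact: cder_cst.
  rewrite /=; case: (eqVneq p 0) => _; rewrite ?andbF ?andbT /=; last by rewrite !mulr0 !addr0.
  (* For [n = 0] every delta meets a zero of its coefficient: [2 i] at 0, [i + 1] at -1, [1 - i] at
     1. *)
  have [->|i0] := eqVneq i 0; first by rewrite /=; ring.
  have [->|i1] := eqVneq i 1; first by rewrite /=; ring.
  have [->|i2] := eqVneq i (-1).
    by have -> : -1 + 1 = 0 :> int by []; rewrite !(mulr0, mul0r, addr0).
  have /negbTE -> : i + 1 != 0 by lia.
  have /negbTE -> : i - 1 != 0 by lia.
  by rewrite /=; ring.
have [a0 a1 a2] := hq 0%N isT; have [b0 b1 b2] := hq 1%N isT; have [c0 c1 c2] := hq 2%N isT.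
apply: cder_eq.
  rewrite /=; apply: cderZ; apply: cderD; first apply: cderD.
  - by apply: cderD; first apply: cderD; apply: cderM (IH _ _); [exact: a0|exact: a1|exact: a2].
  - by apply: cderD; first apply: cderD; apply: cderM (IH _ _); [exact: b0|exact: b1|exact: b2].
  - by apply: cderD; first apply: cderD; apply: cderM (IH _ _); [exact: c0|exact: c1|exact: c2].
rewrite /=.
have -> : i - 1 + 1 = i by lia.
have -> : i + 1 - 1 = i by lia.
have -> : i - 2 + 1 = i - 1 by lia.
have -> : i + 1 - 2 = i - 1 by lia.
have -> : i - 1 - 1 = i - 2 by lia.
have -> : i - 2 - 1 = i - 3 by lia.
have -> : i - 1 - 2 = i - 3 by lia.
have -> : n.+1%:Z = n%:Z + 1 by lia.
ring.
Qed.

End RotationPolynomialsDerivative.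

(** * Existence of Euler angles *)

Section EulerAngles.
Variable R : realType.
Implicit Types (k : 'M[R]_3) (al be ga : R).
Local Notation Re := complex.Re.
Local Notation Im := complex.Im.

Lemma circle_angle (x y : R) : x ^+ 2 + y ^+ 2 = 1 -> exists t, cos t = x /\ sin t = y.
Proof.
move=> h.
have hx : -1 <= x <= 1 by rewrite -ler_norml -sqrtr_sqr -[leRHS]sqrtr1 ler_wsqrtr// -h lerDl sqr_ge0.
have ey : Num.sqrt (1 - x ^+ 2) = `|y| by rewrite -h addrC addKr sqrtr_sqr.
have [y0|y0] := leP 0 y.
  by exists (acos x); rewrite acosK ?in_itv//= sin_acos// ey ger0_norm.
by exists (- acos x); rewrite cosN sinN acosK ?in_itv//= sin_acos// ey ltr0_norm// opprK.
Qed.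

Lemma euler_entries al be ga :
  [/\ euler al be ga o0 o0 = cos al * cos ga - sin al * cos be * sin ga,
      euler al be ga o0 o1 = - cos al * sin ga - sin al * cos be * cos ga &
      euler al be ga o0 o2 = sin al * sin be] /\
  [/\ euler al be ga o1 o0 = sin al * cos ga + cos al * cos be * sin ga,
      euler al be ga o1 o1 = - sin al * sin ga + cos al * cos be * cos ga &
      euler al be ga o1 o2 = - cos al * sin be] /\
  [/\ euler al be ga o2 o0 = sin be * sin ga,
      euler al be ga o2 o1 = sin be * cos ga &
      euler al be ga o2 o2 = cos be].
Proof.
by do !split; rewrite /euler /eulerR /eulerS /mx3 mxE big3 !mxE !big3 !mxE /=; ring.
Qed.

Lemma euler_exists k : SO3 k -> exists al be ga, 0 <= be <= pi /\ k = euler al be ga.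
Proof.
move=> [kk dk]; have [[r1 r2 r3] [[s1 s2 s3] [t1 t2 t3]]] := rotation_rows kk dk.
have n2 := row_dot o2 o2 kk; rewrite /= in n2.
have kk' : k^T *m k^T^T = 1%:M by rewrite trmxK; apply: mulmx1C.
have m2 := row_dot o2 o2 kk'; rewrite !mxE /= in m2.
have m0 := row_dot o0 o0 kk'; rewrite !mxE /= in m0.
have h22 : -1 <= k o2 o2 <= 1.
  rewrite -ler_norml -sqrtr_sqr -[leRHS]sqrtr1 ler_wsqrtr// -[leRHS]n2 -expr2 lerDr.
  by rewrite -!expr2 addr_ge0 ?sqr_ge0.
pose be := acos (k o2 o2).
have hbe : 0 <= be <= pi by rewrite acos_ge0// acos_lepi.
have cb : cos be = k o2 o2 by rewrite acosK ?in_itv.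
have sb2 : sin be ^+ 2 = 1 - k o2 o2 ^+ 2 by rewrite sin2cos2 cb.
have [sb0|sb0] := eqVneq (sin be) 0.
  move: sb2; rewrite sb0 expr0n /= => /esym/eqP; rewrite subr_eq0 => /eqP e22.
  have sum0 (x y : R) : x * x + y * y + k o2 o2 * k o2 o2 = 1 -> x = 0 /\ y = 0.
    rewrite -!expr2 -e22 => /eqP; rewrite addrC -subr_eq0 addrAC subrr add0r.
    by rewrite paddr_eq0 ?sqr_ge0// !sqrf_eq0 => /andP[/eqP-> /eqP->].
  have [z20 z21] := sum0 _ _ n2; have [z02 z12] := sum0 _ _ m2.
  have [al [ca sa]] : exists al, cos al = k o0 o0 /\ sin al = k o1 o0.
    by apply: circle_angle; rewrite -[RHS]m0 z20; ring.
  (* At a pole only one combination of [al] and [ga] is determined; [ga = 0] is a choice. *)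
  exists al, be, 0; split => //.
  have [[e1 e2 e3] [[e4 e5 e6] [e7 e8 e9]]] := euler_entries al be 0.
  apply: matrix3P; split; rewrite ?e1 ?e2 ?e3 ?e4 ?e5 ?e6 ?e7 ?e8 ?e9 ?cos0 ?sin0 ?cb ?sb0 ?ca ?sa.
  - by ring.
  - by rewrite r2 z12; ring.
  - by rewrite z02; ring.
  - by ring.
  - by rewrite s2 z02; ring.
  - by rewrite z12; ring.
  - by rewrite z20; ring.
  - by rewrite z21; ring.
  - by ring.
have [al [ca sa]] : exists al, cos al = - k o1 o2 / sin be /\ sin al = k o0 o2 / sin be.
  apply: circle_angle; apply: (mulIf (_ : sin be ^+ 2 != 0)); first by rewrite sqrf_eq0.
  by rewrite mul1r [RHS]sb2 -[X in _ = X - _]m2; field.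
have [ga [cg sg]] : exists ga, cos ga = k o2 o1 / sin be /\ sin ga = k o2 o0 / sin be.
  apply: circle_angle; apply: (mulIf (_ : sin be ^+ 2 != 0)); first by rewrite sqrf_eq0.
  by rewrite mul1r [RHS]sb2 -[X in _ = X - _]n2; field.
exists al, be, ga; split => //.
have [[e1 e2 e3] [[e4 e5 e6] [e7 e8 e9]]] := euler_entries al be ga.
have sbsb : sin be * sin be = 1 - k o2 o2 * k o2 o2 by rewrite -!expr2 sb2.
have nz : sin be ^+ 2 != 0 by rewrite sqrf_eq0.
(* One cofactor relation substituted into another expresses the upper left block, times
   [sin be ^+ 2], through the last row and column. *)
have E00 : k o0 o0 * sin be ^+ 2 = - k o2 o2 * k o2 o0 * k o0 o2 - k o1 o2 * k o2 o1.
  by rewrite sb2 mulrBr mulr1 {1}r1 {1}s2; ring.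
have E01 : k o0 o1 * sin be ^+ 2 = k o1 o2 * k o2 o0 - k o2 o2 * k o2 o1 * k o0 o2.
  by rewrite sb2 mulrBr mulr1 {1}r2 {1}s1; ring.
have E10 : k o1 o0 * sin be ^+ 2 = k o2 o1 * k o0 o2 - k o2 o2 * k o1 o2 * k o2 o0.
  by rewrite sb2 mulrBr mulr1 {1}s1 {1}r2; ring.
have E11 : k o1 o1 * sin be ^+ 2 = - k o2 o2 * k o1 o2 * k o2 o1 - k o2 o0 * k o0 o2.
  by rewrite sb2 mulrBr mulr1 {1}s2 {1}r1; ring.
apply: matrix3P; split; rewrite ?e1 ?e2 ?e3 ?e4 ?e5 ?e6 ?e7 ?e8 ?e9 ?cb ?ca ?sa ?cg ?sg;
  try (by field); apply: (mulIf nz); rewrite ?E00 ?E01 ?E10 ?E11; by field.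
Qed.

End EulerAngles.

(** * Spinors of a rotation given by Euler angles *)

Section Spinors.
Variable R : realType.
Implicit Types (k : 'M[R]_3) (al be ga : R).
Local Notation Re := complex.Re.
Local Notation Im := complex.Im.

(** The entries of a rotation in spin 1 weight coordinates on both sides, scaled to match
    [spin_quad]. Being linear in [K], they can be differentiated without choosing a spinor. *)
Definition rot_quad (K : 'I_3 -> 'I_3 -> R[i]) (j s : nat) : R[i] :=
  match j, s with
  | 0, 0 => (K o0 o0 + K o1 o1 - 'i%C * (K o1 o0 - K o0 o1)) / 4
  | 0, 1 => ('i%C * K o0 o2 + K o1 o2) / 2
  | 0, _ => (K o0 o0 - K o1 o1 - 'i%C * (K o0 o1 + K o1 o0)) / 4
  | 1, 0 => (- 'i%C * K o2 o0 + K o2 o1) / 2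
  | 1, 1 => K o2 o2
  | 1, _ => (- 'i%C * K o2 o0 - K o2 o1) / 2
  | _, 0 => (K o0 o0 - K o1 o1 + 'i%C * (K o0 o1 + K o1 o0)) / 4
  | _, 1 => ('i%C * K o0 o2 - K o1 o2) / 2
  | _, _ => (K o0 o0 + K o1 o1 + 'i%C * (K o1 o0 - K o0 o1)) / 4
  end.

(** The minus sign in [spin_b], whose exponent is [l + m2 - r], produces the alternating sign of the
    Wigner function. *)
Definition spin_a al be ga : R[i] := (cos (be / 2))%:C * expi (al / 2) * expi (ga / 2).
Definition spin_b al be ga : R[i] := - (sin (be / 2))%:C * expi (- (al / 2)) * expi (ga / 2).
Definition spin_c al be ga : R[i] := (sin (be / 2))%:C * expi (al / 2) * expi (- (ga / 2)).
Definition spin_d al be ga : R[i] := (cos (be / 2))%:C * expi (- (al / 2)) * expi (- (ga / 2)).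

Lemma expi0 : expi (0 : R) = 1.
Proof. by rewrite /expi cos0 sin0. Qed.

Lemma expi_mulN (t : R) : expi t * expi (- t) = 1.
Proof. by rewrite -expiD subrr expi0. Qed.

Lemma spin_det al be ga :
  spin_a al be ga * spin_d al be ga - spin_b al be ga * spin_c al be ga = 1.
Proof.
transitivity (((cos (be / 2))%:C ^+ 2 + (sin (be / 2))%:C ^+ 2) *
  ((expi (al / 2) * expi (- (al / 2))) * (expi (ga / 2) * expi (- (ga / 2))))).
  by rewrite /spin_a /spin_b /spin_c /spin_d; ring.
by rewrite !expi_mulN !mulr1 -!rmorphXn -rmorphD /= cos2Dsin2.
Qed.

(** Two half-angle phases multiply to a full-angle phase; an angle absent from the left side cancels
    by [expi_mulN]. *)
Lemma spin_quadE al be ga j s : (j < 3)%N -> (s < 3)%N ->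
  rot_quad (fun i j => (euler al be ga i j)%:C) j s =
  spin_quad (spin_a al be ga) (spin_b al be ga) (spin_c al be ga) (spin_d al be ga) j s.
Proof.
have [[e1 e2 e3] [[e4 e5 e6] [e7 e8 e9]]] := euler_entries al be ga.
have half (t : R) : t = t / 2 + t / 2 by field.
have ca : cos al = cos (al / 2) ^+ 2 - sin (al / 2) ^+ 2 by rewrite {1}(half al) cosD -!expr2.
have sa : sin al = 2 * sin (al / 2) * cos (al / 2) by rewrite {1}(half al) sinD; ring.
have cg : cos ga = cos (ga / 2) ^+ 2 - sin (ga / 2) ^+ 2 by rewrite {1}(half ga) cosD -!expr2.
have sg : sin ga = 2 * sin (ga / 2) * cos (ga / 2) by rewrite {1}(half ga) sinD; ring.
have cb : cos be = cos (be / 2) ^+ 2 - sin (be / 2) ^+ 2 by rewrite {1}(half be) cosD -!expr2.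
have sb : sin be = 2 * sin (be / 2) * cos (be / 2) by rewrite {1}(half be) sinD; ring.
have cb1 : cos be = 2 * cos (be / 2) ^+ 2 - 1 by rewrite cb sin2cos2; ring.
have cb2 : cos be = 1 - 2 * sin (be / 2) ^+ 2 by rewrite cb cos2sin2; ring.
have cab : cos (al / 2) ^+ 2 + sin (al / 2) ^+ 2 = 1 by exact: cos2Dsin2.
have cgb : cos (ga / 2) ^+ 2 + sin (ga / 2) ^+ 2 = 1 by exact: cos2Dsin2.
have i2 : (2^-1 : R[i]) = (2^-1 : R)%:C by rewrite fmorphV rmorph_nat.
have i4 : (4^-1 : R[i]) = (4^-1 : R)%:C by rewrite fmorphV rmorph_nat.
have xn : expi (al / 2) * expi (- (al / 2)) = 1 := expi_mulN _.
have yn : expi (ga / 2) * expi (- (ga / 2)) = 1 := expi_mulN _.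
case: j => [|[|[|//]]]; case: s => [|[|[|//]]] // _ _.
all: rewrite /rot_quad /spin_quad ?i2 ?i4 ?e1 ?e2 ?e3 ?e4 ?e5 ?e6 ?e7 ?e8 ?e9.
- by rewrite cb1 ca sa cg sg; apply: complexP; rewrite /spin_d /expi !cosN !sinN /=; field.
- rewrite ca sa sb.
  have -> : spin_b al be ga * spin_d al be ga = - (sin (be / 2) * cos (be / 2))%:C *
     expi (- (al / 2)) ^+ 2.
    rewrite rmorphM /= -[X in _ = X]mulr1 -yn /spin_b /spin_d; ring.
  by apply: complexP; rewrite /expi !cosN !sinN /=; field.
- by rewrite cb2 ca sa cg sg; apply: complexP; rewrite /spin_b /expi !cosN !sinN /=; field.
- rewrite cg sg sb.
  have -> : spin_c al be ga * spin_d al be ga = (sin (be / 2) * cos (be / 2))%:C *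
     expi (- (ga / 2)) ^+ 2.
    rewrite rmorphM /= -[X in _ = X]mulr1 -xn /spin_c /spin_d; ring.
  by apply: complexP; rewrite /expi !cosN !sinN /=; field.
- rewrite cb.
  have -> : spin_a al be ga * spin_d al be ga + spin_b al be ga * spin_c al be ga =
     (cos (be / 2) ^+ 2 - sin (be / 2) ^+ 2)%:C.
    rewrite rmorphB /= !rmorphXn /= -[X in _ = X]mulr1 -xn -[X in _ = X]mulr1 -yn.
    by rewrite /spin_a /spin_b /spin_c /spin_d; ring.
  by [].
- rewrite cg sg sb.
  have -> : spin_a al be ga * spin_b al be ga = - (sin (be / 2) * cos (be / 2))%:C *
     expi (ga / 2) ^+ 2.
    rewrite rmorphM /= -[X in _ = X]mulr1 -xn /spin_a /spin_b; ring.
  by apply: complexP; rewrite /expi /=; field.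
- by rewrite cb2 ca sa cg sg; apply: complexP; rewrite /spin_c /expi !cosN !sinN /=; field.
- rewrite ca sa sb.
  have -> : spin_a al be ga * spin_c al be ga = (sin (be / 2) * cos (be / 2))%:C *
     expi (al / 2) ^+ 2.
    rewrite rmorphM /= -[X in _ = X]mulr1 -yn /spin_a /spin_c; ring.
  by apply: complexP; rewrite /expi /=; field.
- by rewrite cb1 ca sa cg sg; apply: complexP; rewrite /spin_a /expi /=; field.
Qed.

Lemma expiX (t : R) n : expi t ^+ n = expi (n%:R * t).
Proof.
elim: n => [|n IH]; first by rewrite expr0 mul0r expi0.
by rewrite exprS IH -expiD -natr1; congr expi; ring.
Qed.

End Spinors.

(** * Wigner functions as sums of divided powers *)

Section WignerFormula.
Variable R : realType.
Implicit Types (k : 'M[R]_3) (al be ga : R) (l m : int).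

Definition wig_norm l m1 m2 : R :=
  Num.sqrt (factz R (l + m1) * factz R (l - m1) * (factz R (l + m2) * factz R (l - m2))).

Lemma factz_gt0 (z : int) : 0 < factz R z.
Proof. by rewrite /factz ltr0n fact_gt0. Qed.

Lemma sqrtr_div (u w : R) : 0 < u -> 0 < w -> Num.sqrt (u / w) = Num.sqrt (u * w) / w.
Proof.
move=> u0 w0; rewrite !sqrtrM ?ltW// sqrtrV ?ltW// -mulrA; congr (_ * _).
have s0 : Num.sqrt w != 0 by rewrite gt_eqF// sqrtr_gt0.
by rewrite -[X in _ / X]sqr_sqrtr ?ltW//; field.
Qed.

Lemma wigU_restrict (F : numFieldType) (a b c d : F) N i p (lo hi : nat) :
  (forall r : nat, (lo <= r <= hi)%N = (r%:Z <= i) && (r%:Z <= p) && (0 <= N - i - p + r%:Z)) ->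
  (hi <= absz p)%N -> (lo <= hi.+1)%N ->
  wigU a b c d N i p = \sum_(lo <= r < hi.+1)
    (divpow a r%:Z * divpow b (p - r%:Z) * divpow c (i - r%:Z) * divpow d (N - i - p + r%:Z)).
Proof.
move=> h hp lh; rewrite /wigU /wsum.
have z r : ~~ (lo <= r <= hi)%N -> wterm a b c d (fun _ _ _ _ => 1) N i p r%:Z = 0.
  rewrite h => hr; rewrite /wterm.
  have [h1|h1] := ltP (p - r%:Z) 0; first by rewrite (divpow_lt0 b h1) !(mulr0, mul0r).
  have [h2|h2] := ltP (i - r%:Z) 0; first by rewrite (divpow_lt0 c h2) !(mulr0, mul0r).
  have [h3|h3] := ltP (N - i - p + r%:Z) 0; first by rewrite (divpow_lt0 d h3) !(mulr0, mul0r).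
  by exfalso; move/negP: hr; apply; apply/andP; split; [apply/andP; split|]; lia.
rewrite [LHS](big_cat_nat (n := lo)) //=; last by lia.
rewrite [X in X + _ = _]big_nat [X in X + _ = _]big1 ?add0r; last first.
  by move=> r /andP[_ hr]; apply: z; lia.
rewrite [LHS](big_cat_nat (n := hi.+1)) //= [X in _ + X = _]big_nat [X in _ + X = _]big1 ?addr0.
  by apply: eq_bigr => r _; rewrite /wterm mul1r.
by move=> r /andP[hr _]; apply: z; lia.
Qed.

(** With [e2, e3, e4] the exponents of [b, c, d], the binomials combine to
    [(l+m2)! (l-m2)! / (r! e2! e3! e4!)]. The numerator cancels against the denominator of the
    square root, which leaves the symmetric norm [wig_norm]. *)
Lemma wigner_eulerE l m1 m2 al be ga : 0 <= l -> `|m1| <= l -> `|m2| <= l ->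
  wigner_euler l m1 m2 al be ga = (wig_norm l m1 m2)%:C *
   wigU (spin_a al be ga) (spin_b al be ga) (spin_c al be ga) (spin_d al be ga)
     (2 * l) (l + m1) (l + m2).
Proof.
move=> hl h1 h2.
have [A eA] : exists A : nat, l + m1 = A by exists (absz (l + m1)); lia.
have [A' eA'] : exists A : nat, l - m1 = A by exists (absz (l - m1)); lia.
have [P eP] : exists A : nat, l + m2 = A by exists (absz (l + m2)); lia.
have [P' eP'] : exists A : nat, l - m2 = A by exists (absz (l - m2)); lia.
have [lo elo] : exists A : nat, Num.max 0 (m1 + m2) = A.
  by exists (absz (Num.max 0 (m1 + m2))); lia.
have [hi ehi] : exists A : nat, Num.min (l + m1) (l + m2) = A.
  by exists (absz (Num.min (l + m1) (l + m2))); lia.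
rewrite /wigner_euler elo ehi (@wigU_restrict _ _ _ _ _ _ _ _ lo hi); last 3 first.
- by move=> r; apply/idP/idP; lia.
- by lia.
- by lia.
rewrite /wig_norm !eA !eA' !eP !eP' !absz_nat !mulr_sumr rmorph_sum /= mulr_suml.
apply: eq_big_nat => r /andP[hr1 hr2].
have [e2 E2] : exists A : nat, P%:Z - r%:Z = A by exists (P - r)%N; lia.
have [e3 E3] : exists B : nat, A%:Z - r%:Z = B by exists (A - r)%N; lia.
have [e4 E4] : exists B : nat, 2 * l - A%:Z - P%:Z + r%:Z = B.
  by exists (absz (2 * l - A%:Z - P%:Z + r%:Z)); lia.
rewrite E2 E3 E4 absz_nat.
have -> : 2 * r%:Z - m1 - m2 = (r + e4)%N by lia.
have -> : 2 * l + m1 + m2 - 2 * r%:Z = (e2 + e3)%N by lia.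
rewrite -!exprnP /factz !absz_nat.
have eP2 : P = (r + e2)%N by lia.
have eP'2 : P' = (e3 + e4)%N by lia.
have bin1 : 'C(P, r)%:R = P`!%:R / (r`!%:R * e2`!%:R) :> R.
  have := @bin_fact P r; rewrite {1}eP2 leq_addr => /(_ isT) <-.
  by rewrite {3}eP2 addKn !natrM mulfK// mulf_neq0 ?pnatr_eq0 -?lt0n ?fact_gt0.
have bin2 : 'C(P', e3)%:R = P'`!%:R / (e3`!%:R * e4`!%:R) :> R.
  have := @bin_fact P' e3; rewrite {1}eP'2 leq_addr => /(_ isT) <-.
  by rewrite {3}eP'2 addKn !natrM mulfK// mulf_neq0 ?pnatr_eq0 -?lt0n ?fact_gt0.
rewrite bin1 bin2 /divpow.
have fpos (n : nat) : 0 < (n`!%:R : R) by rewrite ltr0n fact_gt0.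
have sq : Num.sqrt (A`!%:R * A'`!%:R / (P`!%:R * P'`!%:R)) =
   Num.sqrt (A`!%:R * A'`!%:R * (P`!%:R * P'`!%:R)) / (P`!%:R * P'`!%:R) :> R.
  by apply: sqrtr_div; rewrite mulr_gt0.
rewrite sq.
have sgn : (-1) ^+ P * (-1) ^+ r = (-1) ^+ e2 :> R.
  by rewrite eP2 exprD mulrAC -expr2 sqrr_sign mul1r.
(* [2 m1] is the exponent of [a, c] minus that of [b, d], and [2 m2] that of [a, b] minus that of
   [c, d]. *)
have phase : expi (m1%:~R * al + m2%:~R * ga) =
   expi (al / 2) ^+ (r + e3) * expi (- (al / 2)) ^+ (e2 + e4) *
   (expi (ga / 2) ^+ (r + e2) * expi (- (ga / 2)) ^+ (e3 + e4)) :> R[i].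
  rewrite !expiX -!expiD; congr expi.
  have -> : m1%:~R = ((r + e3)%N%:R - (e2 + e4)%N%:R) / 2 :> R.
    have : ((r + e3)%N%:Z - (e2 + e4)%N%:Z)%:~R = (2 * m1)%:~R :> R by congr (_%:~R); lia.
    by rewrite intrB intrM -!pmulrn => ->; field.
  have -> : m2%:~R = ((r + e2)%N%:R - (e3 + e4)%N%:R) / 2 :> R.
    have : ((r + e2)%N%:Z - (e3 + e4)%N%:Z)%:~R = (2 * m2)%:~R :> R by congr (_%:~R); lia.
    by rewrite intrB intrM -!pmulrn => ->; field.
  by field.
rewrite phase /spin_a /spin_b /spin_c /spin_d.
have nf (n : nat) : (n`!%:R : R[i]) != 0 by rewrite pnatr_eq0 -lt0n fact_gt0.
set S := Num.sqrt _.
transitivity ((S * ((-1) ^+ P * (-1) ^+ r) *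
   ((r`!%:R)^-1 * (e2`!%:R)^-1 * (e3`!%:R)^-1 * (e4`!%:R)^-1) *
   (cos (be / 2) ^+ (r + e4) * sin (be / 2) ^+ (e2 + e3)))%:C *
   (expi (al / 2) ^+ (r + e3) * expi (- (al / 2)) ^+ (e2 + e4) *
   (expi (ga / 2) ^+ (r + e2) * expi (- (ga / 2)) ^+ (e3 + e4)))).
  congr (_%:C * _).
  have := fpos P; have := fpos P'; have := fpos r; have := fpos e2; have := fpos e3.
  have := fpos e4; do 6! move/lt0r_neq0 => ?.
  by field; do !(apply/andP; split).
rewrite sgn !rmorphM /= !rmorphXn /= !fmorphV !rmorph_nat rmorphN1 !exprMn !exprD.
rewrite -(mulN1r (sin (be / 2))%:C) exprMn.
move: (nf r) (nf e2) (nf e3) (nf e4) => *.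
by field; do !(apply/andP; split).
Qed.

End WignerFormula.

(** * Wigner functions as functions of the matrix *)

Section WignerOnRotations.
Variable R : realType.
Implicit Types (g k : 'M[R]_3) (l m : int).

Definition mxC k : 'I_3 -> 'I_3 -> R[i] := fun i j => (k i j)%:C.

Lemma spinors_exist k : SO3 k -> exists a b c d : R[i], a * d - b * c = 1 /\
  forall j s, (j < 3)%N -> (s < 3)%N -> rot_quad (mxC k) j s = spin_quad a b c d j s.
Proof.
move=> /euler_exists[al [be [ga [_ ->]]]].
exists (spin_a al be ga), (spin_b al be ga), (spin_c al be ga), (spin_d al be ga).
by split; [exact: spin_det|move=> j s hj hs; exact: spin_quadE].
Qed.

(** The right side involves only the matrix, which settles the ambiguity of the Euler angles picked
    by [xget]. *)
Lemma wignerE l m1 m2 k : SO3 k -> 0 <= l -> `|m1| <= l -> `|m2| <= l ->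
  wigner l m1 m2 k =
  (wig_norm R l m1 m2)%:C * wigV (absz l) (rot_quad (mxC k)) (l + m1) (l + m2).
Proof.
move=> Sk hl h1 h2; rewrite /wigner hl h1 h2 /=; set S := (X in xget _ X).
have [al [be [ga [hb ek]]]] := euler_exists Sk.
have : S (xget 0 S).
  by apply: xgetPex; exists (wigner_euler l m1 m2 al be ga), al, be, ga.
move=> [al' [be' [ga' [_ ek' ->]]]].
rewrite wigner_eulerE //; congr (_ * _).
rewrite (@wigV_ext _ _ _ (spin_quad (spin_a al' be' ga') (spin_b al' be' ga')
  (spin_c al' be' ga') (spin_d al' be' ga'))).
  by rewrite wigV_spin gez0_abs.
by move=> j s hj hs; rewrite /mxC ek' spin_quadE.
Qed.

Definition relem (q : 'M[R]_3 -> R) : Prop := elementary_fun (fun g => (q g)%:C).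

Lemma relemD q1 q2 : relem q1 -> relem q2 -> relem (fun g => q1 g + q2 g).
Proof.
move=> h1 h2; apply: elementary_ext (elementaryD h1 h2) => g _.
by rewrite rmorphD.
Qed.

Lemma relemM q1 q2 : relem q1 -> relem q2 -> relem (fun g => q1 g * q2 g).
Proof.
move=> h1 h2; apply: elementary_ext (elementaryM h1 h2) => g _.
by rewrite rmorphM.
Qed.

Lemma relemB q1 q2 : relem q1 -> relem q2 -> relem (fun g => q1 g - q2 g).
Proof.
move=> h1 h2; apply: elementary_ext (elementaryD h1 (elementaryM (elementary_cst (-1)) h2)).
by move=> g _; rewrite mulN1r rmorphB.
Qed.

Lemma relem_entry i j : relem (fun g => g i j).
Proof. exact: elementary_entry. Qed.

Lemma relem_sqn2 : relem (@sqn2 R).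
Proof. by do !apply: relemD; apply: relemM; exact: relem_entry. Qed.

Lemma relem_cross12 j : relem (fun g => cross12 g j).
Proof.
by move: j; apply: ord3P; apply: relemB; apply: relemM; exact: relem_entry.
Qed.

Lemma relem_sqn12 : relem (@sqn12 R).
Proof. by do !apply: relemD; apply: relemM; exact: relem_cross12. Qed.

(** Inverse norms must be written as complex powers, the only non-polynomial operation of
    [elementary_fun]. *)
Lemma cpow_invsqrt (x : R) : 0 < x -> cpow x (- 2^-1) = ((Num.sqrt x)^-1)%:C.
Proof.
move=> x0; have -> : - 2^-1 = -1 / 2 :> R[i] by rewrite mulN1r.
rewrite -cpow_sqrt//.
have -> : cpow (Num.sqrt x) (-1) = cpow (Num.sqrt x) (-1)%:C by rewrite rmorphN1.
by rewrite cpow_real ?sqrtr_gt0// powR_inv1 ?sqrtr_ge0.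
Qed.

Lemma krow2C g j : SL3 g -> (krow2 g j)%:C = cpow (sqn2 g) (- 2^-1) * (g o2 j)%:C.
Proof. by move=> /sqn_gt0[u0 v0]; rewrite cpow_invsqrt// -rmorphM. Qed.

Lemma krow0C g j : SL3 g -> (krow0 g j)%:C = cpow (sqn12 g) (- 2^-1) * (cross12 g j)%:C.
Proof. by move=> /sqn_gt0[u0 v0]; rewrite cpow_invsqrt// -rmorphM. Qed.

Lemma elementary_sqn2 s : elementary_fun (fun g : 'M[R]_3 => cpow (sqn2 g) s).
Proof. by apply: elementary_cpow; [exact: relem_sqn2|move=> g /sqn_gt0[]]. Qed.

Lemma elementary_sqn12 s : elementary_fun (fun g : 'M[R]_3 => cpow (sqn12 g) s).
Proof. by apply: elementary_cpow; [exact: relem_sqn12|move=> g /sqn_gt0[]]. Qed.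

Lemma relem_kpart i j : relem (fun g => kpart g i j).
Proof.
have r2 c : relem (fun g => krow2 g c).
  apply: (elementary_ext (f1 := fun g => cpow (sqn2 g) (- 2^-1) * (g o2 c)%:C)).
    by move=> g Sg; rewrite krow2C.
  by apply: elementaryM; [exact: elementary_sqn2|exact: elementary_entry].
have r0 c : relem (fun g => krow0 g c).
  apply: (elementary_ext (f1 := fun g => cpow (sqn12 g) (- 2^-1) * (cross12 g c)%:C)).
    by move=> g Sg; rewrite krow0C.
  by apply: elementaryM; [exact: elementary_sqn12|exact: relem_cross12].
have E (h : 'M[R]_3 -> R) : relem h -> (forall g, h g = kpart g i j) -> relem (fun g => kpart g i j).
  by move=> hh e; apply: elementary_ext hh => g _; rewrite e.
move: i j E; apply: ord3P; apply: ord3P => E.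
- by apply: E (r0 o0) _ => g; rewrite /kpart /mx3 mxE.
- by apply: E (r0 o1) _ => g; rewrite /kpart /mx3 mxE.
- by apply: E (r0 o2) _ => g; rewrite /kpart /mx3 mxE.
- apply: (E _ (relemB (relemM (r2 o1) (r0 o2)) (relemM (r2 o2) (r0 o1)))) => g.
  by rewrite /kpart /mx3 mxE.
- apply: (E _ (relemB (relemM (r2 o2) (r0 o0)) (relemM (r2 o0) (r0 o2)))) => g.
  by rewrite /kpart /mx3 mxE.
- apply: (E _ (relemB (relemM (r2 o0) (r0 o1)) (relemM (r2 o1) (r0 o0)))) => g.
  by rewrite /kpart /mx3 mxE.
- by apply: E (r2 o0) _ => g; rewrite /kpart /mx3 mxE.
- by apply: E (r2 o1) _ => g; rewrite /kpart /mx3 mxE.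
- by apply: E (r2 o2) _ => g; rewrite /kpart /mx3 mxE.
Qed.

Lemma elementary_wigV n i p :
  elementary_fun (fun g => wigV n (rot_quad (mxC (kpart g))) i p).
Proof.
have c z f : elementary_fun f -> elementary_fun (fun g : 'M[R]_3 => z * f g).
  by move=> hf; apply: elementaryM => //; exact: elementary_cst.
have dv z f : elementary_fun f -> elementary_fun (fun g : 'M[R]_3 => f g / z).
  by move=> hf; apply: elementaryM => //; exact: elementary_cst.
have mn f1 f2 : elementary_fun f1 -> elementary_fun f2 ->
    elementary_fun (fun g : 'M[R]_3 => f1 g - f2 g).
  move=> h1 h2; apply: elementary_ext (elementaryD h1 (c (-1) _ h2)).
  by move=> g _; rewrite mulN1r.
have op f : elementary_fun f -> elementary_fun (fun g : 'M[R]_3 => - f g).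
  by move=> hf; apply: elementary_ext (c (-1) _ hf) => g _; rewrite mulN1r.
have e := relem_kpart; rewrite /relem in e.
have q j s : elementary_fun (fun g => rot_quad (mxC (kpart g)) j s).
  case: j => [|[|j]]; case: s => [|[|s]]; rewrite /rot_quad /mxC //;
  do ?[exact: e|apply: dv|apply: c|apply: mn|apply: elementaryD|apply: op].
have V (Q : 'M[R]_3 -> nat -> nat -> R[i]) : (forall j s, elementary_fun (fun g => Q g j s)) ->
    elementary_fun (fun g => wigV n (Q g) i p).
  move=> hQ; elim: n i p => [|n IH] i p; first exact: elementary_cst.
  rewrite /=; apply: c.
  by do ![apply: elementaryM; [exact: hQ|exact: IH]|apply: elementaryD].
exact: (V (fun g => rot_quad (mxC (kpart g))) q).
Qed.

Definition wig_fun (s1 s2 : R[i]) n i p g : R[i] :=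
  cpow (sqn2 g) s1 * cpow (sqn12 g) s2 * wigV n (rot_quad (mxC (kpart g))) i p.

Lemma wignerL_explicit lam1 lam2 lam3 l m1 m2 g : 0 <= l -> `|m1| <= l -> `|m2| <= l ->
  SL3 g -> wignerL lam1 lam2 lam3 l m1 m2 g = (wig_norm R l m1 m2)%:C *
    wig_fun ((lam3 - 1 - lam2) / 2) ((lam2 - 1 - lam1) / 2) (absz l) (l + m1) (l + m2) g.
Proof.
move=> hl h1 h2 Sg; rewrite /wignerL lb_ext_explicit// wignerE//; last exact: kpart_SO3.
by rewrite mulrCA.
Qed.

Lemma wignerL_elementary lam1 lam2 lam3 l m1 m2 : 0 <= l -> `|m1| <= l -> `|m2| <= l ->
  elementary_fun (@wignerL R lam1 lam2 lam3 l m1 m2).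
Proof.
move=> hl h1 h2.
apply: elementary_ext => [g Sg|]; first by apply/esym; exact: wignerL_explicit.
apply: elementaryM; first exact: elementary_cst.
apply: elementaryM; last exact: elementary_wigV.
by apply: elementaryM; [exact: elementary_sqn2|exact: elementary_sqn12].
Qed.

End WignerOnRotations.

(** * Derivative at a rotation *)

Section DerivativeAtRotation.
Variable R : realType.
Variables (k X : 'M[R]_3).
Hypotheses (Sk : SO3 k) (trX : \tr X = 0).

Let Y : 'M[R]_3 := k *m X *m k^T.
Let curve (t : R) : 'M[R]_3 := k *m expmx (t *: X).

Let kk : k *m k^T = 1%:M := proj1 Sk.
Let dk : \det k = 1 := proj2 Sk.

Lemma curve0 : curve 0 = k.
Proof. by rewrite /curve scale0r expmx0 mulmx1. Qed.

Lemma curve_SL3 t : SL3 (curve t).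
Proof. by apply: SL3_mul_expmx => //; exact: SO3_SL3. Qed.

Lemma Y_trace : Y o0 o0 + Y o1 o1 + Y o2 o2 = 0.
Proof.
have : \tr Y = 0 by rewrite /Y mxtrace_mulC mulmxA (mulmx1C kk) mul1mx.
by rewrite /mxtrace big3.
Qed.

(** Since [k X = Y k], the velocity is [Y] acting on the rows of [k]. *)
Lemma curve_derive i j : is_derive 0 (1 : R) (fun t => curve t i j)
  (Y i o0 * k o0 j + Y i o1 * k o1 j + Y i o2 * k o2 j).
Proof.
rewrite (_ : (fun t => _) = (fun t => k i o0 * expmx (t *: X) o0 j +
    k i o1 * expmx (t *: X) o1 j + k i o2 * expmx (t *: X) o2 j)); last first.
  by apply/funext => t; rewrite /curve mxE big3.
have d c := is_derive_mul (is_derive_cst (k i c) (0 : R) (1 : R)) (is_derive_expmx X 0 c j).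
have h := is_derive_add (is_derive_add (d o0) (d o1)) (d o2).
apply: is_derive_eq h _.
rewrite scale0r expmx0 mul1mx /=.
transitivity ((Y *m k) i j); last by rewrite mxE big3.
by rewrite /Y -mulmxA (mulmx1C kk) mulmx1 [RHS]mxE big3; ring.
Qed.

Lemma cross12_rotation j : cross12 k j = k o0 j.
Proof.
have [[r1 r2 r3] _] := rotation_rows kk dk.
by move: j; apply: ord3P; rewrite /cross12 /= ?r1 ?r2 ?r3.
Qed.

(** With rows [r_i] moving by [Y], expand the derivative of [r_1 x r_2] in the frame, using
    [r_1 x r_2 = r_0] and its cyclic versions. *)
Lemma cross12_derive j : is_derive 0 (1 : R) (fun t => cross12 (curve t) j)
  ((Y o1 o1 + Y o2 o2) * k o0 j - Y o1 o0 * k o1 j - Y o2 o0 * k o2 j).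
Proof.
have [[r1 r2 r3] [[s1 s2 s3] [t1 t2 t3]]] := rotation_rows kk dk.
have minor c e := is_derive_add (is_derive_mul (curve_derive o1 c) (curve_derive o2 e))
   (is_derive_opp (is_derive_mul (curve_derive o1 e) (curve_derive o2 c))).
move: j; apply: ord3P; rewrite /cross12 /=.
- apply: is_derive_eq (minor o1 o2) _; rewrite !curve0 r1 s1 t1; ring.
- apply: is_derive_eq (minor o2 o0) _; rewrite !curve0 r2 s2 t2; ring.
- apply: is_derive_eq (minor o0 o1) _; rewrite !curve0 r3 s3 t3; ring.
Qed.

Lemma sqn2_derive : is_derive 0 (1 : R) (fun t => sqn2 (curve t)) (2 * Y o2 o2).
Proof.
have d j := is_derive_mul (curve_derive o2 j) (curve_derive o2 j).
have h := is_derive_add (is_derive_add (d o0) (d o1)) (d o2).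
apply: is_derive_eq h _; rewrite !curve0.
have h0 := row_dot o2 o0 kk; have h1 := row_dot o2 o1 kk; have h2 := row_dot o2 o2 kk.
rewrite /= in h0 h1 h2.
transitivity (2 * (Y o2 o0 * (k o2 o0 * k o0 o0 + k o2 o1 * k o0 o1 + k o2 o2 * k o0 o2) +
  Y o2 o1 * (k o2 o0 * k o1 o0 + k o2 o1 * k o1 o1 + k o2 o2 * k o1 o2) +
  Y o2 o2 * (k o2 o0 * k o2 o0 + k o2 o1 * k o2 o1 + k o2 o2 * k o2 o2))); first by ring.
by rewrite h0 h1 h2; ring.
Qed.

Lemma sqn12_derive : is_derive 0 (1 : R) (fun t => sqn12 (curve t)) (- 2 * Y o0 o0).
Proof.
have d j := is_derive_mul (cross12_derive j) (cross12_derive j).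
have h := is_derive_add (is_derive_add (d o0) (d o1)) (d o2).
apply: is_derive_eq h _; rewrite !curve0 !cross12_rotation.
have h0 := row_dot o0 o0 kk; have h1 := row_dot o0 o1 kk; have h2 := row_dot o0 o2 kk.
rewrite /= in h0 h1 h2.
transitivity (2 * ((Y o1 o1 + Y o2 o2) *
   (k o0 o0 * k o0 o0 + k o0 o1 * k o0 o1 + k o0 o2 * k o0 o2) -
  Y o1 o0 * (k o0 o0 * k o1 o0 + k o0 o1 * k o1 o1 + k o0 o2 * k o1 o2) -
  Y o2 o0 * (k o0 o0 * k o2 o0 + k o0 o1 * k o2 o1 + k o0 o2 * k o2 o2))); first by ring.
rewrite h0 h1 h2 -[RHS]addr0 -[X in _ = _ + X](mulr0 2) -Y_trace; ring.
Qed.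

Lemma sqn2_rotation : sqn2 k = 1.
Proof. by have := row_dot o2 o2 kk; rewrite /= /sqn2 !expr2. Qed.

Lemma sqn12_rotation : sqn12 k = 1.
Proof. by have := row_dot o0 o0 kk; rewrite /= /sqn12 !cross12_rotation !expr2. Qed.

Lemma sqn2_cder s : cder (fun t => cpow (sqn2 (curve t)) s) 0 (s * (2 * Y o2 o2)%:C).
Proof.
have := @cder_cpow R _ 0 _ s _ sqn2_derive; rewrite !curve0 sqn2_rotation !cpow1 !mulr1.
by apply; exact: ltr01.
Qed.

Lemma sqn12_cder s : cder (fun t => cpow (sqn12 (curve t)) s) 0 (s * (- 2 * Y o0 o0)%:C).
Proof.
have := @cder_cpow R _ 0 _ s _ sqn12_derive; rewrite !curve0 sqn12_rotation !cpow1 !mulr1.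
by apply; exact: ltr01.
Qed.

Lemma kpart_rotation : kpart k = k.
Proof. by have [h _ _] := iwasawa_unique (borel1 R) Sk; rewrite mul1mx in h. Qed.

Lemma krow2_cder j : cder (fun t => (krow2 (curve t) j)%:C) 0
  (Y o2 o0 * k o0 j + Y o2 o1 * k o1 j)%:C.
Proof.
apply: (cder_ext (h1 := fun t => cpow (sqn2 (curve t)) (- 2^-1) * (curve t o2 j)%:C)).
  by move=> t; rewrite krow2C//; exact: curve_SL3.
have h := cderM (sqn2_cder (- 2^-1)) (cder_real (curve_derive o2 j)).
apply: cder_eq h _; rewrite curve0 sqn2_rotation cpow1 mul1r.
by rewrite !(rmorph_nat, rmorphD, rmorphM) /=; field.
Qed.

Lemma krow0_cder j : cder (fun t => (krow0 (curve t) j)%:C) 0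
  (- Y o1 o0 * k o1 j - Y o2 o0 * k o2 j)%:C.
Proof.
apply: (cder_ext (h1 := fun t => cpow (sqn12 (curve t)) (- 2^-1) * (cross12 (curve t) j)%:C)).
  by move=> t; rewrite krow0C//; exact: curve_SL3.
have h := cderM (sqn12_cder (- 2^-1)) (cder_real (cross12_derive j)).
apply: cder_eq h _; rewrite curve0 sqn12_rotation cpow1 mul1r cross12_rotation.
have -> : Y o0 o0 = - (Y o1 o1 + Y o2 o2) by rewrite -[LHS]subr0 -Y_trace; ring.
by rewrite !(rmorph_nat, rmorphD, rmorphB, rmorphN, rmorphM) /=; field.
Qed.

Lemma krow2_rotation j : krow2 k j = k o2 j.
Proof.
by rewrite -[in RHS]kpart_rotation /kpart /mx3 mxE; move: j; apply: ord3P.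
Qed.

Lemma krow0_rotation j : krow0 k j = k o0 j.
Proof.
by rewrite -[in RHS]kpart_rotation /kpart /mx3 mxE; move: j; apply: ord3P.
Qed.

(* The orthogonal factor moves by the skew matrix that agrees with [Y] below the diagonal. *)
Lemma kpart_cder j :
  [/\ cder (fun t => mxC (kpart (curve t)) o0 j) 0 (- Y o1 o0 * k o1 j - Y o2 o0 * k o2 j)%:C,
      cder (fun t => mxC (kpart (curve t)) o1 j) 0 (Y o1 o0 * k o0 j - Y o2 o1 * k o2 j)%:C &
      cder (fun t => mxC (kpart (curve t)) o2 j) 0 (Y o2 o0 * k o0 j + Y o2 o1 * k o1 j)%:C].
Proof.
have [[r1 r2 r3] [[s1 s2 s3] [t1 t2 t3]]] := rotation_rows kk dk.
split.
- apply: cder_ext (krow0_cder j) => t; rewrite /mxC /kpart /mx3 mxE.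
  by move: j; apply: ord3P.
- have minor c e := cderD (cderM (krow2_cder c) (krow0_cder e))
     (cderZ (-1) (cderM (krow2_cder e) (krow0_cder c))).
  move: j; apply: ord3P.
  + apply: cder_eq (cder_ext _ (minor o1 o2)) _.
      by move=> t; rewrite /mxC /kpart /mx3 mxE /= mulN1r -!rmorphM -rmorphB.
    rewrite !curve0 !krow2_rotation !krow0_rotation mulN1r.
    rewrite -!rmorphM -!rmorphD -!rmorphB /=; congr (_%:C); rewrite r1 t1; ring.
  + apply: cder_eq (cder_ext _ (minor o2 o0)) _.
      by move=> t; rewrite /mxC /kpart /mx3 mxE /= mulN1r -!rmorphM -rmorphB.
    rewrite !curve0 !krow2_rotation !krow0_rotation mulN1r.
    rewrite -!rmorphM -!rmorphD -!rmorphB /=; congr (_%:C); rewrite r2 t2; ring.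
  + apply: cder_eq (cder_ext _ (minor o0 o1)) _.
      by move=> t; rewrite /mxC /kpart /mx3 mxE /= mulN1r -!rmorphM -rmorphB.
    rewrite !curve0 !krow2_rotation !krow0_rotation mulN1r.
    rewrite -!rmorphM -!rmorphD -!rmorphB /=; congr (_%:C); rewrite r3 t3; ring.
- apply: cder_ext (krow2_cder j) => t; rewrite /mxC /kpart /mx3 mxE.
  by move: j; apply: ord3P.
Qed.

(** Weight coordinates of the skew matrix with lower entries [Y10, Y20, Y21]: [t0] scales a
    component by its weight, [tp] and [tm] couple neighbours, as [wigV_cder] requires. *)
Let t0 : R[i] := 'i%C * (Y o1 o0)%:C / 2.
Let tp : R[i] := (- (Y o2 o1)%:C - 'i%C * (Y o2 o0)%:C) / 2.
Let tm : R[i] := ((Y o2 o1)%:C - 'i%C * (Y o2 o0)%:C) / 2.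

Lemma rot_quad_cder s : (s < 3)%N -> [/\
   cder (fun t => rot_quad (mxC (kpart (curve t))) 0 s) 0
     (- 2 * t0 * rot_quad (mxC k) 0 s + tp * rot_quad (mxC k) 1 s),
   cder (fun t => rot_quad (mxC (kpart (curve t))) 1 s) 0
     (2 * tp * rot_quad (mxC k) 2 s + 2 * tm * rot_quad (mxC k) 0 s) &
   cder (fun t => rot_quad (mxC (kpart (curve t))) 2 s) 0
     (2 * t0 * rot_quad (mxC k) 2 s + tm * rot_quad (mxC k) 1 s)].
Proof.
have [a0 b0 c0] := kpart_cder o0; have [a1 b1 c1] := kpart_cder o1.
have [a2 b2 c2] := kpart_cder o2.
have cB (h1 h2 : R -> R[i]) d1 d2 : cder h1 0 d1 -> cder h2 0 d2 ->
    cder (fun x => h1 x - h2 x) 0 (d1 - d2).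
  move=> H1 H2; have h := cderD H1 (cderZ (-1) H2).
  by rewrite -[- d2]mulN1r; apply: cder_ext h => x; rewrite mulN1r.
have cV (h1 : R -> R[i]) d1 c : cder h1 0 d1 -> cder (fun x => h1 x / c) 0 (d1 / c).
  by move=> H1; rewrite [d1 / c]mulrC; apply: cder_ext (cderZ c^-1 H1) => x; rewrite mulrC.
have i2 : (2^-1 : R[i]) = (2^-1 : R)%:C by rewrite fmorphV rmorph_nat.
have i4 : (4^-1 : R[i]) = (4^-1 : R)%:C by rewrite fmorphV rmorph_nat.
rewrite /t0 /tp /tm.
case: s => [|[|[|//]]] _; split; rewrite /rot_quad.
- apply: cder_eq (cV _ _ _ (cB _ _ _ _ (cderD a0 b1) (cderZ _ (cB _ _ _ _ b0 a1)))) _.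
  by rewrite /mxC i2 i4; apply: complexP; rewrite /=; field.
- apply: cder_eq (cV _ _ _ (cderD (cderZ _ c0) c1)) _.
  by rewrite /mxC i2 i4; apply: complexP; rewrite /=; field.
- apply: cder_eq (cV _ _ _ (cderD (cB _ _ _ _ a0 b1) (cderZ _ (cderD a1 b0)))) _.
  by rewrite /mxC i2 i4; apply: complexP; rewrite /=; field.
- apply: cder_eq (cV _ _ _ (cderD (cderZ _ a2) b2)) _.
  by rewrite /mxC i2; apply: complexP; rewrite /=; field.
- apply: cder_eq c2 _.
  by rewrite /mxC i2; apply: complexP; rewrite /=; field.
- apply: cder_eq (cV _ _ _ (cB _ _ _ _ (cderZ _ a2) b2)) _.
  by rewrite /mxC i2; apply: complexP; rewrite /=; field.
- apply: cder_eq (cV _ _ _ (cB _ _ _ _ (cB _ _ _ _ a0 b1) (cderZ _ (cderD a1 b0)))) _.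
  by rewrite /mxC i2 i4; apply: complexP; rewrite /=; field.
- apply: cder_eq (cV _ _ _ (cB _ _ _ _ (cderZ _ c0) c1)) _.
  by rewrite /mxC i2 i4; apply: complexP; rewrite /=; field.
- apply: cder_eq (cV _ _ _ (cderD (cderD a0 b1) (cderZ _ (cB _ _ _ _ b0 a1)))) _.
  by rewrite /mxC i2 i4; apply: complexP; rewrite /=; field.
Qed.

Lemma wig_fun_cder s1 s2 n i p :
  cder (fun t => wig_fun s1 s2 n i p (curve t)) 0
  ((s1 * (2 * Y o2 o2)%:C + s2 * (- 2 * Y o0 o0)%:C) * wigV n (rot_quad (mxC k)) i p +
  (t0 * (2 * i - 2 * n%:Z)%:~R * wigV n (rot_quad (mxC k)) i p +
   tp * (i + 1)%:~R * wigV n (rot_quad (mxC k)) (i + 1) p +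
   tm * (2 * n%:Z - i + 1)%:~R * wigV n (rot_quad (mxC k)) (i - 1) p)).
Proof.
have hV := @wigV_cder R n (fun t => rot_quad (mxC (kpart (curve t)))) t0 tp tm 0 i p.
rewrite /= curve0 kpart_rotation in hV.
have h := cderM (cderM (sqn2_cder s1) (sqn12_cder s2)) (hV rot_quad_cder).
apply: cder_eq h _; rewrite /= curve0 kpart_rotation sqn2_rotation sqn12_rotation !cpow1.
by ring.
Qed.

End DerivativeAtRotation.

(** * Clebsch-Gordan coefficients freed of their factorials *)

Section ReducedClebschGordan.
Variable R : realType.
Implicit Types (k j l m n : int).

Definition fact2 l m : R := factz R (l + m) * factz R (l - m).

Lemma fact2_gt0 l m : 0 < fact2 l m.
Proof. by rewrite mulr_gt0 ?factz_gt0. Qed.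

Lemma wig_normE l m1 m2 : wig_norm R l m1 m2 = Num.sqrt (fact2 l m1) * Num.sqrt (fact2 l m2).
Proof. by rewrite -sqrtrM// ltW// fact2_gt0. Qed.

Definition cg_scale k : R := (Num.sqrt (factz R (2 - k) * factz R (2 + k)))^-1.

(** For [j <= 0] the target factorials [b] stand in the denominator and cancel against the target
    norm. *)
Lemma sqrt_lower (K D e a b : R) : 0 < K -> 0 < D -> 0 < e -> 0 < a -> 0 < b ->
  Num.sqrt (K * a) / Num.sqrt (D * e * b) * Num.sqrt b =
  Num.sqrt a * Num.sqrt (K / D) / Num.sqrt e.
Proof.
move=> K0 D0 e0 a0 b0.
have [sD se sb] : [/\ Num.sqrt D != 0, Num.sqrt e != 0 & Num.sqrt b != 0].
  by rewrite !gt_eqF ?sqrtr_gt0.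
rewrite !sqrtrM ?ltW ?mulr_gt0// sqrtrV ?ltW//.
by field; rewrite sD se sb.
Qed.

(** For [j > 0] they stand in the numerator, so the target norm completes them to [b], and [b / a]
    is a rational function of [l] and [m]. *)
Lemma sqrt_raise (K D e a b : R) : 0 < K -> 0 < D -> 0 < e -> 0 < a -> 0 < b ->
  Num.sqrt (K * b) / Num.sqrt (D * e * a) * Num.sqrt b =
  b / a * (Num.sqrt a * Num.sqrt (K / D) / Num.sqrt e).
Proof.
move=> K0 D0 e0 a0 b0.
have [sD se sa] : [/\ Num.sqrt D != 0, Num.sqrt e != 0 & Num.sqrt a != 0].
  by rewrite !gt_eqF ?sqrtr_gt0.
rewrite -{3}[b]sqr_sqrtr ?ltW// -{2}[a]sqr_sqrtr ?ltW//.
rewrite !sqrtrM ?ltW ?mulr_gt0// sqrtrV ?ltW//.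
by field; rewrite sD se sa.
Qed.

Lemma factz_rise (z : int) (n : nat) : 0 <= z ->
  factz R (z + n%:Z) = rise (z%:~R : R) n * factz R z.
Proof.
move=> z0; elim: n => [|n IH]; first by rewrite addr0 mul1r.
have -> : factz R (z + n.+1%:Z) = (z + n.+1%:Z)%:~R * factz R (z + n%:Z).
  rewrite /factz (_ : absz (z + n.+1%:Z) = (absz (z + n%:Z)%R).+1); last by lia.
  rewrite factS natrM; congr (_ * _); rewrite pmulrn; congr (_%:~R); lia.
by rewrite IH /= intrD -pmulrn mulrA.
Qed.

Lemma factz_pred (z : int) : 0 < z -> factz R z = z%:~R * factz R (z - 1).
Proof.
move=> z0; rewrite -{1}[z](subrK 1) (@factz_rise (z - 1) 1); last by lia.
by rewrite /= mulr1 intrB subrK.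
Qed.

Lemma fact2_ratio j k l m : j \in [:: 1; 2] -> k \in [:: -2; -1; 0; 1; 2] ->
  0 <= l + m -> 0 <= l - m -> 0 <= l + m + (j + k) -> 0 <= l - m + (j - k) ->
  (if j == 1 then (l * k - 2 * m)%:~R else 1) * (fact2 (l + j) (m + k) / fact2 l m) =
  rcg j k (l%:~R : R) m%:~R.
Proof.
move=> hj hk h1 h2 h3 h4.
have f1 : factz R (l + m) != 0 by rewrite gt_eqF ?factz_gt0.
have f2 : factz R (l - m) != 0 by rewrite gt_eqF ?factz_gt0.
have r1 (z : int) (n : nat) : z = n%:Z ->
    factz R (l + m + z) = rise (l%:~R + m%:~R : R) n * factz R (l + m).
  by move=> ->; rewrite factz_rise// intrD.
have r2 (z : int) (n : nat) : z = n%:Z ->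
    factz R (l - m + z) = rise (l%:~R - m%:~R : R) n * factz R (l - m).
  by move=> ->; rewrite factz_rise// intrB.
have [E1 E2] : l + j + (m + k) = l + m + (j + k) /\ l + j - (m + k) = l - m + (j - k) by lia.
rewrite /fact2 E1 E2; move: h3 h4 {E1 E2}.
move: hj hk; rewrite !inE => /orP[]/eqP-> /or4P[/eqP->|/eqP->|/eqP->|/orP[]/eqP->] h3 h4.
(* For [j = 1, k = -2] one factorial drops below [(l + m)!]; the denominator [l + m] cancels against
   [l k - 2 m = -2 (l + m)]. *)
- have p : factz R (l + m + (1 - 2)) = factz R (l + m) / (l%:~R + m%:~R).
    rewrite [factz R (l + m)]factz_pred; last by lia.
    by rewrite intrD mulrAC mulfV ?mul1r// -intrD intr_eq0; lia.
  have nz : l%:~R + m%:~R != 0 :> R by rewrite -intrD intr_eq0; lia.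
  by rewrite p (r2 _ 3%N erefl) /rcg /=; field; rewrite nz f1 f2.
- by rewrite (r1 _ 0%N erefl) (r2 _ 2%N erefl) /rcg /=; field; rewrite f1 f2.
- by rewrite (r1 _ 1%N erefl) (r2 _ 1%N erefl) /rcg /=; field; rewrite f1 f2.
- by rewrite (r1 _ 2%N erefl) (r2 _ 0%N erefl) /rcg /=; field; rewrite f1 f2.
- have p : factz R (l - m + (1 - 2)) = factz R (l - m) / (l%:~R - m%:~R).
    rewrite [factz R (l - m)]factz_pred; last by lia.
    by rewrite intrB mulrAC mulfV ?mul1r// -intrB intr_eq0; lia.
  have nz : l%:~R - m%:~R != 0 :> R by rewrite -intrB intr_eq0; lia.
  by rewrite p (r1 _ 3%N erefl) /rcg /=; field; rewrite nz f1 f2.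
- by rewrite (r1 _ 0%N erefl) (r2 _ 4%N erefl) /rcg /=; field; rewrite f1 f2.
- by rewrite (r1 _ 1%N erefl) (r2 _ 3%N erefl) /rcg /=; field; rewrite f1 f2.
- by rewrite (r1 _ 2%N erefl) (r2 _ 2%N erefl) /rcg /=; field; rewrite f1 f2.
- by rewrite (r1 _ 3%N erefl) (r2 _ 1%N erefl) /rcg /=; field; rewrite f1 f2.
- by rewrite (r1 _ 4%N erefl) (r2 _ 0%N erefl) /rcg /=; field; rewrite f1 f2.
Qed.

Lemma signz k : k \in [:: -2; -1; 0; 1; 2] -> (-1 : R) ^ k = sgnz R k.
Proof.
rewrite !inE => /or4P[/eqP->|/eqP->|/eqP->|/orP[]/eqP->]; rewrite /sgnz /=.
- by rewrite -[LHS]/(((-1) ^+ 2)^-1) sqrrN expr1n invr1.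
- by rewrite -[LHS]/(((-1) ^+ 1)^-1) expr1 invrN1.
- by rewrite expr0z.
- by rewrite expr1z.
- by rewrite -exprnP sqrrN expr1n.
Qed.

(** The target norm trades all factorials in [l] and [m] for the source norm; what remains is a root
    in [j, l], a root in [k], and a polynomial. *)
Lemma cg_reduced k j l m : k \in [:: -2; -1; 0; 1; 2] -> j \in [:: -2; -1; 0; 1; 2] ->
  `|m| <= l -> `|m + k| <= l + j ->
  cg R k j l m * Num.sqrt (fact2 (l + j) (m + k)) =
  Num.sqrt (fact2 l m) * Num.sqrt (rcg_den j (l%:~R : R)) * cg_scale k * rcg j k l%:~R m%:~R.
Proof.
move=> hk hj hm hmk; rewrite /cg.
have k2 : `|k| <= 2 by move: hk; rewrite !inE => /or4P[/eqP->|/eqP->|/eqP->|/orP[]/eqP->].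
have j2 : `|j| <= 2 by move: hj; rewrite !inE => /or4P[/eqP->|/eqP->|/eqP->|/orP[]/eqP->].
rewrite k2 j2 hm [k + m]addrC hmk /=.
have a0 := fact2_gt0 l m; have b0 := fact2_gt0 (l + j) (m + k).
have e0 : 0 < factz R (2 - k) * factz R (2 + k) by rewrite mulr_gt0 ?factz_gt0.
(* When the triangle condition fails, [cg] is 0 by definition, and the root on the right is 0
   because [rcg_den] contains an inverse of 0. *)
case: ifPn => hl; last first.
  rewrite mul0r (_ : rcg_den j (l%:~R : R) = 0) ?sqrtr0 ?(mulr0, mul0r)//.
  have : (j \in [:: -2; -1; 0; 1]) && (l == 0) || (j \in [:: -2; -1]) && (l == 1).
    by move: hl {k2 j2 hmk a0 b0 e0} hj; rewrite !inE =>
      hl /or4P[/eqP ej|/eqP ej|/eqP ej|/orP[]/eqP ej]; rewrite ej /= in hl *; lia.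
  case/orP; rewrite !inE => /andP[h /eqP->].
    by case/or4P: h => /eqP->; rewrite /rcg_den /= !mul0r invr0 mulr0.
  by case/orP: h => /eqP->; rewrite /rcg_den /= subrr !(mulr0, mul0r) invr0 mulr0.
pose x : R := l%:~R.
have idx c : factz R (l - k - m + c) * factz R (l + k + m + c) = fact2 (l + c) (m + k).
  by rewrite /fact2 mulrC; congr (factz R _ * factz R _); lia.
have pos (D : int) : 0 < D -> 0 < D%:~R :> R by rewrite ltr0z.
move: hj; rewrite !inE => /or4P[/eqP ej|/eqP ej|/eqP ej|/orP[]/eqP ej];
  rewrite ej /= in hl hmk b0 *.
- have D0 := pos (l * (l - 1) * (2 * l - 1) * (2 * l + 1)) ltac:(nia).
  have low := sqrt_lower (ltr0Sn R 5) D0 e0 a0 b0.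
  have DE : (l * (l - 1) * (2 * l - 1) * (2 * l + 1))%:~R = x * (x - 1) * (2 * x - 1) * (2 * x + 1) :> R by rewrite /x; ring.
  rewrite /cg_m2 signz//.
  have -> : 6 * factz R (l - m) * factz R (l + m) = 6%:R * fact2 l m by rewrite /fact2; ring.
  have -> : (l * (l - 1) * (2 * l - 1) * (2 * l + 1))%:~R * factz R (2 - k) * factz R (2 + k) * factz R (l - k - m - 2) * factz R (l + k + m - 2) =
    (l * (l - 1) * (2 * l - 1) * (2 * l + 1))%:~R * (factz R (2 - k) * factz R (2 + k)) * fact2 (l - 2) (m + k).
    by rewrite -idx; ring.
  rewrite DE in low *; rewrite /rcg_den /rcg /= -/x /cg_scale.
  transitivity (sgnz R k * (Num.sqrt (6%:R * fact2 l m) / Num.sqrt (x * (x - 1) * (2 * x - 1) * (2 * x + 1) * (factz R (2 - k) * factz R (2 + k)) *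
      fact2 (l - 2) (m + k)) * Num.sqrt (fact2 (l - 2) (m + k)))); first by rewrite /x; ring.
  by rewrite low /x; ring.
- have D0 := pos (l * (l - 1) * (l + 1) * (2 * l + 1)) ltac:(nia).
  have low := sqrt_lower (ltr0Sn R 2) D0 e0 a0 b0.
  have DE : (l * (l - 1) * (l + 1) * (2 * l + 1))%:~R = x * (x - 1) * (x + 1) * (2 * x + 1) :> R by rewrite /x; ring.
  rewrite /cg_m1 signz//.
  have -> : 3 * factz R (l - m) * factz R (l + m) = 3%:R * fact2 l m by rewrite /fact2; ring.
  have -> : (l * (l - 1) * (l + 1) * (2 * l + 1))%:~R * factz R (2 - k) * factz R (2 + k) * factz R (l - k - m - 1) * factz R (l + k + m - 1) =
    (l * (l - 1) * (l + 1) * (2 * l + 1))%:~R * (factz R (2 - k) * factz R (2 + k)) * fact2 (l - 1) (m + k).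
    by rewrite -idx; ring.
  rewrite DE in low *; rewrite /rcg_den /rcg /= -/x /cg_scale.
  transitivity ((sgnz R k * (k + l * k + 2 * m)%:~R) * (Num.sqrt (3%:R * fact2 l m) / Num.sqrt (x * (x - 1) * (x + 1) * (2 * x + 1) * (factz R (2 - k) * factz R (2 + k)) *
      fact2 (l - 1) (m + k)) * Num.sqrt (fact2 (l - 1) (m + k)))); first by rewrite /x; ring.
  by rewrite low /x; ring.
- have D0 := pos (l * (l + 1) * (2 * l - 1) * (2 * l + 3)) ltac:(nia).
  have low := sqrt_lower (ltr0Sn R 0) D0 e0 a0 b0.
  have DE : (l * (l + 1) * (2 * l - 1) * (2 * l + 3))%:~R = x * (x + 1) * (2 * x - 1) * (2 * x + 3) :> R by rewrite /x; ring.
  rewrite /cg_0 signz//.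
  have -> : factz R (l - m) * factz R (l + m) = 1%:R * fact2 l m by rewrite /fact2; ring.
  have -> : (l * (l + 1) * (2 * l - 1) * (2 * l + 3))%:~R * factz R (2 - k) * factz R (2 + k) * factz R (l - k - m) * factz R (l + k + m) =
    (l * (l + 1) * (2 * l - 1) * (2 * l + 3))%:~R * (factz R (2 - k) * factz R (2 + k)) * fact2 (l + 0) (m + k).
    by rewrite -idx ?addr0; ring.
  rewrite DE in low *; rewrite /rcg_den /rcg /= -/x /cg_scale.
  transitivity ((sgnz R k * (2 * l ^+ 2 * (k ^+ 2 - 1) + l * (5 * k ^+ 2 + 6 * k * m - 2) + 3 * (k ^+ 2 + 3 * k * m + 2 * m ^+ 2))%:~R) * (Num.sqrt (1%:R * fact2 l m) / Num.sqrt (x * (x + 1) * (2 * x - 1) * (2 * x + 3) * (factz R (2 - k) * factz R (2 + k)) *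
      fact2 (l + 0) (m + k)) * Num.sqrt (fact2 (l + 0) (m + k)))); first by rewrite /x; ring.
  by rewrite low /x; ring.
- have D0 := pos (l * (l + 1) * (l + 2) * (2 * l + 1)) ltac:(nia).
  have high := sqrt_raise (ltr0Sn R 2) D0 e0 a0 b0.
  have DE : (l * (l + 1) * (l + 2) * (2 * l + 1))%:~R = x * (x + 1) * (x + 2) * (2 * x + 1) :> R by rewrite /x; ring.
  have ratio := @fact2_ratio 1 k l m isT hk ltac:(lia) ltac:(lia) ltac:(lia) ltac:(lia).
  rewrite /cg_1.
  have -> : 3 * factz R (l - k - m + 1) * factz R (l + k + m + 1) = 3%:R * fact2 (l + 1) (m + k).
    by rewrite -idx; ring.
  have -> : (l * (l + 1) * (l + 2) * (2 * l + 1))%:~R * factz R (2 - k) * factz R (2 + k) * factz R (l - m) * factz R (l + m) =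
    (l * (l + 1) * (l + 2) * (2 * l + 1))%:~R * (factz R (2 - k) * factz R (2 + k)) * fact2 l m by rewrite /fact2; ring.
  rewrite -ratio; rewrite DE in high *; rewrite /rcg_den /= -/x /cg_scale.
  transitivity ((l * k - 2 * m)%:~R * (Num.sqrt (3%:R * fact2 (l + 1) (m + k)) / Num.sqrt (x * (x + 1) * (x + 2) * (2 * x + 1) * (factz R (2 - k) * factz R (2 + k)) *
      fact2 l m) * Num.sqrt (fact2 (l + 1) (m + k)))); first by ring.
  by rewrite high; ring.
- have D0 := pos ((l + 1) * (l + 2) * (2 * l + 1) * (2 * l + 3)) ltac:(nia).
  have high := sqrt_raise (ltr0Sn R 5) D0 e0 a0 b0.
  have DE : ((l + 1) * (l + 2) * (2 * l + 1) * (2 * l + 3))%:~R = (x + 1) * (x + 2) * (2 * x + 1) * (2 * x + 3) :> R by rewrite /x; ring.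
  have ratio := @fact2_ratio 2 k l m isT hk ltac:(lia) ltac:(lia) ltac:(lia) ltac:(lia).
  rewrite /cg_2.
  have -> : 6 * factz R (l - k - m + 2) * factz R (l + k + m + 2) = 6%:R * fact2 (l + 2) (m + k).
    by rewrite -idx; ring.
  have -> : ((l + 1) * (l + 2) * (2 * l + 1) * (2 * l + 3))%:~R * factz R (2 - k) * factz R (2 + k) * factz R (l - m) * factz R (l + m) =
    ((l + 1) * (l + 2) * (2 * l + 1) * (2 * l + 3))%:~R * (factz R (2 - k) * factz R (2 + k)) * fact2 l m by rewrite /fact2; ring.
  rewrite -ratio; rewrite DE in high *; rewrite /rcg_den /= -/x /cg_scale.
  transitivity (1 * (Num.sqrt (6%:R * fact2 (l + 2) (m + k)) / Num.sqrt ((x + 1) * (x + 2) * (2 * x + 1) * (2 * x + 3) * (factz R (2 - k) * factz R (2 + k)) *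
      fact2 l m) * Num.sqrt (fact2 (l + 2) (m + k)))); first by ring.
  by rewrite high; ring.
Qed.

End ReducedClebschGordan.

(** * Normalization constants and the reduction of each term of the sum *)

Section SpinorAction.
Variable R : realType.
Implicit Types (k j l m n : int).

(** [Zscale] compares [Z_n] with the quartics of second index [2 + n]; [kscale] holds the
    denominators with which these enter the first diagonal entry of the conjugate of [Z_n], as in
    [Zmx_spin]. *)
Definition Zscale n : R :=
  if n == 0 then Num.sqrt (2 / 3) * 8 else if odd (absz n) then 8 else 16.

Definition kscale k : R := if k == 0 then 48 else 16.

Lemma cg_scaleE : [/\ cg_scale R (-2) = (2 * Num.sqrt 6)^-1, cg_scale R (-1) = (Num.sqrt 6)^-1,
  cg_scale R 0 = 2^-1, cg_scale R 1 = (Num.sqrt 6)^-1 & cg_scale R 2 = (2 * Num.sqrt 6)^-1].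
Proof.
have s4 : Num.sqrt 4 = 2 :> R.
  by rewrite (_ : 4 = 2 ^+ 2) ?sqrtr_sqr ?ger0_norm//; ring.
have s24 : Num.sqrt 24 = 2 * Num.sqrt 6 :> R.
  by rewrite -s4 -sqrtrM//; congr Num.sqrt; ring.
have e (z w : int) (v : nat) : ((absz z)`! * (absz w)`! = v)%N -> factz R z * factz R w = v%:R.
  by move=> <-; rewrite /factz natrM.
split; rewrite /cg_scale; congr (_^-1).
- by rewrite -s24 (e _ _ 24%N).
- by rewrite (e _ _ 6%N).
- by rewrite -s4 (e _ _ 4%N).
- by rewrite (e _ _ 6%N).
- by rewrite -s24 (e _ _ 24%N).
Qed.

Lemma scale_coef k n : k \in [:: -2; 0; 2] -> n \in [:: -2; -1; 0; 1; 2] ->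
  coef_c R k * cg_scale R k * cg_scale R n =
  Zscale n / kscale k * ('C(4, absz (2 + k))%:R * 'C(4, absz (2 + n))%:R / 24).
Proof.
have [c1 c2 c3 c4 c5] := cg_scaleE.
have w0 : Num.sqrt 6 != 0 :> R by rewrite gt_eqF// sqrtr_gt0.
have ww : Num.sqrt 6 * Num.sqrt 6 = 6 :> R by rewrite -expr2 sqr_sqrtr.
have w3 : Num.sqrt (2 / 3) = Num.sqrt 6 / 3 :> R.
  rewrite -[RHS]ger0_norm ?divr_ge0 ?sqrtr_ge0// -sqrtr_sqr; congr Num.sqrt.
  by field: ww.
rewrite !inE => /or3P[]/eqP-> /or4P[/eqP->|/eqP->|/eqP->|/orP[]/eqP->];
  rewrite /coef_c /Zscale /kscale /= ?c1 ?c2 ?c3 ?c4 ?c5 ?w3.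
all: compute_nat.
all: by field: ww.
Qed.

End SpinorAction.

Section TermReduction.
Variable R : realType.
Implicit Types (k j l m n : int).

Lemma rcg_den_ge0 j l : j \in [:: -2; -1; 0; 1; 2] -> 0 <= l -> 0 <= rcg_den j (l%:~R : R).
Proof.
move=> hj hl.
have pos (D : int) (x K : R) : 0 <= D -> D%:~R = x -> 0 <= K -> 0 <= K / x.
  by move=> D0 <- K0; rewrite divr_ge0 // ler0z.
move: hj; rewrite !inE => /or4P[/eqP->|/eqP->|/eqP->|/orP[]/eqP->]; rewrite /rcg_den /=.
- apply: (pos (l * (l - 1) * (2 * l - 1) * (2 * l + 1))) => //; last by ring.
  (* At [l = 0] the factors [l - 1] and [2 l - 1] are negative, but the product is 0. *)
  have [->|l0] := eqVneq l 0; first by [].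
  by rewrite !mulr_ge0 //; lia.
- apply: (pos (l * (l - 1) * (l + 1) * (2 * l + 1))) => //; last by ring.
  have [->|l0] := eqVneq l 0; first by [].
  by rewrite !mulr_ge0 //; lia.
- apply: (pos (l * (l + 1) * (2 * l - 1) * (2 * l + 3))) => //; last by ring.
  have [->|l0] := eqVneq l 0; first by [].
  by rewrite !mulr_ge0 //; lia.
- apply: (pos (l * (l + 1) * (l + 2) * (2 * l + 1))) => //; last by ring.
  by rewrite !mulr_ge0 //; lia.
- apply: (pos ((l + 1) * (l + 2) * (2 * l + 1) * (2 * l + 3))) => //; last by ring.
  by rewrite !mulr_ge0 //; lia.
Qed.

(** Both coefficients carry the same root of [rcg_den j l], so only its square enters. *)
Lemma cg_product k n j l m1 m2 : k \in [:: -2; 0; 2] -> n \in [:: -2; -1; 0; 1; 2] ->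
  j \in [:: -2; -1; 0; 1; 2] -> 0 <= l -> `|m1| <= l -> `|m2| <= l ->
  `|m1 + k| <= l + j -> `|m2 + n| <= l + j ->
  coef_c R k * cg R k j l m1 * cg R n j l m2 * wig_norm R (l + j) (m1 + k) (m2 + n) =
  wig_norm R l m1 m2 * (Zscale R n / kscale R k) * cgprod k n j l%:~R m1%:~R m2%:~R.
Proof.
move=> hk hn hj hl h1 h2 h3 h4.
have hk' : k \in [:: -2; -1; 0; 1; 2] by move: hk; rewrite !inE => /or3P[]/eqP->.
have e1 := cg_reduced R hk' hj h1 h3; have e2 := cg_reduced R hn hj h2 h4.
rewrite !wig_normE.
transitivity (coef_c R k * (cg R k j l m1 * Num.sqrt (fact2 R (l + j) (m1 + k))) *
  (cg R n j l m2 * Num.sqrt (fact2 R (l + j) (m2 + n)))); first by ring.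
rewrite e1 e2 /cgprod.
rewrite -[X in _ = _ * (_ * X * _ * _)](sqr_sqrtr (rcg_den_ge0 hj hl)).
transitivity (coef_c R k * cg_scale R k * cg_scale R n *
  (Num.sqrt (fact2 R l m1) * Num.sqrt (fact2 R l m2) *
   Num.sqrt (rcg_den j l%:~R) ^+ 2 * rcg j k l%:~R m1%:~R * rcg j n l%:~R m2%:~R));
  first by ring.
by rewrite scale_coef//; ring.
Qed.

Lemma cgprodC k n j (x y z : R) :
  (cgprod k n j x y z)%:C = cgprod k n j x%:C y%:C z%:C.
Proof.
have dC : (rcg_den j x)%:C = rcg_den j x%:C.
  rewrite /rcg_den; do !case: ifP => _;
  by rewrite fmorph_div !(rmorph_nat, rmorph1, rmorphM, rmorphB, rmorphD).
by rewrite /cgprod rmorphM rmorph_rcg rmorphM rmorph_rcg rmorphM /= dC fmorph_div rmorphM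
  !rmorph_nat.
Qed.

(** Indices out of range give 0 on both sides, for [wigner] by convention and for [wigU] because
    some exponent is negative; hence the sum needs no side conditions. *)
Lemma term_reduction k n j l m1 m2 (g : 'M[R]_3) (a b c d : R[i]) :
  k \in [:: -2; 0; 2] -> n \in [:: -2; -1; 0; 1; 2] ->
  j \in [:: -2; -1; 0; 1; 2] -> 0 <= l -> `|m1| <= l -> `|m2| <= l -> SO3 g ->
  (forall j s : nat, (j < 3)%N -> (s < 3)%N -> rot_quad (mxC g) j s = spin_quad a b c d j s) ->
  (coef_c R k * cg R k j l m1 * cg R n j l m2)%:C * wigner (l + j) (m1 + k) (m2 + n) g =
  (wig_norm R l m1 m2)%:C * (Zscale R n / kscale R k)%:C *
    (cgprod k n j l%:~R m1%:~R m2%:~R *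
     wigU a b c d (2 * l + 2 * j) (l + j + m1 + k) (l + j + m2 + n)).
Proof.
move=> hk hn hj hl h1 h2 Sg hq.
have [h|h] := boolP ((`|m1 + k| <= l + j) && (`|m2 + n| <= l + j)).
  have /andP[h3 h4] := h; have h0 : 0 <= l + j by lia.
  rewrite wignerE// (wigV_ext _ _ _ hq) wigV_spin.
  have -> : 2 * (absz (l + j))%:Z = 2 * l + 2 * j by lia.
  have -> : l + j + (m1 + k) = l + j + m1 + k by lia.
  have -> : l + j + (m2 + n) = l + j + m2 + n by lia.
  rewrite mulrA -rmorphM /= cg_product// rmorphM /= cgprodC rmorphM /=.
  by rewrite !rmorph_int; ring.
rewrite /wigner ifF; last first.
  by apply/negbTE; move: h; apply: contra => /and3P[_ -> ->].
rewrite mulr0 wigU_out ?mulr0//; apply/negP => /and4P[u1 u2 u3 u4].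
by move/negP: h; apply; apply/andP; split; lia.
Qed.

End TermReduction.

(** * The conjugate of [Z_n] in spinor coordinates *)

Section PiAction.
Variable R : realType.

Definition conjC (K : 'I_3 -> 'I_3 -> R[i]) (Z : 'M[R[i]]_3) (i j : 'I_3) : R[i] :=
  (K i o0 * Z o0 o0 + K i o1 * Z o1 o0 + K i o2 * Z o2 o0) * K j o0 +
  (K i o0 * Z o0 o1 + K i o1 * Z o1 o1 + K i o2 * Z o2 o1) * K j o1 +
  (K i o0 * Z o0 o2 + K i o1 * Z o1 o2 + K i o2 * Z o2 o2) * K j o2.

Lemma conjCE (g : 'M[R]_3) (Z : 'M[R[i]]_3) (i j : 'I_3) :
  ((g *m map_mx (@complex.Re R) Z *m g^T) i j)%:C +
  'i%C * ((g *m map_mx (@complex.Im R) Z *m g^T) i j)%:C = conjC (mxC g) Z i j.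
Proof.
have zE a b : Z a b = (map_mx (@complex.Re R) Z a b)%:C + 'i%C * (map_mx (@complex.Im R) Z a b)%:C.
  by rewrite !mxE; apply: complexP; rewrite /= ?cReM ?cImM ?cReD ?cImD /= ?cReM ?cImM /=; ring.
rewrite /conjC /mxC !zE; move: (map_mx _ Z) (map_mx _ Z) => A B.
by rewrite !mxE !big3 !mxE !big3 !(rmorphD, rmorphM) /=; ring.
Qed.

Lemma Zmx_traceless (n : int) : n \in [:: -2; -1; 0; 1; 2] ->
  \tr (map_mx (@complex.Re R) (Zmx R n)) = 0 /\ \tr (map_mx (@complex.Im R) (Zmx R n)) = 0.
Proof.
rewrite !inE => /or4P[/eqP->|/eqP->|/eqP->|/orP[]/eqP->]; rewrite /Zmx /=;
  by split; rewrite /mxtrace big3 !mxE /=; ring.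
Qed.

(** Solving [rot_quad = spin_quad] for the entries of [K] makes them quadratic in the spinor, so the
    conjugate is quartic. The last two combinations are the coefficients [tp] and [tm] of the
    rotation. *)
Lemma Zmx_spin (n : int) (K : 'I_3 -> 'I_3 -> R[i]) (a b c d : R[i]) :
  n \in [:: -2; -1; 0; 1; 2] ->
  (forall j s : nat, (j < 3)%N -> (s < 3)%N -> rot_quad K j s = spin_quad a b c d j s) ->
  let y := conjC K (Zmx R n) in
  let Q i := poly_eval a b c d (quartic R[i] i (absz (2 + n))) in
  let z := (Zscale R n)%:C in
  [/\ y o0 o0 = z * (Q 4%N / 16 + Q 0%N / 16 + Q 2%N / 48),
      'i%C * y o1 o0 = z * (Q 4%N / 16 - Q 0%N / 16),
      y o2 o2 = - z * Q 2%N / 24,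
      (- y o2 o1 - 'i%C * y o2 o0) / 2 = z * Q 1%N / 32 &
      (y o2 o1 - 'i%C * y o2 o0) / 2 = z * Q 3%N / 32].
Proof.
move=> hn hq.
have JJ : 'i%C * 'i%C = -1 :> R[i] by rewrite -expr2 sqr_i.
have q00 := hq 0%N 0%N isT isT; have q01 := hq 0%N 1%N isT isT; have q02 := hq 0%N 2%N isT isT.
have q10 := hq 1%N 0%N isT isT; have q11 := hq 1%N 1%N isT isT; have q12 := hq 1%N 2%N isT isT.
have q20 := hq 2%N 0%N isT isT; have q21 := hq 2%N 1%N isT isT; have q22 := hq 2%N 2%N isT isT.
rewrite /rot_quad /spin_quad /= in q00 q01 q02 q10 q11 q12 q20 q21 q22.
have K12 : K o1 o2 = b * d - a * c by rewrite -q01 -q21; field.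
have K02 : K o0 o2 = - 'i%C * (b * d + a * c) by rewrite -q01 -q21; field: JJ.
have K21 : K o2 o1 = c * d - a * b by rewrite -q10 -q12; field.
have K20 : K o2 o0 = 'i%C * (c * d + a * b) by rewrite -q10 -q12; field: JJ.
have K00 : K o0 o0 = a ^+ 2 / 2 + b ^+ 2 / 2 + c ^+ 2 / 2 + d ^+ 2 / 2.
  by rewrite -q00 -q02 -q20 -q22; field.
have K11 : K o1 o1 = a ^+ 2 / 2 - b ^+ 2 / 2 - c ^+ 2 / 2 + d ^+ 2 / 2.
  by rewrite -q00 -q02 -q20 -q22; field.
have K10 : K o1 o0 = - 'i%C * (a ^+ 2 / 2 - b ^+ 2 / 2 + c ^+ 2 / 2 - d ^+ 2 / 2).
  by rewrite -q00 -q02 -q20 -q22; field: JJ.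
have K01 : K o0 o1 = - 'i%C * (- (a ^+ 2 / 2) - b ^+ 2 / 2 + c ^+ 2 / 2 + d ^+ 2 / 2).
  by rewrite -q00 -q02 -q20 -q22; field: JJ.
rewrite /conjC q11 K12 K02 K21 K20 K00 K11 K10 K01 {q00 q01 q02 q10 q11 q12 q20 q21 q22 hq}.
move: hn; rewrite !inE => /or4P[/eqP->|/eqP->|/eqP->|/orP[]/eqP->];
  rewrite /Zmx /Zscale /= !mxE /= /quartic /poly_eval /mono_eval /= ?rmorphM ?rmorph_nat /=.
all: by split; field: JJ.
Qed.

End PiAction.

(** * The identity on rotations and its extension *)

Section MainIdentity.
Variable R : realType.
Variables (lam1 lam2 lam3 : R[i]) (l m1 m2 : int).
Hypotheses (hl : 0 <= l) (h1 : `|m1| <= l) (h2 : `|m2| <= l).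
Local Notation f := (@wignerL R lam1 lam2 lam3 l m1 m2).

(** Linear in a complex [y], so that the real and imaginary parts of [Z_n], differentiated
    separately, recombine. *)
Definition bracket (y : 'I_3 -> 'I_3 -> R[i]) (V : int -> R[i]) : R[i] :=
  ((lam3 - 1 - lam2) * y o2 o2 + (1 + lam1 - lam2) * y o0 o0) * V (l + m1) +
  ('i%C * y o1 o0 * m1%:~R * V (l + m1) +
   (- y o2 o1 - 'i%C * y o2 o0) / 2 * (l + m1 + 1)%:~R * V (l + m1 + 1) +
   (y o2 o1 - 'i%C * y o2 o0) / 2 * (2 * l - (l + m1) + 1)%:~R * V (l + m1 - 1)).

Lemma wignerL_pi_real (X g : 'M[R]_3) : SO3 g -> \tr X = 0 ->
  pi_real X f g = (wig_norm R l m1 m2)%:C *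
    bracket (fun i j => ((g *m X *m g^T) i j)%:C)
      (fun i => wigV (absz l) (rot_quad (mxC g)) i (l + m2)).
Proof.
move=> Sg trX; apply: pi_realE.
have Sg' := SO3_SL3 Sg.
have h := cderZ (wig_norm R l m1 m2)%:C (wig_fun_cder Sg trX
  ((lam3 - 1 - lam2) / 2) ((lam2 - 1 - lam1) / 2) (absz l) (l + m1) (l + m2)).
apply: cder_eq (cder_ext _ h) _.
  by move=> t; rewrite wignerL_explicit//; exact: SL3_mul_expmx.
congr (_ * _); rewrite /bracket.
have -> : (2 * (absz l)%:Z - (l + m1) + 1)%:~R = (2 * l - (l + m1) + 1)%:~R :> R[i].
  by congr (_%:~R); lia.
have -> : (2 * (l + m1) - 2 * (absz l)%:Z)%:~R = 2 * m1%:~R :> R[i].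
  by rewrite (_ : 2 * (l + m1) - 2 * (absz l)%:Z = 2 * m1) ?intrM//; lia.
rewrite !(rmorph_nat, rmorphM, rmorphN) /=.
by field.
Qed.

Lemma pi_act_rotation n (g : 'M[R]_3) : n \in [:: -2; -1; 0; 1; 2] -> SO3 g ->
  pi_act (Zmx R n) f g = (wig_norm R l m1 m2)%:C *
    bracket (conjC (mxC g) (Zmx R n))
      (fun i => wigV (absz l) (rot_quad (mxC g)) i (l + m2)).
Proof.
move=> hn Sg; have [t1 t2] := Zmx_traceless R hn.
rewrite /pi_act !wignerL_pi_real// mulrCA -mulrDr; congr (_ * _).
by rewrite /bracket -!conjCE; ring.
Qed.

Lemma main_identity_rotation n (g : 'M[R]_3) : n \in [:: -2; -1; 0; 1; 2] -> SO3 g ->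
  pi_act (Zmx R n) f g =
    \sum_(j <- [:: -2; -1; 0; 1; 2] : seq int) \sum_(k <- [:: -2; 0; 2] : seq int)
      (coef_c R k * cg R k j l m1 * cg R n j l m2)%:C *
      Lambda k j lam1 lam2 lam3 l m1 *
      wignerL lam1 lam2 lam3 (l + j) (m1 + k) (m2 + n) g.
Proof.
move=> hn Sg; have [a [b [c [d [abcd hq]]]]] := spinors_exist Sg.
rewrite pi_act_rotation//.
have VU i : wigV (absz l) (rot_quad (mxC g)) i (l + m2) = wigU a b c d (2 * l) i (l + m2).
  by rewrite (wigV_ext _ _ _ hq) wigV_spin gez0_abs.
have [y00 y10 y22 yp ym] := Zmx_spin hn hq.
rewrite /bracket !VU y00 y10 y22 yp ym.
have q2 := @quartic_identity_holds _ _ _ _ _ abcd l m1 m2 2 n isT hn h1 h2.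
have qm2 := @quartic_identity_holds _ _ _ _ _ abcd l m1 m2 (-2) n isT hn h1 h2.
have q0 := @quartic_identity_holds _ _ _ _ _ abcd l m1 m2 0 n isT hn h1 h2.
have qd := @deriv_identity_holds _ _ _ _ _ abcd l m1 m2 n hn h1 h2.
rewrite /quartic_identity /deriv_identity in q2 qm2 q0 qd.
rewrite -[absz (2 + 2)]/4%N in q2; rewrite -[absz (2 - 2)]/0%N in qm2.
rewrite -[absz (2 + 0)]/2%N in q0.
(* [G] stays abstract, so that [ring] and [field] see each product of a coefficient and a [wigU] as
   one unknown. *)
have [G hG] : exists G : int -> int -> R[i], forall k j, G k j =
    cgprod k n j l%:~R m1%:~R m2%:~R *
    wigU a b c d (2 * l + 2 * j) (l + j + m1 + k) (l + j + m2 + n) by eexists.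
have {}q2 := etrans q2 (eq_bigr _ (fun j _ => esym (hG 2 j))).
have {}qm2 := etrans qm2 (eq_bigr _ (fun j _ => esym (hG (-2) j))).
have {}q0 := etrans q0 (eq_bigr _ (fun j _ => esym (hG 0 j))).
have dG (j : int) : ((j * l)%:~R + (j + j ^+ 2)%:~R / 2) * cgprod 0 n j l%:~R m1%:~R m2%:~R *
    wigU a b c d (2 * l + 2 * j) (l + j + m1 + 0) (l + j + m2 + n) =
    ((j * l)%:~R + (j + j ^+ 2)%:~R / 2) * G 0 j.
  by rewrite hG -[LHS]mulrA.
have {}qd := etrans qd (eq_bigr _ (fun j _ => dG j)).
have term j k : j \in [:: -2; -1; 0; 1; 2] -> k \in [:: -2; 0; 2] ->
   (coef_c R k * cg R k j l m1 * cg R n j l m2)%:C * Lambda k j lam1 lam2 lam3 l m1 *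
      wignerL lam1 lam2 lam3 (l + j) (m1 + k) (m2 + n) g =
   (wig_norm R l m1 m2)%:C * (Zscale R n)%:C *
     ((kscale R k)^-1%:C * G k j * Lambda k j lam1 lam2 lam3 l m1).
  move=> hj hk; rewrite /wignerL lb_ext_SO3// mulrAC (term_reduction hk hn hj hl h1 h2 Sg hq).
  by rewrite rmorphM /= -hG; ring.
have tsum j : j \in [:: -2; -1; 0; 1; 2] -> \sum_(k <- [:: -2; 0; 2] : seq int)
      (coef_c R k * cg R k j l m1 * cg R n j l m2)%:C *
      Lambda k j lam1 lam2 lam3 l m1 *
      wignerL lam1 lam2 lam3 (l + j) (m1 + k) (m2 + n) g =
   (wig_norm R l m1 m2)%:C * (Zscale R n)%:C *
   (16^-1 * G (-2) j * (lam1 - lam2 + 1 - m1%:~R) +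
    48^-1 * G 0 j * (lam1 + lam2 - 2 * lam3 + ((j * l)%:~R + (j + j ^+ 2)%:~R / 2)) +
    16^-1 * G 2 j * (lam1 - lam2 + 1 + m1%:~R)).
  have k16 : (16^-1 : R)%:C = 16^-1 by rewrite fmorphV rmorph_nat.
  have k48 : (48^-1 : R)%:C = 48^-1 by rewrite fmorphV rmorph_nat.
  move=> hj; rewrite !big_cons big_nil (term j (-2) hj isT) (term j 0 hj isT) (term j 2 hj isT).
  rewrite -[kscale R (-2)]/16 -[kscale R 0]/48 -[kscale R 2]/16 k16 k48.
  rewrite /Lambda /=; move: (G (-2) j) (G 0 j) (G 2 j) => G1 G2 G3.
  move: (wig_norm R l m1 m2)%:C (Zscale R n)%:C => W Z.
  by ring.
rewrite (eq_big_seq _ tsum) -mulr_sumr -[RHS]mulrA; congr (_ * _).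
move: (Zscale R n)%:C q2 qm2 q0 qd => {y00 y10 y22 yp ym term tsum hG VU dG} Z.
set u := wigU a b c d (2 * l) (l + m1) (l + m2).
set up := wigU a b c d (2 * l) (l + m1 + 1) (l + m2).
set um := wigU a b c d (2 * l) (l + m1 - 1) (l + m2).
move: (poly_eval a b c d (quartic R[i] 0 _)) (poly_eval a b c d (quartic R[i] 1 _))
  (poly_eval a b c d (quartic R[i] 2 _)) (poly_eval a b c d (quartic R[i] 3 _))
  (poly_eval a b c d (quartic R[i] 4 _)) => Q0 Q1 Q2 Q3 Q4.
move: u up um => u up um q2 qm2 q0 qd.
(* The [Q2] terms from [y00] and [y22] add up to [(lam1 + lam2 - 2 lam3 + 3) / 48]; the surplus 3 is
   the term [3 / 2 * 2] of the Casimir identity. The difference [m1 (Q4 - Q0) / 16] supplies [m1] in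
   [Lambda] for [k = 2] and [k = -2]. *)
transitivity (Z * (16^-1 * (lam1 - lam2 + 1 - m1%:~R) * (Q0 * u) +
   48^-1 * (lam1 + lam2 - 2 * lam3) * (Q2 * u) +
   48^-1 * (3 / 2 * (2 * (Q2 * u) + (l + m1 + 1)%:~R * (Q1 * up) +
        (2 * l - (l + m1) + 1)%:~R * (Q3 * um))) +
   16^-1 * (lam1 - lam2 + 1 + m1%:~R) * (Q4 * u))).
  by field.
congr (_ * _); rewrite qd q2 qm2 q0 !big_cons !big_nil; by field.
Qed.

(** Left multiplication by [p] commutes with right translation along the curve, so the character is
    a constant factor under the derivative. *)
Lemma pi_act_equivariant (Z : 'M[R[i]]_3) (p g : 'M[R]_3) : borel3 p -> SL3 g ->
  \tr (map_mx (@complex.Re R) Z) = 0 -> \tr (map_mx (@complex.Im R) Z) = 0 ->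
  pi_act Z f (p *m g) = lb_char lam1 lam2 lam3 p * pi_act Z f g.
Proof.
move=> bp Sg tr1 tr2.
have E X : \tr X = 0 -> pi_real X f (p *m g) = lb_char lam1 lam2 lam3 p * pi_real X f g.
  move=> trX; have [f' _ H] := elementary_derivative (wignerL_elementary lam1 lam2 lam3 hl h1 h2) trX.
  rewrite (pi_realE (H g Sg)); apply: pi_realE.
  apply: cder_ext (cderZ _ (H g Sg)) => t.
  by rewrite -mulmxA /wignerL (lb_ext_equivariant _ _ _ _ bp)//; exact: SL3_mul_expmx.
by rewrite /pi_act (E _ tr1) (E _ tr2) mulrDr [in RHS]mulrCA.
Qed.

End MainIdentity.

Theorem theorem5p1 (R : realType) (lam1 lam2 lam3 : R[i])
    (hlam : lam1 + lam2 + lam3 = 0)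
    (l m1 m2 n : int) (hl : 0 <= l) (hm1 : `|m1| <= l) (hm2 : `|m2| <= l)
    (hn : n \in [:: -2; -1; 0; 1; 2]) :
  line_bundle lam1 lam2 lam3 (wignerL lam1 lam2 lam3 l m1 m2) /\
  forall g : 'M[R]_3, SL3 g ->
    pi_act (Zmx R n) (wignerL lam1 lam2 lam3 l m1 m2) g =
    \sum_(j <- [:: -2; -1; 0; 1; 2] : seq int) \sum_(k <- [:: -2; 0; 2] : seq int)
      (coef_c R k * cg R k j l m1 * cg R n j l m2)%:C *
      Lambda k j lam1 lam2 lam3 l m1 *
      wignerL lam1 lam2 lam3 (l + j) (m1 + k) (m2 + n) g.
Proof.
split; first split.
- exact/elementary_smooth/wignerL_elementary.
- by move=> p g bp Sg; exact: lb_ext_equivariant.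
move=> g Sg; have [t1 t2] := Zmx_traceless R hn.
have bp := iwasawa_exists Sg; have Sk := kpart_SO3 Sg.
rewrite (iwasawa_decomp Sg) pi_act_equivariant//; last exact: SO3_SL3.
rewrite main_identity_rotation// mulr_sumr; apply: eq_bigr => j _.
rewrite mulr_sumr; apply: eq_bigr => k _.
by rewrite /wignerL (lb_ext_equivariant _ _ _ _ bp (SO3_SL3 Sk)) mulrCA.
Qed.
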